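(* If $a\in S^\infty_{1,0}(\mathbb{R}^n\times\mathbb{R}^n)$ and $\mathcal{K}(\xi,\eta)=(2\pi)^{-n}\hat a(\xi-\eta,\eta)$ is the distribution kernel of $\mathcal{F}a(x,D)\mathcal{F}^{-1}$, then $$\operatorname{supp}\mathcal{F}a(x,D)u\subset\overline{\operatorname{supp}\mathcal{K}\circ\operatorname{supp}\mathcal{F}u}\quad\text{for every }u\in\mathcal{S}'(\mathbb{R}^n).$$ Here the set $\operatorname{supp}\mathcal{K}\circ\operatorname{supp}\mathcal{F}u$ is closed if $\operatorname{supp}\mathcal{F}u$ is compact.
   Context: Fourier transform: $\mathcal{F}u(\xi)=\int e^{-i x\cdot\xi}u(x)\,dx$; for a symbol, $\hat a(\xi,\eta)=\mathcal{F}_{x\to\xi}a(\xi,\eta)$ is the partial Fourier transform in $x$ (in the sense of $\mathcal{S}'(\mathbb{R}^{2n})$). $S^\infty_{1,0}=\bigcup_{d\in\mathbb{R}}S^d_{1,0}$, where $S^d_{1,0}(\mathbb{R}^n\times\mathbb{R}^n)$ is the set of $a\in C^\infty(\mathbb{R}^{2n})$ with $|D^\alpha_\eta D^\beta_x a(x,\eta)|\le C_{\alpha,\beta}(1+|\eta|)^{d-|\alpha|}$ for all multiindices $\alpha,\beta$. $a(x,D)$ is the unique continuous linear extension $\mathcal{S}'(\mathbb{R}^n)\to\mathcal{S}'(\mathbb{R}^n)$ of $a(x,D)u(x)=(2\pi)^{-n}\int e^{i x\cdot\eta}a(x,\eta)\mathcal{F}u(\eta)\,d\eta$, $u\in\mathcal{S}(\mathbb{R}^n)$.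 $\operatorname{supp}\mathcal{K}\circ\operatorname{supp}\mathcal{F}u=\{\xi\in\mathbb{R}^n\mid\exists\eta\in\operatorname{supp}\mathcal{F}u:\ (\xi,\eta)\in\operatorname{supp}\mathcal{K}\}$. *)

(* Defs.v *)
From HB Require Import structures.
From mathcomp Require Import all_boot all_order all_algebra.
From mathcomp Require Import all_classical all_reals all_analysis.
From mathcomp Require Import complex.

Set Implicit Arguments.
Unset Strict Implicit.
Unset Printing Implicit Defensive.

Import Order.TTheory GRing.Theory Num.Theory.
Import numFieldNormedType.Exports.

Local Open Scope classical_set_scope.
Local Open Scope ring_scope.
Local Open Scope complex_scope.

(* R[i] gets the topology of its modulus; the generic numFieldType instances are
   not found on the concrete type R[i]. *)
HB.instance Definition _ (R : realType) := NormedModule.copy R[i] R[i]^o.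

(* The Lebesgue measure of R^n is built on n.-tuple, which carries the product
   sigma-algebra, as the n-fold product of the one-dimensional one. *)
Section lebesgue_measure_Rn.
Variable R : realType.
Local Notation T := (measurableTypeR R).

Definition cons_pair n (p : T * n.-tuple T) : n.+1.-tuple T :=
  [tuple of p.1 :: p.2].

Lemma measurable_cons_pair n : measurable_fun setT (@cons_pair n).
Proof. by apply: measurable_cons. Qed.

Section step.
Variables (n : nat) (m : {sigma_finite_measure set (n.-tuple T) -> \bar R}).

Definition lebesgue_cons : set (n.+1.-tuple T) -> \bar R :=
  pushforward (lebesgue_measure \x m)%E (@cons_pair n).

HB.instance Definition _ := Measure.copy lebesgue_cons
  (measure_function_pushforward__canonical__measure_function_Measure
     (lebesgue_measure \x m)%E (@measurable_cons_pair n)).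

Lemma lebesgue_cons_sigma_finite : sigma_finite setT lebesgue_cons.
Proof.
have /sigma_finiteP[F [FT ndF Foo]] := sigma_finiteT (@lebesgue_measure R).
have /sigma_finiteP[G [GT ndG Goo]] := sigma_finiteT m.
pose uncons (t : n.+1.-tuple T) : T * n.-tuple T := (thead t, [tuple of behead t]).
have muncons : measurable_fun setT uncons.
  apply: measurable_fun_pair; first exact: (@measurable_tnth _ _ _ ord0).
  exact: measurable_behead.
have unconsK : cancel (@cons_pair n) uncons.
  by case=> x t; rewrite /uncons /cons_pair /= theadE; congr pair; exact/val_inj.
exists (fun i => uncons @^-1` (F i `*` G i)).
  rewrite -preimage_bigcup (_ : \bigcup_i _ = setT) ?preimage_setT//.
  apply/seteqP; split=> // -[x t] _.
  have [i _ Fix] : (\bigcup_i F i) x by rewrite -FT.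
  have [j _ Gjt] : (\bigcup_i G i) t by rewrite -GT.
  exists (maxn i j) => //; split => /=.
    by move: x Fix; exact/subsetPset/ndF/leq_maxl.
  by move: t Gjt; exact/subsetPset/ndG/leq_maxr.
move=> i; have [mF Fi] := Foo i; have [mG Gi] := Goo i.
split.
  by rewrite -[X in measurable X]setTI; apply: muncons => //; exact: measurableX.
rewrite /lebesgue_cons /pushforward (_ : _ @^-1` _ = F i `*` G i).
  by rewrite product_measure1E// lte_mul_pinfty// ge0_fin_numE.
by apply/funext => p; exact: (f_equal (F i `*` G i) (unconsK p)).
Qed.

HB.instance Definition _ := Measure_isSigmaFinite.Build _ _ _ lebesgue_cons
  lebesgue_cons_sigma_finite.
End step.

Fixpoint lebesgue_tuple n : {sigma_finite_measure set (n.-tuple T) -> \bar R} :=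
  if n is n'.+1 then lebesgue_cons (lebesgue_tuple n')
  else \d_ [tuple].

End lebesgue_measure_Rn.

Section integral_Rn.
Variables (R : realType) (n : nat).

Definition row_of_tuple (t : n.-tuple (measurableTypeR R)) : 'rV[R]_n :=
  \row_i tnth t i.

Definition integralC (f : 'rV[R]_n -> R[i]) : R[i] :=
  (\int[lebesgue_tuple R n]_t complex.Re (f (row_of_tuple t))) +i*
  (\int[lebesgue_tuple R n]_t complex.Im (f (row_of_tuple t))).

Definition dot (x y : 'rV[R]_n) : R := \sum_i x 0 i * y 0 i.

Definition euclidean_norm (x : 'rV[R]_n) : R := Num.sqrt (\sum_i x 0 i ^+ 2).

End integral_Rn.

Definition expi (R : realType) (t : R) : R[i] := cos t +i* sin t.

Section derivatives.
Variables (R : realType) (N : nat).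
Local Notation E := 'rV[R]_N.
Implicit Types f g : E -> R[i].

Definition partial (i : 'I_N) f : E -> R[i] := fun x =>
  ('D_(delta_mx 0 i) (@complex.Re R \o f) x) +i*
  ('D_(delta_mx 0 i) (@complex.Im R \o f) x).

(* Complex-valued functions are differentiated componentwise: R[i] is not a
   normed module over R. *)
Definition has_partial (i : 'I_N) f := forall x : E,
  derivable (@complex.Re R \o f) x (delta_mx 0 i) /\
  derivable (@complex.Im R \o f) x (delta_mx 0 i).

(* Multiindices are words: s = [:: i1; ...; ik] encodes d_i1 ... d_ik, of order
   size s, and the monomial x_i1 ... x_ik. On smooth functions the order of the
   letters is immaterial, and D = -i d has the same modulus as d. *)
Definition partials (s : seq 'I_N) f : E -> R[i] := foldr partial f s.

Definition smooth f := forall s : seq 'I_N,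
  continuous (partials s f) /\ forall i, has_partial i (partials s f).

Definition monomial (s : seq 'I_N) (x : E) : R := \prod_(i <- s) x 0 i.

Definition weighted (s t : seq 'I_N) f : E -> R[i] := fun x =>
  (monomial s x)%:C * partials t f x.

Definition is_schwartz f : Prop := smooth f /\
  forall s t, exists M : R, forall x, `|weighted s t f x| <= M%:C.

Definition schwartz : {pred E -> R[i]} := fun f => `[< is_schwartz f >].

Lemma has_partial_lin i (c : R[i]) f g : has_partial i f -> has_partial i g ->
  has_partial i (c *: f + g) /\
  partial i (c *: f + g) = c *: partial i f + partial i g.
Proof.
move=> df dg.
have Ere : @complex.Re R \o (c *: f + g) =
    complex.Re c *: (@complex.Re R \o f) - complex.Im c *: (@complex.Im R \o f)
    + (@complex.Re R \o g).
  by apply/funext => x; rewrite !fctE /=; case: (c) (f x) (g x) => [? ?] [? ?] [].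
have Eim : @complex.Im R \o (c *: f + g) =
    complex.Re c *: (@complex.Im R \o f) + complex.Im c *: (@complex.Re R \o f)
    + (@complex.Im R \o g).
  by apply/funext => x; rewrite !fctE /=; case: (c) (f x) (g x) => [? ?] [? ?] [].
split.
  move=> x; have [fr fi] := df x; have [gr gi] := dg x.
  rewrite Ere Eim; split; apply: derivableD => //.
    by apply: derivableB; apply: derivableZ.
  by apply: derivableD; apply: derivableZ.
apply/funext => x; have [fr fi] := df x; have [gr gi] := dg x.
rewrite /partial Ere Eim.
rewrite deriveD//; last by apply: derivableB; apply: derivableZ.
rewrite deriveB ?deriveZ//; try exact: derivableZ.
rewrite deriveD//; last by apply: derivableD; apply: derivableZ.
rewrite deriveD ?deriveZ//; try exact: derivableZ.
by rewrite !fctE; case: (c).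
Qed.

Lemma partials_lin s (c : R[i]) f g : smooth f -> smooth g ->
  partials s (c *: f + g) = c *: partials s f + partials s g.
Proof.
move=> sf sg; elim: s => //= i s ->.
by have [_ ->] := has_partial_lin c (proj2 (sf s) i) (proj2 (sg s) i).
Qed.

Lemma smooth_lin (c : R[i]) f g : smooth f -> smooth g -> smooth (c *: f + g).
Proof.
move=> sf sg s; rewrite partials_lin//; have [cf df] := sf s.
have [cg dg] := sg s; split; last by move=> i; have [] := has_partial_lin c (df i) (dg i).
move=> x; apply: continuousD; last exact: cg.
by apply: continuousZl_tmp; exact: cf.
Qed.

Lemma smooth0 : smooth (0 : E -> R[i]).
Proof.
have re0 : @complex.Re R \o (0 : E -> R[i]) = cst 0 by [].
have im0 : @complex.Im R \o (0 : E -> R[i]) = cst 0 by [].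
have d0 i : partial i 0 = 0.
  apply/funext => x; rewrite /partial re0 im0 !derive_cst; exact: erefl.
have p0 s : partials s 0 = 0 by elim: s => //= i s ->.
move=> s; rewrite p0; split; first exact: cst_continuous.
by move=> i x; rewrite re0 im0; split; exact: derivable_cst.
Qed.

Lemma schwartz_submod_closed : submod_closed schwartz.
Proof.
split.
  apply/asboolP; split; first exact: smooth0.
  move=> s t; exists 0 => x; rewrite /weighted.
  have -> : partials t (0 : E -> R[i]) = 0.
    have := partials_lin t (-1) smooth0 smooth0.
    by rewrite scaler0 addr0 scaleN1r addNr.
  by rewrite [X in _ * X](_ : _ = 0)// mulr0 normr0.
move=> c f g /asboolP[sf bf] /asboolP[sg bg]; apply/asboolP.
split; first exact: smooth_lin.
move=> s t; have [M Mf] := bf s t; have [M' Mg] := bg s t.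
have [k kE] : exists k : R, `|c| = k%:C by exists (Normc.normc c).
exists (k * M + M') => x.
have -> : (k * M + M')%:C = `|c| * M%:C + M'%:C by rewrite kE rmorphD rmorphM.
rewrite /weighted partials_lin// mulrDr mulrCA.
apply: (le_trans (ler_normD _ _)); rewrite lerD//; last exact: Mg.
by rewrite normrM ler_wpM2l//; exact: Mf.
Qed.

HB.instance Definition _ := GRing.isSubmodClosed.Build R[i] (E -> R[i])
  schwartz schwartz_submod_closed.

End derivatives.

Section schwartz_space.
Variables (R : realType) (N : nat).
Local Notation E := 'rV[R]_N.

Record Schwartz := MkSchwartz {
  schwartz_fun :> E -> R[i] ;
  _ : schwartz_fun \in @schwartz R N }.

HB.instance Definition _ := [isSub for schwartz_fun].
HB.instance Definition _ := [Choice of Schwartz by <:].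
HB.instance Definition _ := [SubChoice_isSubLmodule of Schwartz by <:].

(* The topology of S(R^N) is the one of its seminorms sup |x^s d^t phi|, i.e. the
   coarsest making phi |-> x^s d^t phi continuous for uniform convergence. *)
Definition weighted_family (phi : Schwartz) :
    prod_topology (fun _ : seq 'I_N * seq 'I_N => {uniform E -> R[i]}) :=
  fun st => weighted st.1 st.2 phi.

HB.instance Definition _ :=
  Topological.copy Schwartz (initial_topology weighted_family).

(* Total version of the inclusion: f itself when f is a Schwartz function (as in
   every use below), and 0 otherwise. *)
Definition to_schwartz (f : E -> R[i]) : Schwartz := insubd 0 f.

Definition is_tempered (u : Schwartz -> R[i]) : Prop := linear u /\ continuous u.

Definition tempered : {pred Schwartz -> R[i]} := fun u => `[< is_tempered u >].

Lemma tempered_submod_closed : submod_closed tempered.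
Proof.
split.
  apply/asboolP; split; last exact: cst_continuous.
  have z0 w : (0 : Schwartz -> R[i]) w = 0 by [].
  by move=> a x y; rewrite !z0 scaler0 addr0.
move=> c u v /asboolP[lu cu] /asboolP[lv cv]; apply/asboolP; split.
  move=> a x y; rewrite !fctE lu lv !scalerDr addrACA; congr (_ + _ + (_ + _)).
  exact: mulrCA.
move=> x; apply: continuousD; last exact: cv.
by apply: continuousZl_tmp; exact: cu.
Qed.

HB.instance Definition _ := GRing.isSubmodClosed.Build R[i] (Schwartz -> R[i])
  tempered tempered_submod_closed.

Record Tempered := MkTempered {
  tempered_fun :> Schwartz -> R[i] ;
  _ : tempered_fun \in tempered }.

HB.instance Definition _ := [isSub for tempered_fun].
HB.instance Definition _ := [Choice of Tempered by <:].
HB.instance Definition _ := [SubChoice_isSubLmodule of Tempered by <:].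

(* S'(R^N) has the weak-* topology. *)
HB.instance Definition _ := Topological.copy Tempered
  (initial_topology (tempered_fun : Tempered -> {ptws Schwartz -> R[i]})).

(* The distribution phi |-> int f phi defined by the function f. *)
Definition regular (f : E -> R[i]) : Schwartz -> R[i] :=
  fun phi => integralC (fun x => f x * phi x).

(* Schwartz functions with compact support in U are exactly the elements of
   C_c^oo(U). *)
Definition vanishes_on (u : Schwartz -> R[i]) (U : set E) : Prop :=
  forall phi : Schwartz,
    compact (closure [set x | phi x != 0]) ->
    closure [set x | phi x != 0] `<=` U -> u phi = 0.

Definition supp (u : Schwartz -> R[i]) : set E :=
  ~` \bigcup_(U in [set U | open U /\ vanishes_on u U]) U.

Definition fourier (f : E -> R[i]) (xi : E) : R[i] :=
  integralC (fun x => expi (- dot x xi) * f x).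

Definition inv_fourier (f : E -> R[i]) (x : E) : R[i] :=
  ((2 * pi) ^- N)%:C * integralC (fun xi => expi (dot x xi) * f xi).

(* Operations on distributions are transposes: <F u, phi> = <u, F phi>. *)
Definition fourierD (u : Schwartz -> R[i]) : Schwartz -> R[i] :=
  fun phi => u (to_schwartz (fourier phi)).

Definition inv_fourierD (u : Schwartz -> R[i]) : Schwartz -> R[i] :=
  fun phi => u (to_schwartz (inv_fourier phi)).

End schwartz_space.

(* A point (x, eta) of R^n x R^n is row_mx x eta : 'rV_(n + n). *)
Section pseudodifferential.
Variables (R : realType) (n : nat).
Local Notation E := 'rV[R]_n.
Local Notation EE := 'rV[R]_(n + n).

Definition symbol_class (d : R) : set (EE -> R[i]) := [set a | smooth a /\
  forall alpha beta : seq 'I_n, exists C : R, forall x eta : E,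
    `| partials (map (@rshift n n) alpha)
         (partials (map (@lshift n n) beta) a) (row_mx x eta) |
    <= (C * (1 + euclidean_norm eta) `^ (d - (size alpha)%:R))%:C].

Definition symbols : set (EE -> R[i]) := \bigcup_d symbol_class d.

Definition psdo_fun (a : EE -> R[i]) (phi : E -> R[i]) (x : E) : R[i] :=
  ((2 * pi) ^- n)%:C *
  integralC (fun eta => expi (dot x eta) * a (row_mx x eta) * fourier phi eta).

(* A = a(x,D): the continuous linear map on S' that sends the distribution given
   by phi in S to the one given by the function a(x,D)phi. *)
Definition is_psdo (a : EE -> R[i]) (A : Tempered R n -> Tempered R n) : Prop :=
  [/\ linear A, continuous A &
    forall (phi : Schwartz R n) (v : Tempered R n),
      v =1 regular phi -> A v =1 regular (psdo_fun a phi)].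

Definition partial_fourier (f : EE -> R[i]) (z : EE) : R[i] :=
  integralC (fun x : E => expi (- dot x (lsubmx z)) * f (row_mx x (rsubmx z))).

Definition partial_fourierD (u : Schwartz R (n + n) -> R[i]) :
    Schwartz R (n + n) -> R[i] :=
  fun phi => u (to_schwartz (partial_fourier phi)).

(* u(xi - eta, eta): the change of variables (xi, eta) |-> (xi - eta, eta) has
   determinant 1 and inverse (zeta, eta) |-> (zeta + eta, eta). *)
Definition shearD (u : Schwartz R (n + n) -> R[i]) :
    Schwartz R (n + n) -> R[i] :=
  fun phi => u (to_schwartz
    (fun z => phi (row_mx (lsubmx z + rsubmx z) (rsubmx z)))).

(* K(xi, eta) = (2 pi)^-n hat a(xi - eta, eta). *)
Definition psdo_kernel (a : EE -> R[i]) : Schwartz R (n + n) -> R[i] :=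
  fun phi => ((2 * pi) ^- n)%:C * shearD (partial_fourierD (regular a)) phi.

Definition tensor (f g : E -> R[i]) (z : EE) : R[i] :=
  f (lsubmx z) * g (rsubmx z).

(* K is the Schwartz kernel of F A F^-1:
   <F A F^-1 phi, psi> = <K, psi (x) phi>. *)
Definition is_conjugate_kernel (A : Tempered R n -> Tempered R n)
    (K : Schwartz R (n + n) -> R[i]) : Prop :=
  forall (phi psi : Schwartz R n) (v : Tempered R n),
    v =1 inv_fourierD (regular phi) ->
    fourierD (A v) psi = K (to_schwartz (tensor psi phi)).

(* The composite K o B of a relation K with a set B. *)
Definition compose (K : set EE) (B : set E) : set E :=
  [set xi | exists2 eta, B eta & K (row_mx xi eta)].

End pseudodifferential.

(* Main.v *)
Require Import Defs.
From mathcomp Require Import all_boot all_order all_algebra.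
From mathcomp Require Import all_classical all_reals all_analysis.
From mathcomp Require Import measurable_realfun complex ring lra.

Set Implicit Arguments.
Unset Strict Implicit.
Unset Printing Implicit Defensive.

Import Order.TTheory GRing.Theory Num.Theory.
Import numFieldNormedType.Exports.
Import Normc.

Local Open Scope classical_set_scope.
Local Open Scope ring_scope.
Local Open Scope complex_scope.

(** Notation: [F] is the Fourier transform, [S] the Schwartz space, [S'] its dual,
    [K] the kernel of [F A F^-1], and [int] an integral over [R^n].

    The kernel. If [u] is given by [F^-1 phi] with [phi] in [S], then [A u] is the
    function [x |-> (2 pi)^-n int e^(i x.eta) a(x, eta) phi(eta) d eta], and its
    pairing with [F psi] is an absolutely convergent double integral. In that
    integral [e^(i x.eta) phi(eta) F psi(x)] is the partial Fourier transform of
    [psi(zeta + eta) phi(eta)], which is the definition of [K] tested on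
    [psi (x) phi] ([psdo_conjugate_kernel]). This rests on the inversion formula
    ([fourier_inv_fourier]) and on the stability of Schwartz functions under the
    partial Fourier transform, affine maps and tensor products.

    The support. Let [psi] be a test function whose support is compact and does
    not meet the composite of [supp K] and [supp F u]; the claim is that
    [<F A u, psi> = 0] ([psdo_fourier_local]). The functional
    [w |-> <F A w, psi>] is linear and weak-* continuous on [S'], hence it is the
    pairing [w |-> <F w, h>] with one function [h] of [S]
    ([weak_star_functional]). For [w] with [F w = phi] in [S] this reads
    [int phi h = K(psi (x) phi)]. Let [eta] be a point of [supp F u]. The compact
    set [supp psi x {eta}] misses the closed set [supp K], and so does
    [supp psi x B] for a small ball [B] around [eta] ([tube_left]). Therefore
    [int phi h = 0] for every [phi] supported in [B] ([localization]), and [h] is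
    zero near [eta] ([schwartz_annihilated]). So [h] vanishes in a neighbourhood
    of [supp F u], and [<F u, h> = 0]: this is clear for the product of [h] with a
    compactly supported cutoff, and these products converge to [h] in [S]
    ([fourierD_flat], [cutoff_family]).

    Closedness. When [supp F u] is compact, a point outside the composite has a
    neighbourhood outside it, by compactness again ([closed_compose]).

    The facts on [S] are proved for families of functions bounded, in every
    seminorm, by a constant times a given rate ([schwartz_family]). One argument
    then shows both that an operation preserves [S] and that it preserves null
    sequences. Membership is obtained by coinduction: it suffices that a class of
    rapidly decaying families is stable under derivation, up to finite sums
    ([schwartz_family_coind]). *)

(** * Complex numbers and directional derivatives *)

Section complex_modulus.
Variable R : realType.
Implicit Types z w : R[i].
Local Notation Re := (@complex.Re R).
Local Notation Im := (@complex.Im R).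

Lemma normcE z : `|z| = (normc z)%:C. Proof. by []. Qed.

Lemma Re_mul z w : Re (z * w) = Re z * Re w - Im z * Im w.
Proof. by case: z w => [? ?] []. Qed.

Lemma Im_mul z w : Im (z * w) = Re z * Im w + Im z * Re w.
Proof. by case: z w => [? ?] [] ? ? /=; rewrite [X in _ + X]mulrC. Qed.

Lemma Re_add z w : Re (z + w) = Re z + Re w.
Proof. by case: z w => [? ?] []. Qed.

Lemma Im_add z w : Im (z + w) = Im z + Im w.
Proof. by case: z w => [? ?] []. Qed.

Lemma Re_opp z : Re (- z) = - Re z. Proof. by case: z. Qed.

Lemma Im_opp z : Im (- z) = - Im z. Proof. by case: z. Qed.

Definition ReImE := (Re_mul, Im_mul, Re_add, Im_add, Re_opp, Im_opp).

Lemma normc_ge0 z : 0 <= normc z.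
Proof. by rewrite -lecR; exact: (normr_ge0 z). Qed.

Lemma normc_Re z : `|Re z| <= normc z.
Proof.
by case: z => a b /=; rewrite -sqrtr_sqr ler_sqrt ?lerDl ?addr_ge0 ?sqr_ge0.
Qed.

Lemma normc_Im z : `|Im z| <= normc z.
Proof.
by case: z => a b /=; rewrite -sqrtr_sqr ler_sqrt ?lerDr ?addr_ge0 ?sqr_ge0.
Qed.

Lemma normc_ReIm z : normc z <= `|Re z| + `|Im z|.
Proof.
case: z => a b /=; rewrite -[leRHS]ger0_norm ?addr_ge0// -sqrtr_sqr.
rewrite ler_sqrt ?sqr_ge0// sqrrD !real_normK ?num_real//.
by rewrite lerD2r lerDl mulrn_wge0// mulr_ge0.
Qed.

Lemma normc_real (x : R) : normc x%:C = `|x|.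
Proof. by rewrite /= expr0n/= addr0 sqrtr_sqr. Qed.

Lemma normc_expi (t : R) : normc (expi t) = 1.
Proof. by rewrite /= cos2Dsin2 sqrtr1. Qed.

Lemma expiD (s t : R) : expi (s + t) = expi s * expi t.
Proof. by rewrite /expi cosD sinD; congr (_ +i* _); rewrite addrC. Qed.

Lemma expi0 : expi (0 : R) = 1.
Proof. by rewrite /expi cos0 sin0. Qed.

(** The topology of [R[i]] is that of the modulus, while derivatives and integrals
    are taken componentwise; this is the bridge between the two. *)
Lemma continuous_ReIm (T : topologicalType) (f : T -> R[i]) :
  continuous f <-> continuous (Re \o f) /\ continuous (Im \o f).
Proof.
split=> [cf|[cr ci]].
  by split=> x; apply/cvgrPdist_lt => e e0;
    have /cvgrPdist_lt/(_ e%:C) := cf x; rewrite ltcR => /(_ e0);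
    apply: filterS => y; rewrite normcE ltcR; apply: le_lt_trans => /=;
    rewrite -raddfB ?normc_Re ?normc_Im.
move=> x; apply/cvgrPdist_lt => e e0.
have [d d0 ed] : exists2 d : R, 0 < d & e = d%:C.
  case: e e0 => d d'; rewrite ltcE /= => /andP[/eqP-> d0].
  by exists d.
have d20 : 0 < d / 2 by rewrite divr_gt0.
have /cvgrPdist_lt/(_ _ d20) Hr := cr x.
have /cvgrPdist_lt/(_ _ d20) Hi := ci x.
near=> y; rewrite normcE ed ltcR; apply: (le_lt_trans (normc_ReIm _)).
rewrite [ltRHS](splitr d) !raddfB; apply: ltrD.
  by near: y; exact: Hr.
by near: y; exact: Hi.
Unshelve. all: by end_near. Qed.

End complex_modulus.

Section line_derivatives.
Variables (R : realType) (V : normedModType R).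
Implicit Types f : V -> R.

(** Reduces directional derivatives to derivatives of functions of one variable. *)
Lemma is_derive_line f (x v : V) (s d : R) :
  is_derive (x + s *: v) v f d <-> is_derive s 1 (fun s => f (x + s *: v)) d.
Proof.
have E : (fun h : R => h^-1 *: ((f \o shift (x + s *: v)) (h *: v) - f (x + s *: v))) =
    (fun h : R => h^-1 *: (((fun s => f (x + s *: v)) \o shift s) (h *: 1) - f (x + s *: v))).
  by apply/funext => h /=; rewrite scaler1 scalerDl addrCA addrC.
by split=> -[]; rewrite /derivable /derive ?E -?E => ? ?; split;
  rewrite /derivable /derive ?E -?E.
Qed.

Lemma segment_MVT f (f' : V -> R) (v : V) :
  (forall x, is_derive x v f (f' x)) ->
  forall x, exists2 t : R, 0 <= t <= 1 & f (x + v) - f x = f' (x + t *: v).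
Proof.
move=> df x; pose g s : R := f (x + s *: v).
have dg (s : R) : is_derive s 1 g (f' (x + s *: v)) by exact/is_derive_line.
have cg : {within `[0 : R, 1], continuous g}.
  by apply: derivable_within_continuous => s _; have [] := dg s.
have [t] := @MVT_segment R g (fun s => f' (x + s *: v)) 0 1 ler01 (fun s _ => dg s) cg.
rewrite in_itv/= => tI gE; exists t => //.
by move: gE; rewrite /g scale1r scale0r addr0 subr0 mulr1.
Qed.

End line_derivatives.

Section partial_derivatives.
Variables (R : realType) (N : nat).
Local Notation E := 'rV[R]_N.
Local Notation Re := (@complex.Re R).
Local Notation Im := (@complex.Im R).
Implicit Types (f g : E -> R[i]) (x v : E).

(** A relation between [f] and its derivative composes better than a pair of a
    differentiability statement and a value. *)
Definition is_directional (v : E) f g := forall x,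
  is_derive x v (Re \o f) (Re (g x)) /\ is_derive x v (Im \o f) (Im (g x)).

Definition is_partial (i : 'I_N) := is_directional (delta_mx 0 i).

Lemma is_partialP i f g :
  is_partial i f g <-> has_partial i f /\ partial i f = g.
Proof.
split=> [dfg|[df <-] x]; last first.
  by have [fr fi] := df x; split; [exact: (derivableP fr)|exact: (derivableP fi)].
split=> [x|]; first by have [[fr _] [fi _]] := dfg x; exact: conj fr fi.
apply/funext => x; have [[_ r] [_ m]] := dfg x.
by rewrite /partial r m; case: (g x).
Qed.

Lemma has_partialP i f : has_partial i f -> is_partial i f (partial i f).
Proof. by move=> df; apply/is_partialP. Qed.

Lemma is_directional_cst v (c : R[i]) : is_directional v (cst c) (cst 0).
Proof. by move=> x; split; exact: is_derive_cst. Qed.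

Lemma is_directionalD v f f' g g' : is_directional v f f' ->
  is_directional v g g' ->
  is_directional v (fun x => f x + g x) (fun x => f' x + g' x).
Proof.
move=> df dg x; have [fr fi] := df x; have [gr gi] := dg x.
rewrite (_ : Re \o (fun x => f x + g x) = (Re \o f) + (Re \o g)); last first.
  by apply/funext => y; rewrite !fctE /= ReImE.
rewrite (_ : Im \o (fun x => f x + g x) = (Im \o f) + (Im \o g)); last first.
  by apply/funext => y; rewrite !fctE /= ReImE.
by rewrite /= !ReImE; split; exact: is_deriveD.
Qed.

Lemma is_directionalM v f f' g g' : is_directional v f f' ->
  is_directional v g g' ->
  is_directional v (fun x => f x * g x) (fun x => f' x * g x + f x * g' x).
Proof.
move=> df dg x; have [fr fi] := df x; have [gr gi] := dg x.
rewrite (_ : Re \o _ = (Re \o f) * (Re \o g) - (Im \o f) * (Im \o g)); last first.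
  by apply/funext => y /=; rewrite Re_mul.
rewrite (_ : Im \o (fun x => f x * g x) = (Re \o f) * (Im \o g) + (Im \o f) * (Re \o g)); last first.
  by apply/funext => y /=; rewrite Im_mul.
rewrite !ReImE.
split.
  apply: (is_derive_eq (is_deriveB (is_deriveM fr gr) (is_deriveM fi gi))).
  by rewrite /GRing.scale /=; ring.
apply: (is_derive_eq (is_deriveD (is_deriveM fr gi) (is_deriveM fi gr))).
by rewrite /GRing.scale /=; ring.
Qed.

Lemma is_directionalZ v (c : R[i]) f f' : is_directional v f f' ->
  is_directional v (fun x => c * f x) (fun x => c * f' x).
Proof.
move=> df x; have := is_directionalM (@is_directional_cst v c) df x.
by rewrite mul0r add0r.
Qed.

Lemma is_directional_ext v f f' g g' : f =1 g -> f' =1 g' ->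
  is_directional v f f' -> is_directional v g g'.
Proof. by move=> /funext -> /funext ->. Qed.

Lemma is_derive_scale (h : E -> R) x v s d :
  is_derive x v h d -> is_derive x (s *: v) h (s * d).
Proof.
move=> dh.
have H0 : is_derive (s * 0) 1 (fun t => h (x + t *: v)) d.
  by apply/(is_derive_line h x v (s * 0)); rewrite mulr0 scale0r addr0.
have Hs : is_derive (0 : R) 1 (fun t : R => s * t) s.
  apply: (is_derive_eq (is_deriveZ s (is_derive_id (0 : R) 1))).
  by rewrite /GRing.scale /= mulr1.
have := is_derive1_comp H0 Hs; rewrite mulrC.
have -> : (fun t => h (x + t *: v)) \o (fun t : R => s * t) =
    (fun t => h (x + t *: (s *: v))).
  by apply/funext => t; rewrite /= scalerA mulrC.
by move/(is_derive_line h x (s *: v) 0); rewrite scale0r addr0.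
Qed.

Lemma is_directional_scale v (s : R) f f' : is_directional v f f' ->
  is_directional (s *: v) f (fun x => s%:C * f' x).
Proof.
move=> df x; have [fr fi] := df x.
by rewrite !ReImE /= !mul0r subr0 addr0; split; exact: is_derive_scale.
Qed.

End partial_derivatives.

(** * From partial to directional derivatives *)

Section total_derivative.
Variables (R : realType) (N : nat).
Local Notation E := 'rV[R]_N.
Local Notation Re := (@complex.Re R).
Local Notation Im := (@complex.Im R).

Lemma is_derive_cvg (h : E -> R) (x v : E) (d : R) :
  (fun s : R => s^-1 *: ((h \o shift x) (s *: v) - h x)) @ 0^' --> d <->
  is_derive x v h d.
Proof.
split=> [hd|[dh <-]]; last exact: dh.
by split; [exact: (cvgP d hd)|exact: (cvg_lim _ hd)].
Qed.

(** Moving first along [v], then along [u], the second increment is controlled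
    by the mean value theorem and the continuity of the derivative along [u]. *)
Lemma is_derive_addl (h hu : E -> R) (x u v : E) (d : R) :
  (forall y, is_derive y u h (hu y)) -> {for x, continuous hu} ->
  is_derive x v h d -> is_derive x (u + v) h (hu x + d).
Proof.
move=> dhu chu /is_derive_cvg dhv; apply/is_derive_cvg.
rewrite (_ : (fun s => _) = (fun s : R => s^-1 *: (h (s *: u + (s *: v + x)) - h (s *: v + x)))
   \+ (fun s : R => s^-1 *: ((h \o shift x) (s *: v) - h x))); last first.
  by apply/funext => s /=; rewrite [s *: (u + v)]scalerDr -[s *: u + s *: v + x]addrA -scalerDr subrKA.
apply: cvgD => //.
apply/cvgrPdist_lt => e e0; move/cvgrPdist_lt : chu => /(_ e e0).
move=> /nbhs_ballP[r /= r0 Hr].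
have c0 : 0 < `|u| + `|v| + 1 by rewrite ltr_wpDl// addr_ge0.
near=> s.
have s0 : s != 0 by near: s; exact: nbhs_dnbhs_neq.
have dsu y : is_derive y (s *: u) h (s * hu y) by exact: is_derive_scale.
have [t /andP[t0 t1]] := segment_MVT dsu (s *: v + x).
rewrite [s *: v + x + s *: u]addrC => ->.
rewrite /GRing.scale/= mulKf//; apply: Hr; rewrite -ball_normE /ball_/=.
rewrite [s *: v + x + _]addrAC opprD addrCA subrr addr0 normrN.
apply: (@le_lt_trans _ _ (`|s| * (`|u| + `|v| + 1))); last first.
  rewrite -ltr_pdivlMr//; near: s; apply: dnbhs0_lt; exact: divr_gt0.
apply: (le_trans (ler_normD _ _)); rewrite !normrZ mulrDr mulrDr mulr1.
have s_ge0 : 0 <= `|s| by [].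
rewrite (ger0_norm t0).
have : t * (`|s| * `|u|) <= `|s| * `|u| by rewrite ler_piMl// mulr_ge0.
by lra.
Unshelve. all: by end_near. Qed.

Lemma is_directional_sum (r : seq 'I_N) (c : 'I_N -> R) (f : E -> R[i]) f' :
  (forall i, is_partial i f (f' i)) -> (forall i, continuous (f' i)) ->
  is_directional (\sum_(i <- r) c i *: delta_mx 0 i) f
    (fun x => \sum_(i <- r) (c i)%:C * f' i x).
Proof.
move=> df cf; elim: r => [|i r IH] x.
  rewrite !big_nil; split; exact: is_derive0.
have [IHr IHi] := IH x; rewrite !big_cons Re_add Im_add.
have dfi := is_directional_scale (c i) (df i).
have /continuous_ReIm[cr ci] : continuous (fun x => (c i)%:C * f' i x).
  by move=> y; apply: continuousZl_tmp; exact: cf.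
split.
  apply: (@is_derive_addl _ (fun x => Re ((c i)%:C * f' i x))) => //.
    by move=> y; have [] := dfi y.
  exact: cr.
apply: (@is_derive_addl _ (fun x => Im ((c i)%:C * f' i x))) => //.
  by move=> y; have [] := dfi y.
exact: ci.
Qed.

(** Summing the coordinates of [v] one at a time, by [is_derive_addl]. *)
Lemma is_directional_C1 (v : E) (f : E -> R[i]) f' :
  (forall i, is_partial i f (f' i)) -> (forall i, continuous (f' i)) ->
  is_directional v f (fun x => \sum_i (v 0 i)%:C * f' i x).
Proof.
move=> df cf; rewrite [X in is_directional X](row_sum_delta v).
exact: is_directional_sum.
Qed.

Lemma coord_le_norm (v : E) i : `|v 0 i| <= `|v|.
Proof.
rewrite [`|v|]mx_normrE; exact: (le_bigmax _ (fun ij => `|v ij.1 ij.2|) (0, i)).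
Qed.

(** Moving along one coordinate at a time, each step is controlled by the mean
    value theorem. *)
Lemma bounded_partials_lipschitz (h : E -> R) (h' : 'I_N -> E -> R) (M : R) :
  (forall i x, is_derive x (delta_mx 0 i) h (h' i x)) ->
  (forall i x, `|h' i x| <= M) ->
  forall x v, `|h (x + v) - h x| <= (\sum_(i < N) M) * `|v|.
Proof.
move=> dh hM x v; rewrite {1}(row_sum_delta v).
suff H (r : seq 'I_N) : `|h (x + \sum_(i <- r) v 0 i *: delta_mx 0 i) - h x|
    <= \sum_(i <- r) M * `|v|.
  by apply: (le_trans (H _)); rewrite mulr_suml.
elim: r => [|i r IH]; first by rewrite !big_nil addr0 subrr normr0.
rewrite !big_cons addrCA addrC.
set y := x + _ in IH *; rewrite -(subrKA (h y)).
apply: (le_trans (ler_normD _ _)); apply: lerD => //.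
have dsu z : is_derive z (v 0 i *: delta_mx 0 i) h (v 0 i * h' i z).
  exact: is_derive_scale.
have [t _ ->] := segment_MVT dsu y.
rewrite normrM mulrC; apply: ler_pM => //; exact: coord_le_norm.
Qed.

Lemma lipschitz_continuous (h : E -> R) (M : R) :
  (forall x v, `|h (x + v) - h x| <= M * `|v|) -> continuous h.
Proof.
move=> hM x.
apply/(@cvgrPdist_lt _ _ _ _ (nbhs_filter (x : E))) => e e0.
have M0 : 0 < `|M| + 1 by rewrite ltr_wpDl.
have d0 : 0 < e / (`|M| + 1) by exact: divr_gt0.
apply: filterS (nbhsx_ballx (x : E) _ d0) => y.
rewrite -ball_normE /ball_/= distrC => xy.
rewrite distrC -(subrKC x y); apply: (le_lt_trans (hM _ _)).
apply: (@le_lt_trans _ _ ((`|M| + 1) * `|y - x|)).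
  by rewrite ler_wpM2r// ler_wpDr// ler_norm.
by rewrite mulrC -ltr_pdivlMr.
Qed.

Lemma bounded_partials_continuous (f : E -> R[i]) f' (M : 'I_N -> R) :
  (forall i, is_partial i f (f' i)) ->
  (forall i x, normc (f' i x) <= M i) -> continuous f.
Proof.
move=> df fM; apply/continuous_ReIm.
have hM i x : normc (f' i x) <= \sum_j `|M j|.
  rewrite (bigD1 i)//= (le_trans (fM i x))// (le_trans (ler_norm _))// lerDl.
  by rewrite sumr_ge0.
split; apply: lipschitz_continuous.
  apply: (@bounded_partials_lipschitz _ (fun i x => Re (f' i x))) => i x.
    by have [+ _] := df i x.
  exact: le_trans (normc_Re _) (hM i x).
apply: (@bounded_partials_lipschitz _ (fun i x => Im (f' i x))) => i x.
  by have [_ +] := df i x.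
exact: le_trans (normc_Im _) (hM i x).
Qed.

End total_derivative.

(** * Schwartz families *)

Section schwartz_families.
Variables (R : realType) (N : nat).
Local Notation E := 'rV[R]_N.
Implicit Types (f g : E -> R[i]) (x : E) (s t : seq 'I_N).

(** Equivalent to the square of the usual bracket; being a polynomial, it interacts
    simply with monomials and with changes of variables. *)
Definition weight x : R := 1 + \sum_i x 0 i ^+ 2.

Lemma weight_ge1 x : 1 <= weight x.
Proof. by rewrite lerDl sumr_ge0// => i _; exact: sqr_ge0. Qed.

Lemma weight_gt0 x : 0 < weight x.
Proof. exact: lt_le_trans (weight_ge1 x). Qed.

Lemma weight_ge0 x : 0 <= weight x.
Proof. exact/ltW/weight_gt0. Qed.

Lemma weightX_ge0 x m : 0 <= weight x ^+ m.
Proof. by rewrite exprn_ge0// weight_ge0. Qed.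

Lemma coord_le_weight x i : `|x 0 i| <= weight x.
Proof.
rewrite /weight (bigD1 i)//=.
have : 0 <= \sum_(j < N | j != i) x 0 j ^+ 2 by rewrite sumr_ge0// => j _; exact: sqr_ge0.
have := sqr_ge0 (`|x 0 i| - 1); rewrite sqrrB real_normK ?num_real//.
by have := normr_ge0 (x 0 i); nra.
Qed.

Lemma monomial_le_weight s x : `|monomial s x| <= weight x ^+ size s.
Proof.
rewrite /monomial; elim: s => [|i s IH]; first by rewrite big_nil normr1.
by rewrite big_cons normrM exprS ler_pM// coord_le_weight.
Qed.

Lemma normc_weighted s t f x :
  normc (weighted s t f x) = `|monomial s x| * normc (partials t f x).
Proof. by rewrite /weighted normcM normc_real. Qed.

Section family.
Variables (I : Type) (e : I -> R).
Implicit Types F G : I -> E -> R[i].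

(** Families are bounded in every seminorm with the prescribed rate [e]: the
    constant rate on one index gives Schwartz functions, a rate tending to zero
    gives sequences tending to zero. An operation that preserves families
    therefore preserves the Schwartz space and is sequentially continuous. *)
Definition schwartz_family F := (forall k, smooth (F k)) /\
  forall s t, exists M : R, forall k x, normc (weighted s t (F k) x) <= M * e k.

Definition rapid F := forall m, exists M : R, forall k x,
  weight x ^+ m * normc (F k x) <= M * e k.

(** The powers of [weight] are polynomials, hence sums of monomials; conversely
    a monomial is bounded by a power of [weight]. *)
Lemma rapidP F : rapid F <-> forall s, exists M : R, forall k x,
  `|monomial s x| * normc (F k x) <= M * e k.
Proof.
split=> [rF s|mF m].
  have [M FM] := rF (size s); exists M => k x; apply: le_trans (FM k x).
  by rewrite ler_wpM2r ?normc_ge0// monomial_le_weight.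
suff H s : exists M : R, forall k x,
    weight x ^+ m * (`|monomial s x| * normc (F k x)) <= M * e k.
  have [M FM] := H [::]; exists M => k x.
  by have := FM k x; rewrite /monomial big_nil normr1 mul1r.
elim: m s => [|m IH] s.
  by have [M FM] := mF s; exists M => k x; rewrite expr0 mul1r.
have [M0 FM0] := IH s; have /choice[M FM] := fun i => IH (i :: i :: s).
(* The factor [weight x] is 1 plus the sum of the monomials of the words [:: i; i]. *)
exists (M0 + \sum_i M i) => k x.
rewrite exprS {1}/weight -mulrA mulrDl mul1r mulrDl lerD// mulr_suml mulr_suml.
apply: ler_sum => i _; apply: le_trans (FM i k x).
rewrite le_eqVlt; apply/orP; left; apply/eqP.
rewrite /monomial !big_cons !normrM -(real_normK (num_real (x 0 i))).
by ring.
Qed.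

Lemma rapid0 : rapid (fun _ _ => 0).
Proof. by move=> m; exists 0 => k x; rewrite normc0 mulr0 mul0r. Qed.

Lemma rapidD F G : rapid F -> rapid G -> rapid (fun k x => F k x + G k x).
Proof.
move=> rF rG m; have [M FM] := rF m; have [M' GM] := rG m.
exists (M + M') => k x; rewrite mulrDl; apply: le_trans (lerD (FM k x) (GM k x)).
by rewrite -mulrDr ler_wpM2l ?weightX_ge0// le_normcD.
Qed.

Inductive add_closure (C : set (I -> E -> R[i])) : (I -> E -> R[i]) -> Prop :=
| add_closure0 : add_closure C (fun _ _ => 0)
| add_closure_in F : C F -> add_closure C F
| add_closureD F G : add_closure C F -> add_closure C G ->
    add_closure C (fun k x => F k x + G k x).

Lemma add_closure_sum (J : Type) (r : seq J) (C : set (I -> E -> R[i])) (F : J -> I -> E -> R[i]) :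
  (forall j, C (F j)) -> add_closure C (fun k x => \sum_(j <- r) F j k x).
Proof.
move=> CF; elim: r => [|j r IH].
  rewrite (_ : (fun k x => _) = fun _ _ => 0); first exact: add_closure0.
  by apply/funext => k; apply/funext => x; rewrite big_nil.
rewrite (_ : (fun k x => _) = fun k x => F j k x + \sum_(j <- r) F j k x).
  exact: add_closureD (add_closure_in (CF j)) IH.
by apply/funext => k; apply/funext => x; rewrite big_cons.
Qed.

(** A class of rapidly decaying families whose derivatives are sums of members
    consists of Schwartz families: iterating gives the decay of all derivatives,
    and each of them is continuous because those of the next order are bounded. *)
Lemma schwartz_family_coind (C : set (I -> E -> R[i])) :
  (forall F, C F -> rapid F /\ forall i, exists G, add_closure C G /\
     forall k, is_partial i (F k) (G k)) ->
  forall F, C F -> schwartz_family F.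
Proof.
move=> HC F CF.
have {}HC G : add_closure C G -> rapid G /\
    forall i, exists H, add_closure C H /\ forall k, is_partial i (G k) (H k).
  elim=> [|H /HC//|H K _ [rH dH] _ [rK dK]].
    split=> [|i]; first exact: rapid0.
    exists (fun _ _ => 0); split=> [|k]; first exact: add_closure0.
    exact: (is_directional_cst _ 0).
  split=> [|i]; first exact: rapidD.
  have [H' [CH' dH']] := dH i; have [K' [CK' dK']] := dK i.
  exists (fun k x => H' k x + K' k x); split=> [|k]; first exact: add_closureD.
  exact: (is_directionalD (dH' k) (dK' k)).
have HD t : add_closure C (fun k => partials t (F k)).
  elim: t => [|i t IH] /=; first exact: add_closure_in.
  have [_ /(_ i)[G [CG dG]]] := HC _ IH.
  rewrite (_ : (fun k => _) = G)//; apply/funext => k.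
  by have /is_partialP[] := dG k.
split=> [k t|s t]; last first.
  have [/rapidP/(_ s)[M HM] _] := HC _ (HD t).
  by exists M => k x; rewrite normc_weighted.
have [_ /choice[G HG]] := HC _ (HD t); split=> [|i]; last first.
  by have [_ /(_ k)/is_partialP[]] := HG i.
have /choice[M HM] i : exists M, forall x, normc (G i k x) <= M.
  have [CG _] := HG i; have [/(_ 0%N)[M GM] _] := HC _ CG.
  by exists (M * e k) => x; have := GM k x; rewrite expr0 mul1r.
by apply: (@bounded_partials_continuous _ _ _ (G^~ k) M) => i; have [_ /(_ k)] := HG i.
Qed.

(** Variant in which boundedness replaces rapid decay, for classes that are stable
    under multiplication by the coordinates. *)
Lemma schwartz_family_coind_coord (C : set (I -> E -> R[i])) :
  (forall F, C F -> [/\ exists M : R, forall k x, normc (F k x) <= M * e k,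
     forall i, C (fun k x => (x 0 i)%:C * F k x) &
     forall i, exists G, C G /\ forall k, is_partial i (F k) (G k)]) ->
  forall F, C F -> schwartz_family F.
Proof.
move=> HC; apply: schwartz_family_coind => F CF; split=> [|i]; last first.
  have [_ _ /(_ i)[G [CG dG]]] := HC _ CF.
  by exists G; split=> //; exact: add_closure_in.
apply/rapidP => s.
have CsF : C (fun k x => (monomial s x)%:C * F k x).
  elim: s => [|i s IH].
    rewrite (_ : (fun k x => _) = F)//; apply/funext => k; apply/funext => x.
    by rewrite /monomial big_nil mul1r.
  have [_ /(_ i) + _] := HC _ IH; congr C.
  apply/funext => k; apply/funext => x.
  by rewrite /monomial big_cons mulrA rmorphM.
have [[M HM] _ _] := HC _ CsF; exists M => k x.
by have := HM k x; rewrite normcM normc_real.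
Qed.

Section facts.
Variable F : I -> E -> R[i].
Hypothesis SF : schwartz_family F.

Lemma schwartz_family_smooth k : smooth (F k).
Proof. by have [+ _] := SF; exact. Qed.

Lemma schwartz_family_rapid : rapid F.
Proof.
apply/rapidP => s; have [_ /(_ s [::])[M FM]] := SF.
by exists M => k x; have := FM k x; rewrite normc_weighted.
Qed.

Lemma schwartz_family_continuous k : continuous (F k).
Proof. by have [/(_ k [::])[]] := SF. Qed.

Lemma schwartz_family_is_partial i k : is_partial i (F k) (partial i (F k)).
Proof. by apply: has_partialP; have [/(_ k [::])[_]] := SF. Qed.

Lemma partials_rcons t i f : partials (rcons t i) f = partials t (partial i f).
Proof. by rewrite /partials foldr_rcons. Qed.

Lemma schwartz_family_partial i : schwartz_family (fun k => partial i (F k)).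
Proof.
have [smF SFb] := SF; split=> [k t|s t]; first by rewrite -partials_rcons; exact: smF.
have [M FM] := SFb s (rcons t i); exists M => k x.
by have := FM k x; rewrite !normc_weighted partials_rcons.
Qed.

End facts.
End family.

(** Multipliers of the Schwartz space: smooth functions whose derivatives have
    polynomial growth, again with a rate [e]. *)
Definition slow_family (I : Type) (e : I -> R) (G : I -> E -> R[i]) :=
  (forall k, smooth (G k)) /\
  forall t, exists m, exists M : R, forall k x,
    normc (partials t (G k) x) <= M * e k * weight x ^+ m.

Lemma slow_family_partial I (e : I -> R) G i : slow_family e G ->
  slow_family e (fun k => partial i (G k)).
Proof.
move=> [sG bG]; split=> [k t|t]; first by rewrite -partials_rcons; exact: sG.
have [m [M GM]] := bG (rcons t i); exists m; exists M => k x.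
by rewrite -partials_rcons.
Qed.

(** By coinduction on the class of all such products, closed by Leibniz' rule. *)
Lemma schwartz_familyM I (e e' : I -> R) G F : slow_family e G ->
  schwartz_family e' F ->
  schwartz_family (fun k => e k * e' k) (fun k x => G k x * F k x).
Proof.
move=> slG sF.
pose C : set (I -> E -> R[i]) := [set H | exists G F, [/\ slow_family e G,
  schwartz_family e' F & H = fun k x => G k x * F k x]].
apply: (@schwartz_family_coind _ _ C); last by exists G, F.
move=> _ [{sF}G [{}F [{}slG sF ->]]]; split=> [m|i].
  have [_ /(_ [::])[m' [M GM]]] := slG.
  have [M' FM] := schwartz_family_rapid sF (m + m').
  exists (M * M') => k x; rewrite normcM mulrACA.
  have := GM k x => /=; have := FM k x; rewrite exprD.
  have wg := weightX_ge0 x m.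
  have wg' : 0 < weight x ^+ m' by rewrite exprn_gt0// weight_gt0.
  set w := weight x ^+ m in wg *; set w' := weight x ^+ m' in wg' *.
  set b := normc (F k x); set a := normc (G k x) => h1 h2.
  have a0 : 0 <= a by exact: normc_ge0.
  have b0 : 0 <= b by exact: normc_ge0.
  have Me0 : 0 <= M * e k by rewrite -(pmulr_lge0 _ wg') (le_trans a0).
  apply: (@le_trans _ _ (M * e k * w' * (w * b))).
    by rewrite mulrCA ler_wpM2r// mulr_ge0.
  by rewrite -mulrA ler_wpM2l// mulrCA mulrA.
exists (fun k x => partial i (G k) x * F k x + G k x * partial i (F k) x).
split=> [|k]; last first.
  apply: is_directionalM; last exact: (schwartz_family_is_partial sF i k).
  by apply: has_partialP; have [/(_ k [::])[_]] := slG.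
apply: add_closureD; apply: add_closure_in.
  by exists (fun k => partial i (G k)), F; split=> //; exact: slow_family_partial.
by exists G, (fun k => partial i (F k)); split=> //; exact: schwartz_family_partial.
Qed.

End schwartz_families.

(** * Affine changes of variables and tensor products *)

Section pullback.
Variable R : realType.

(** The chain rule for a map that sends lines of direction [v] to lines of
    direction [w], for instance an affine map. *)
Lemma is_directional_pullback (N M : nat) (L : 'rV[R]_N -> 'rV[R]_M) v w f f' :
  (forall x (s : R), L (s *: v + x) = s *: w + L x) ->
  is_directional w f f' -> is_directional v (f \o L) (f' \o L).
Proof.
move=> Lv df x; have [fr fi] := df (L x).
suff H (h : 'rV[R]_M -> R) d : is_derive (L x) w h d -> is_derive x v (h \o L) d.
  by split; exact: H.
move=> /is_derive_cvg dh; apply/is_derive_cvg; apply: cvg_trans dh.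
by under [X in _ `=>` X @ _]eq_fun do rewrite /= -Lv; exact: cvg_refl.
Qed.

Section affine.
Variables (I : Type) (e : I -> R) (N M : nat).
Variables (c : 'rV[R]_M) (B : 'M[R]_(N, M)) (B' : 'M[R]_(M, N)).
Hypothesis BK : B *m B' = 1%:M.
Let L (x : 'rV[R]_N) : 'rV[R]_M := c + x *m B.

Let is_directional_affine i (f : 'rV[R]_M -> R[i]) : smooth f ->
  is_partial i (f \o L) (fun x => \sum_j (B i j)%:C * partial j f (L x)).
Proof.
move=> sf.
have H : is_directional (row i B) f (fun y => \sum_j (row i B 0 j)%:C * partial j f y).
  apply: is_directional_C1 => j; last by have [] := sf [:: j].
  by apply: has_partialP; have [_] := sf [::].
have HL x (s : R) : L (s *: delta_mx 0 i + x) = s *: row i B + L x.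
  by rewrite /L mulmxDl -scalemxAl -rowE addrCA.
apply: is_directional_ext (is_directional_pullback HL H) => // x /=.
by apply: eq_bigr => j _; rewrite mxE.
Qed.

Let weight_affine : exists2 K : R, 0 <= K & forall x, weight x <= K * weight (L x) ^+ 2.
Proof.
pose K i := \sum_j (1 + `|c 0 j|) * `|B' j i|.
have K0 i : 0 <= K i by apply: sumr_ge0 => j _; rewrite mulr_ge0// addr_ge0.
have xK (x : 'rV[R]_N) i : `|x 0 i| <= K i * weight (L x).
  rewrite {1}(_ : x = (L x - c) *m B'); last first.
    by rewrite addrC addKr -mulmxA BK mulmx1.
  rewrite mxE /K mulr_suml; apply: (le_trans (ler_norm_sum _ _ _)).
  apply: ler_sum => j _; rewrite normrM mulrAC ler_wpM2r//.
  rewrite mxE [X in `|_ + X|]mxE; apply: (le_trans (ler_normB _ _)).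
  have := coord_le_weight (L x) j; have := weight_ge1 (L x).
  have := normr_ge0 (c 0 j); nra.
(* Each coordinate of [x = (L x - c) *m B'] is at most [K i * weight (L x)]. *)
exists (1 + \sum_i K i ^+ 2); first by rewrite addr_ge0// sumr_ge0// => i _; exact: sqr_ge0.
move=> x; rewrite {1}/weight mulrDl mul1r lerD//.
  by rewrite exprn_ege1// weight_ge1.
rewrite mulr_suml; apply: ler_sum => i _.
rewrite -(real_normK (num_real (x 0 i))) -exprMn.
by rewrite ler_pXn2r ?nnegrE// mulr_ge0// ltW// weight_gt0.
Qed.

(** The left inverse [B'] of the linear part bounds [x] by [c + x *m B], so that
    rapid decay is inherited. *)
Lemma schwartz_family_affine F : schwartz_family e F ->
  schwartz_family e (fun k x => F k (c + x *m B)).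
Proof.
move=> sF; have [K K0 HK] := weight_affine.
apply: (@schwartz_family_coind _ _ _ _ [set H | exists (b : R) F,
    schwartz_family e F /\ H = fun k x => b%:C * F k (L x)]); last first.
  exists 1, F; split=> //.
  by apply/funext => k; apply/funext => x; rewrite mul1r.
move=> _ [b [{sF}F [sF ->]]]; split=> [m|i].
  have [M' FM] := schwartz_family_rapid sF (2 * m).
  exists (K ^+ m * `|b| * M') => k x; rewrite normcM normc_real mulrCA.
  rewrite [K ^+ m * _]mulrC -!mulrA ler_wpM2l//.
  apply: (@le_trans _ _ (K ^+ m * (weight (L x) ^+ (2 * m) * normc (F k (L x))))).
    rewrite exprM mulrA -exprMn ler_wpM2r ?normc_ge0//.
    apply: lerXn2r => //; rewrite nnegrE; first exact: weight_ge0.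
    by rewrite mulr_ge0// weightX_ge0.
  by rewrite ler_wpM2l// exprn_ge0.
exists (fun k x => \sum_j (B i j * b)%:C * partial j (F k) (L x)).
split=> [|k].
  apply: (@add_closure_sum _ _ _ _ _ _ (fun j k x => (B i j * b)%:C * partial j (F k) (L x))) => j.
  exists (B i j * b), (fun k => partial j (F k)); split=> //.
  exact: schwartz_family_partial.
have dF := is_directionalZ b%:C (is_directional_affine i (schwartz_family_smooth sF k)).
apply: is_directional_ext dF => // x.
rewrite mulr_sumr; apply: eq_bigr => j _.
by rewrite mulrA -rmorphM mulrC [b * _]mulrC mulrC.
Qed.

End affine.

Section tensor.
Variables (I : Type) (e e' : I -> R) (n : nat).
Local Notation E := 'rV[R]_n.

Lemma weight_tensor (z : 'rV[R]_(n + n)) :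
  weight z <= weight (lsubmx z) * weight (rsubmx z).
Proof.
have -> : weight z = weight (lsubmx z) + weight (rsubmx z) - 1.
  rewrite /weight big_split_ord /=.
  under [in RHS]eq_bigr do rewrite mxE.
  under [X in _ = _ + (_ + X) - _]eq_bigr do rewrite mxE.
  by ring.
have := weight_ge1 (lsubmx z); have := weight_ge1 (rsubmx z); nra.
Qed.

Lemma lsubmx_shift (v x : 'rV[R]_(n + n)) (s : R) :
  lsubmx (s *: v + x) = s *: lsubmx v + lsubmx x.
Proof. by rewrite linearP. Qed.

Lemma rsubmx_shift (v x : 'rV[R]_(n + n)) (s : R) :
  rsubmx (s *: v + x) = s *: rsubmx v + rsubmx x.
Proof. by rewrite linearP. Qed.

Lemma lsubmx_delta (j : 'I_n) :
  lsubmx (delta_mx 0 (lshift n j)) = delta_mx 0 j :> 'rV[R]_n.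
Proof. by apply/rowP => k; rewrite !mxE eq_lshift. Qed.

Lemma rsubmx_delta (j : 'I_n) :
  rsubmx (delta_mx 0 (rshift n j)) = delta_mx 0 j :> 'rV[R]_n.
Proof. by apply/rowP => k; rewrite !mxE eq_rshift. Qed.

Lemma rsubmx_delta0 (j : 'I_n) :
  rsubmx (delta_mx 0 (lshift n j)) = 0 :> 'rV[R]_n.
Proof. by apply/rowP => k; rewrite !mxE eq_rlshift. Qed.

Lemma lsubmx_delta0 (j : 'I_n) :
  lsubmx (delta_mx 0 (rshift n j)) = 0 :> 'rV[R]_n.
Proof. by apply/rowP => k; rewrite !mxE eq_lrshift. Qed.

Lemma is_directional0 N (f : 'rV[R]_N -> R[i]) : is_directional 0 f (cst 0).
Proof. by move=> x; split; exact: is_derive0. Qed.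

Lemma schwartz_family_tensor (F G : I -> E -> R[i]) :
  schwartz_family e F -> schwartz_family e' G ->
  schwartz_family (fun k => e k * e' k) (fun k => tensor (F k) (G k)).
Proof.
move=> sF sG.
apply: (@schwartz_family_coind _ _ _ _ [set H | exists F G, [/\ schwartz_family e F,
    schwartz_family e' G & H = fun k => tensor (F k) (G k)]]); last by exists F, G.
move=> _ [{sF}F [{sG}G [sF sG ->]]]; split=> [m|i].
  have [M FM] := schwartz_family_rapid sF m.
  have [M' GM] := schwartz_family_rapid sG m.
  exists (M * M') => k z; rewrite normcM mulrACA.
  apply: (@le_trans _ _ ((weight (lsubmx z) ^+ m * normc (F k (lsubmx z))) *
     (weight (rsubmx z) ^+ m * normc (G k (rsubmx z))))).
    rewrite mulrACA -exprMn ler_wpM2r ?mulr_ge0 ?normc_ge0//.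
    apply: lerXn2r; rewrite ?nnegrE ?weight_tensor ?weight_ge0//.
    by rewrite mulr_ge0// weight_ge0.
  by rewrite ler_pM// mulr_ge0 ?weightX_ge0 ?normc_ge0.
rewrite -(fintype.splitK i); case: (fintype.split i) => j /=.
  exists (fun k => tensor (partial j (F k)) (G k)); split=> [|k].
    apply: add_closure_in; exists (fun k => partial j (F k)), G; split=> //.
    exact: schwartz_family_partial.
  have dl := is_directional_pullback (lsubmx_shift (delta_mx 0 (lshift n j))).
  have dr := is_directional_pullback (rsubmx_shift (delta_mx 0 (lshift n j))).
  rewrite lsubmx_delta in dl; rewrite rsubmx_delta0 in dr.
  have := is_directionalM (dl _ _ (schwartz_family_is_partial sF j k))
    (dr _ _ (is_directional0 (G k))).
  by apply: is_directional_ext => // z /=; rewrite mulr0 addr0.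
exists (fun k => tensor (F k) (partial j (G k))); split=> [|k].
  apply: add_closure_in; exists F, (fun k => partial j (G k)); split=> //.
  exact: schwartz_family_partial.
have dl := is_directional_pullback (lsubmx_shift (delta_mx 0 (rshift n j))).
have dr := is_directional_pullback (rsubmx_shift (delta_mx 0 (rshift n j))).
rewrite lsubmx_delta0 in dl; rewrite rsubmx_delta in dr.
have := is_directionalM (dl _ _ (is_directional0 (F k)))
  (dr _ _ (schwartz_family_is_partial sG j k)).
by apply: is_directional_ext => // z /=; rewrite mul0r add0r.
Qed.

End tensor.
End pullback.

(** * Smooth functions *)

Section smooth_functions.
Variables (R : realType) (N : nat).
Local Notation E := 'rV[R]_N.
Implicit Types (f g : E -> R[i]).

(** Carries the results on families over to single functions. *)
Lemma is_schwartzE f : is_schwartz f <-> schwartz_family (fun _ : unit => 1) (fun _ => f).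
Proof.
split=> -[sf bf]; split.
- by [].
- move=> s t; have [M fM] := bf s t; exists M => _ x; rewrite mulr1 -lecR.
  exact: fM.
- exact: sf tt.
- move=> s t; have [M fM] := bf s t; exists M => x.
  by rewrite normcE lecR; have := fM tt x; rewrite mulr1.
Qed.

Lemma schwartz_bounded (f : E -> R[i]) : is_schwartz f -> exists M : R, forall x, normc (f x) <= M.
Proof.
move=> [_ bf]; have [M HM] := bf [::] [::]; exists M => x.
by have := HM x; rewrite normcE lecR normc_weighted /monomial big_nil normr1 mul1r.
Qed.

Inductive algebra_closure (A : set (E -> R[i])) : (E -> R[i]) -> Prop :=
| algebra_in f : A f -> algebra_closure A f
| algebra_cst c : algebra_closure A (fun _ => c)
| algebraD f g : algebra_closure A f -> algebra_closure A g ->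
    algebra_closure A (fun x => f x + g x)
| algebraM f g : algebra_closure A f -> algebra_closure A g ->
    algebra_closure A (fun x => f x * g x).

Lemma continuous_mulC (T : topologicalType) (f g : T -> R[i]) :
  continuous f -> continuous g -> continuous (fun x => f x * g x).
Proof.
move=> /continuous_ReIm[fr fi] /continuous_ReIm[gr gi].
apply/continuous_ReIm; split=> x.
  rewrite (_ : @complex.Re R \o (fun x => f x * g x) = (fun x => (@complex.Re R \o f) x * (@complex.Re R \o g) x -
    (@complex.Im R \o f) x * (@complex.Im R \o g) x)).
    apply: cvgB; apply: cvgM; [exact: fr|exact: gr|exact: fi|exact: gi].
  by apply/funext => y; exact: Re_mul.
rewrite (_ : @complex.Im R \o (fun x => f x * g x) = (fun x => (@complex.Re R \o f) x * (@complex.Im R \o g) x +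
    (@complex.Im R \o f) x * (@complex.Re R \o g) x)).
  apply: cvgD; apply: cvgM; [exact: fr|exact: gi|exact: fi|exact: gr].
by apply/funext => y; exact: Im_mul.
Qed.

Lemma continuous_cstC (T : topologicalType) (c : R[i]) : continuous (fun _ : T => c).
Proof. by apply/continuous_ReIm; split=> x; exact: (@cvg_cst R). Qed.

(** Smoothness only has to be checked up to polynomial combinations: the
    derivatives of the generators may leave the set of generators. *)
Lemma smooth_algebra (A : set (E -> R[i])) :
  (forall f, A f -> continuous f /\ forall i, exists g,
     algebra_closure A g /\ is_partial i f g) ->
  forall f, algebra_closure A f -> smooth f.
Proof.
move=> HA.
have {}HA f : algebra_closure A f -> continuous f /\ forall i, exists g,
     algebra_closure A g /\ is_partial i f g.
  elim=> [{}f /HA//|c|{}f g Af [cf df] Ag [cg dg]|{}f g Af [cf df] Ag [cg dg]].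
  - split=> [|i]; first exact: continuous_cstC.
    exists (fun _ => 0); split; first exact: algebra_cst.
    exact: is_directional_cst.
  - split=> [x|i]; first by apply: (continuousD (f := f) (g := g)); [exact: cf|exact: cg].
    have [f' [Af' df']] := df i; have [g' [Ag' dg']] := dg i.
    exists (fun x => f' x + g' x); split; first exact: algebraD.
    exact: is_directionalD.
  - split=> [|i]; first exact: (continuous_mulC cf cg).
    have [f' [Af' df']] := df i; have [g' [Ag' dg']] := dg i.
    exists (fun x => f' x * g x + f x * g' x); split.
      by apply: algebraD; apply: algebraM.
    exact: is_directionalM.
move=> f Af t.
have : algebra_closure A (partials t f).
  elim: t => [//|i t IH] /=.
  by have [_ /(_ i)[g [Ag /is_partialP[_ ->]]]] := HA _ IH.
move=> /HA[cf df]; split=> // i.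
by have [g [_ /is_partialP[]]] := df i.
Qed.

Lemma smooth_is_partial f i : smooth f -> is_partial i f (partial i f).
Proof. by move=> /(_ [::])[_ df]; exact: has_partialP. Qed.

Lemma smooth_partial f i : smooth f -> smooth (partial i f).
Proof. by move=> sf t; rewrite -partials_rcons; exact: sf. Qed.

Lemma smooth_generators f : smooth f -> continuous f /\ forall i, exists g,
     algebra_closure (@smooth R N) g /\ is_partial i f g.
Proof.
move=> sf; split=> [|i]; first by have [] := sf [::].
exists (partial i f); split; last exact: smooth_is_partial.
exact/algebra_in/smooth_partial.
Qed.

Lemma smoothM f g : smooth f -> smooth g -> smooth (fun x => f x * g x).
Proof.
move=> sf sg; apply: (smooth_algebra smooth_generators).
by apply: algebraM; exact: algebra_in.
Qed.

Lemma smooth_cst c : smooth (fun _ : E => c).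
Proof. by apply: (smooth_algebra smooth_generators); exact: algebra_cst. Qed.

Lemma partials_cst t i (c : R[i]) :
  partials (rcons t i) (fun _ : E => c) = fun _ => 0.
Proof.
have H c' j : partial j (fun _ : E => c' : R[i]) = fun _ => 0.
  by have /is_partialP[_ ->] := @is_directional_cst R N (delta_mx 0 j) c'.
rewrite partials_rcons H; elim: t => [//|j t IH] /=.
by rewrite IH H.
Qed.

Lemma smooth_prod (J : Type) (r : seq J) (f : J -> E -> R[i]) :
  (forall j, smooth (f j)) -> smooth (fun x => \prod_(j <- r) f j x).
Proof.
move=> sf; elim: r => [|j r IH].
  rewrite (_ : (fun x => _) = fun _ => 1); first exact: smooth_cst.
  by apply/funext => x; rewrite big_nil.
rewrite (_ : (fun x => _) = fun x => f j x * \prod_(j <- r) f j x).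
  exact: (smoothM (sf j) IH).
by apply/funext => x; rewrite big_cons.
Qed.

Lemma is_partial_scale (a : R) i f g : is_partial i f g ->
  is_partial i (fun x => f (a *: x)) (fun x => a%:C * g (a *: x)).
Proof.
move=> /(is_directional_scale a); apply: (@is_directional_pullback _ _ _ (fun x => a *: x)) => x s.
by rewrite scalerDr !scalerA mulrC.
Qed.

Lemma partials_scale (a : R) t f : smooth f ->
  partials t (fun x => f (a *: x)) = fun x => (a ^+ size t)%:C * partials t f (a *: x).
Proof.
move=> sf; elim: t => [|i t IH].
  by apply/funext => x; rewrite /= expr0 mul1r.
rewrite [LHS]/= IH.
have dt : is_partial i (partials t f) (partials (i :: t) f).
  by apply: has_partialP; have [] := sf t.
have /is_partialP[_ ->] := is_directionalZ (a ^+ size t)%:C (is_partial_scale a dt).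
by apply/funext => x /=; rewrite exprSr rmorphM mulrA.
Qed.

Lemma smooth_scale (a : R) f : smooth f -> smooth (fun x => f (a *: x)).
Proof.
move=> sf; apply: (@smooth_algebra [set h | exists2 f, smooth f & h = fun x => f (a *: x)]).
  move=> _ [{sf}f sf ->]; split=> [x|i].
    apply: (@continuous_comp _ _ _ (fun x : E => a *: x)); first exact: scaler_continuous.
    by have [+ _] := sf [::]; exact.
  exists (fun x => a%:C * partial i f (a *: x)); split; last first.
    exact/is_partial_scale/smooth_is_partial.
  apply: algebraM; first exact: algebra_cst.
  by apply: algebra_in; exists (partial i f) => //; exact: smooth_partial.
by apply: algebra_in; exists f.
Qed.

End smooth_functions.

(** * Smooth plateau functions *)

Section flat_function.
Variable R : realType.
Implicit Types y : R.

(** The functions y^(-k) exp(-1/y), extended by zero: they form a family closed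
    under derivation up to linear combinations, and are flat at the origin. *)
Definition flat (k : nat) y : R :=
  if 0 < y then (y^-1) ^+ k * expR (- y^-1) else 0.

Lemma flat_le0 k y : y <= 0 -> flat k y = 0.
Proof. by move=> y0; rewrite /flat ltNge y0. Qed.

Lemma flat_ge0 k y : 0 <= flat k y.
Proof.
rewrite /flat; case: ifP => // y0.
by rewrite mulr_ge0 ?expR_ge0// exprn_ge0// invr_ge0 ltW.
Qed.

Lemma flat_gt0 k y : 0 < y -> 0 < flat k y.
Proof. by move=> y0; rewrite /flat y0 mulr_gt0 ?expR_gt0// exprn_gt0// invr_gt0. Qed.

(** From [y ^- k.+1 <= k.+1`! * exp (1 / y)], a term of the exponential series. *)
Lemma flat_le k y : flat k y <= (k.+1)`!%:R * `|y|.
Proof.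
have [y0|y0] := leP y 0; first by rewrite flat_le0// mulr_ge0.
rewrite /flat y0 gtr0_norm//.
have z0 : 0 < y^-1 by rewrite invr_gt0.
have zk : 0 < y^-1 ^+ k.+1 by exact: exprn_gt0.
have fk : 0 < (k.+1)`!%:R :> R by rewrite ltr0n fact_gt0.
have : y^-1 ^+ k.+1 / (k.+1)`!%:R <= expR y^-1.
  by apply: le_trans (expR_ge1Dxn k (ltW z0)); rewrite lerDr.
rewrite ler_pdivrMr// => H.
rewrite expRN ler_pdivrMr ?expR_gt0//.
have -> : y^-1 ^+ k = y^-1 ^+ k.+1 * y by rewrite exprSr -mulrA mulVf ?mulr1// gt_eqF.
by rewrite [leRHS]mulrAC ler_wpM2r ?(ltW y0)// mulrC.
Qed.

Lemma flat_cvg k :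
  (fun h : R => h^-1 *: ((flat k \o shift 0) (h *: 1) - flat k 0)) @ 0^' --> (0 : R).
Proof.
have fk : 0 < (k.+2)`!%:R :> R by rewrite ltr0n fact_gt0.
apply/cvgrPdist_lt => e e0; near=> h.
have h0 : h != 0 by near: h; exact: nbhs_dnbhs_neq.
rewrite /= addr0 /GRing.scale/= mulr1 [flat k 0]flat_le0// subr0 sub0r normrN.
have [hn|hp] := leP h 0; first by rewrite flat_le0// mulr0 normr0.
have -> : h^-1 * flat k h = flat k.+1 h by rewrite /flat hp exprS mulrA.
rewrite ger0_norm ?flat_ge0// (le_lt_trans (flat_le _ _))//.
rewrite mulrC -ltr_pdivlMr//; near: h; apply: dnbhs0_lt; exact: divr_gt0.
Unshelve. all: by end_near. Qed.

Lemma is_derive_flat k y :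
  is_derive y 1 (flat k) (flat k.+2 y - k%:R * flat k.+1 y).
Proof.
have [y0|y0|y0] := ltgtP y 0.
- rewrite !flat_le0 ?ltW// mulr0 subrr.
  apply: (near_eq_is_derive _ (is_derive_cst (0 : R) y 1)).
  near=> z; rewrite flat_le0// ltW//; near: z; exact: lt_nbhsl.
- have yn0 : y != 0 by rewrite gt_eqF.
  have di : is_derive y 1 (fun z : R => z^-1) (- (y ^- 2)).
    split; first exact: derivableV.
    by rewrite deriveV// derive_id /GRing.scale/= mulr1.
  have de : is_derive y 1 (fun z : R => expR (- z^-1)) (expR (- y^-1) * (- - (y ^- 2))).
    exact: (is_derive1_comp (is_derive_expR _) (is_deriveN di)).
  have H := is_deriveM (is_deriveX k di) de.
  apply: (near_eq_is_derive _ (is_derive_eq H _)).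
    near=> z; rewrite /flat ifT ?fctE//; near: z; exact: lt_nbhsr.
  rewrite /flat y0 /GRing.scale/= fctE -exprVn expr2.
  by case: k {H} => [|k] /=; rewrite ?exprS; ring.
- rewrite y0 !flat_le0// mulr0 subrr; split.
    exact: (cvgP (0 : R) (flat_cvg k)).
  exact: (cvg_lim _ (flat_cvg k)).
Unshelve. all: by end_near. Qed.

Lemma continuous_flat k : continuous (flat k).
Proof.
move=> y; apply: differentiable_continuous; apply/derivable1_diffP.
by have [] := is_derive_flat k y.
Qed.

Definition flat_sum y := flat 0 y + flat 0 (1 - y).

Definition step y := flat 0 y / flat_sum y.

Lemma flat_sum_gt0 y : 0 < flat_sum y.
Proof.
have [y0|y0] := ltP 0 y; first by rewrite ltr_pwDl ?flat_gt0 ?flat_ge0.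
by rewrite ltr_wpDl ?flat_ge0// flat_gt0//; lra.
Qed.

Lemma step_ge0 y : 0 <= step y.
Proof. by rewrite divr_ge0 ?flat_ge0// ltW// flat_sum_gt0. Qed.

Lemma step_eq0 y : y <= 0 -> step y = 0.
Proof. by move=> y0; rewrite /step flat_le0// mul0r. Qed.

Lemma step_eq1 y : 1 <= y -> step y = 1.
Proof.
move=> y1; have := flat_sum_gt0 y; rewrite /step /flat_sum.
by rewrite [flat 0 (1 - y)]flat_le0 ?subr_le0// addr0 => /lt0r_neq0 /divff.
Qed.

Lemma is_derive_flat_sumV y : is_derive y 1 (fun z => (flat_sum z)^-1)
  (- ((flat_sum y)^-1 * (flat_sum y)^-1 * (flat 2 y - flat 2 (1 - y)))).
Proof.
have d0 : flat_sum y != 0 by rewrite gt_eqF// flat_sum_gt0.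
have dm : is_derive y 1 (fun z : R => 1 - z) (-1).
  have := is_deriveB (is_derive_cst (1 : R) y 1) (is_derive_id y 1).
  by rewrite sub0r.
have d1 := is_derive_flat 0 y.
have d2 := @is_derive1_comp R (flat 0) (fun z => 1 - z) y _ _ (is_derive_flat 0 (1 - y)) dm.
have [ds sE] := is_deriveD d1 d2.
split; first exact: derivableV.
rewrite deriveV// sE /GRing.scale/= !mul0r !subr0 mulrN1.
by rewrite mulNr expr2 invfM.
Qed.

Lemma continuous_flat_sumV : continuous (fun z => (flat_sum z)^-1).
Proof.
move=> y; apply: differentiable_continuous; apply/derivable1_diffP.
by have [] := is_derive_flat_sumV y.
Qed.

End flat_function.

Section plateau.
Variables (R : realType) (N : nat).
Local Notation E := 'rV[R]_N.

Lemma is_partial_coord (g g' : R -> R) (a s : R) (i j : 'I_N) :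
  (forall y : R, is_derive y 1 g (g' y)) ->
  is_partial j (fun x : E => (g (a + s * x 0 i))%:C)
    (fun x => ((i == j)%:R * s * g' (a + s * x 0 i))%:C).
Proof.
move=> dg x; split; last exact: is_derive_cst.
rewrite (_ : _ \o _ = fun x : E => g (a + s * x 0 i))//=.
suff : is_derive (0 : R) 1 (fun t => g (a + s * (x + t *: delta_mx 0 j) 0 i))
    ((i == j)%:R * s * g' (a + s * x 0 i)).
  by move/(is_derive_line (fun x : E => g (a + s * x 0 i)));
    rewrite scale0r addr0.
pose l (t : R) : R := (a + s * x 0 i) + ((i == j)%:R * s) * t.
have dl : is_derive (0 : R) 1 l ((i == j)%:R * s).
  have := is_deriveD (is_derive_cst (a + s * x 0 i) (0 : R) 1)
    (is_deriveZ ((i == j)%:R * s) (is_derive_id (0 : R) 1)).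
  by rewrite add0r /GRing.scale/= mulr1.
have l0 : l 0 = a + s * x 0 i by rewrite /l mulr0 addr0.
have := @is_derive1_comp R g l 0 _ _ (dg (l 0)) dl.
rewrite l0 mulrC; congr is_derive.
apply/funext => t /=; rewrite /l !mxE eqxx /=; congr g.
by ring.
Qed.

(** Closed under derivation up to polynomial combinations, as [smooth_algebra]
    requires: the derivative of the inverse of [flat_sum] involves its square. *)
Definition step_generators : set (E -> R[i]) := [set f | exists (a s : R) (i : 'I_N),
  (exists k, f = fun x : E => (flat k (a + s * x 0 i))%:C) \/
  f = fun x : E => ((flat_sum (a + s * x 0 i))^-1)%:C].

Lemma continuous_affine_coord (g : R -> R) (a s : R) i : continuous g ->
  continuous (fun x : E => (g (a + s * x 0 i))%:C).
Proof.
have c0 : continuous (fun _ : E => 0 : R) by exact: cst_continuous.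
move=> cg; apply/continuous_ReIm; split=> x; last exact: c0.
apply: (@continuous_comp _ _ _ (fun x : E => a + s * x 0 i) g); last exact: cg.
apply: (@continuousD R R); first exact: cst_continuous.
apply: (@continuousM R); first exact: cst_continuous.
exact: coord_continuous.
Qed.

Lemma step_generatorsP f : step_generators f -> continuous f /\ forall j, exists g,
  algebra_closure step_generators g /\ is_partial j f g.
Proof.
case=> a [s [i [[k ->]|->]]].
  split=> [|j]; first exact: continuous_affine_coord (@continuous_flat R k).
  have := is_partial_coord a s i j (is_derive_flat k).
  set c := _ * s => H.
  exists (fun x => c%:C * ((flat k.+2 (a + s * x 0 i))%:C
                     + (- k%:R)%:C * (flat k.+1 (a + s * x 0 i))%:C)).
  split; last first.
    apply: is_directional_ext H => // x.
    by rewrite -!(rmorphM, rmorphD) mulNr.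
  apply: algebraM; first exact: algebra_cst.
  apply: algebraD; first by apply: algebra_in; exists a, s, i; left; exists k.+2.
  apply: algebraM; first exact: algebra_cst.
  by apply: algebra_in; exists a, s, i; left; exists k.+1.
split=> [|j]; first exact: continuous_affine_coord (@continuous_flat_sumV R).
have := is_partial_coord a s i j (@is_derive_flat_sumV R).
set c := _ * s => H.
pose v (x : E) : R[i] := ((flat_sum (a + s * x 0 i))^-1)%:C.
exists (fun x => (- c)%:C * (v x * v x * ((flat 2 (a + s * x 0 i))%:C
                   + (- 1)%:C * (flat 2 ((1 - a) + (- s) * x 0 i))%:C))).
split; last first.
  apply: is_directional_ext H => // x.
  rewrite -!(rmorphM, rmorphD); congr (_%:C).
  have -> : 1 - a + - s * x 0 i = 1 - (a + s * x 0 i) by ring.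
  by ring.
have Av : algebra_closure step_generators v.
  by apply: algebra_in; exists a, s, i; right.
apply: algebraM; first exact: algebra_cst.
apply: algebraM; first exact: algebraM.
apply: algebraD; first by apply: algebra_in; exists a, s, i; left; exists 2%N.
apply: algebraM; first exact: algebra_cst.
by apply: algebra_in; exists (1 - a), (- s), i; left; exists 2%N.
Qed.

Lemma smooth_step (a s : R) i : smooth (fun x : E => (step (a + s * x 0 i))%:C).
Proof.
apply: (smooth_algebra step_generatorsP).
rewrite (_ : (fun x => _) = fun x : E => (flat 0 (a + s * x 0 i))%:C *
   ((flat_sum (a + s * x 0 i))^-1)%:C).
  apply: algebraM; apply: algebra_in; exists a, s, i; [by left; exists 0%N|by right].
by apply/funext => x; rewrite -rmorphM.
Qed.

(** A product of smooth steps, two for each coordinate; the balls are those of the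
    maximum norm, that is, cubes. *)
Lemma plateau_exists (c : E) (r : R) : 0 < r -> exists b : E -> R,
  [/\ smooth (fun x => (b x)%:C), forall x, 0 <= b x,
      forall x, `|x - c| <= r -> b x = 1 &
      forall x, b x != 0 -> `|x - c| <= 2 * r].
Proof.
move=> r0.
have r0' : r != 0 by rewrite gt_eqF.
(* Each factor is 1 for [|x_i - c_i| <= r] and 0 for [|x_i - c_i| >= 2 r]. *)
pose f (i : 'I_N) (x : E) : R := step (2 + c 0 i / r + (- r^-1) * x 0 i) *
  step (2 - c 0 i / r + r^-1 * x 0 i).
have fE i x : f i x = step (2 - (x 0 i - c 0 i) / r) * step (2 + (x 0 i - c 0 i) / r).
  by rewrite /f; congr (step _ * step _); ring.
have coordB (x : E) i : `|x 0 i - c 0 i| <= `|x - c|.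
  by have := coord_le_norm (x - c) i; rewrite !mxE.
exists (fun x => \prod_(i < N) f i x); split.
- rewrite (_ : (fun x => _) = fun x => \prod_(i < N) (f i x)%:C).
    apply: smooth_prod => i.
    rewrite (_ : (fun x => _) = fun x : E => (step (2 + c 0 i / r + (- r^-1) * x 0 i))%:C *
      (step (2 - c 0 i / r + r^-1 * x 0 i))%:C).
      by apply: smoothM; exact: smooth_step.
    by apply/funext => x; rewrite -rmorphM.
  by apply/funext => x; rewrite rmorph_prod.
- by move=> x; apply: prodr_ge0 => i _; rewrite mulr_ge0 ?step_ge0.
- move=> x xc; apply: big1 => i _; rewrite fE.
  have /(le_trans (coordB x i)) := xc; rewrite -[X in _ <= X]mul1r -ler_pdivrMr//.
  rewrite -[X in _ / X]gtr0_norm// -normf_div ler_norml => /andP[h1 h2].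
  by rewrite !step_eq1 ?mulr1//; lra.
- move=> x; apply: contra_neqT; rewrite -ltNge => xc.
  have [i xi] : exists i, 2 * r < `|x 0 i - c 0 i|.
    apply: contrapT => /forallNP H; move: xc; apply/negP; rewrite -leNgt.
    rewrite [`|_|]mx_normrE; apply/bigmax_leP; split=> [|[j i] _].
      by rewrite mulr_ge0// ltW.
    by rewrite leNgt ord1 !mxE; apply/negP; exact: H.
  rewrite (bigD1 i)//= fE.
  move: xi; rewrite -ltr_pdivlMr// -[X in _ / X]gtr0_norm// -normf_div.
  rewrite lter_normr => /orP[h|h].
    by rewrite step_eq0 ?mul0r//; lra.
  by rewrite [X in _ * X * _]step_eq0 ?mulr0 ?mul0r//; lra.
Qed.

End plateau.

(** * Functions of bounded support and cutoffs *)

Section bounded_support.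
Variables (R : realType) (N : nat).
Local Notation E := 'rV[R]_N.
Implicit Types (f g : E -> R[i]).

Lemma partials_vanish t f (U : set E) : open U -> smooth f ->
  (forall x, U x -> f x = 0) -> forall x, U x -> partials t f x = 0.
Proof.
move=> oU sf fU; elim: t => [//|i t IH] x Ux /=.
have nx : \near x, partials t f x = 0.
  by near=> y; apply: IH; near: y; exact: open_nbhs_nbhs.
rewrite /partial (@near_eq_derive _ _ _ _ (cst (0 : R))); last first.
  by apply: filterS nx => y /= ->.
rewrite (@near_eq_derive _ _ _ (@complex.Im R \o _) (cst (0 : R))); last first.
  by apply: filterS nx => y /= ->.
by rewrite !derive_cst.
Unshelve. all: by end_near. Qed.

Lemma closed_cball_row (c : E) (r : R) : closed [set x : E | `|x - c| <= r].
Proof.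
rewrite (_ : [set x | _] = (fun x : E => `|x - c|) @^-1` [set y | y <= r])//.
apply: closed_comp; last exact: closed_le.
move=> x _; apply: continuous_comp; last exact: norm_continuous.
have cc : continuous (fun _ : E => c) by exact: cst_continuous.
by apply: (@continuousB R E E id (fun _ => c)); [exact: cvg_id|exact: cc].
Qed.

Lemma compact_cball (c : E) (r : R) : compact [set x : E | `|x - c| <= r].
Proof.
apply: bounded_closed_compact.
  exists (`|c| + r); split; first exact: num_real.
  move=> M cM x /= xc; apply: ltW; apply: le_lt_trans cM.
  by rewrite -[x](subrK c) addrC (le_trans (ler_normD _ _))// lerD2l.
exact: closed_cball_row.
Qed.

Lemma compact_support_bounded (f : E -> R[i]) (A : set E) : compact A ->
  continuous f -> (forall x, ~ A x -> f x = 0) ->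
  exists M : R, forall x, normc (f x) <= M.
Proof.
move=> cA /continuous_ReIm[cr ci] fA.
have H (h : E -> R) : continuous h -> exists M : R, forall x, A x -> `|h x| <= M.
  move=> ch; have : compact (h @` A).
    by apply: continuous_compact => //; exact: continuous_subspaceT.
  move=> /compact_bounded[M [_ HM]]; exists (M + 1) => x Ax.
  by apply: (HM (M + 1)); [rewrite ltrDl|exists x].
have [M HM] := H _ cr; have [M' HM'] := H _ ci.
exists (`|M| + `|M'|) => x; have [Ax|/fA->] := pselect (A x); last first.
  by rewrite normc0 addr_ge0.
apply: (le_trans (normc_ReIm _)); apply: lerD.
  exact: le_trans (HM x Ax) (ler_norm _).
exact: le_trans (HM' x Ax) (ler_norm _).
Qed.

Lemma schwartz_family_cst (I : Type) f : is_schwartz f ->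
  schwartz_family (fun _ : I => 1) (fun _ => f).
Proof.
move=> /is_schwartzE[sf bf]; split=> [_|s t]; first exact: sf tt.
by have [M HM] := bf s t; exists M => _ x; exact: HM tt x.
Qed.

Definition bounded_partials f := smooth f /\
  forall t, exists M : R, forall x, normc (partials t f x) <= M.

Lemma partials_support t f (c : E) (r : R) : smooth f ->
  (forall x, f x != 0 -> `|x - c| <= r) ->
  forall x, ~ `|x - c| <= r -> partials t f x = 0.
Proof.
move=> sf fr x xr.
have oU : open (~` [set x : E | `|x - c| <= r]).
  exact/closed_openC/closed_cball_row.
have fU y : (~` [set x : E | `|x - c| <= r]) y -> f y = 0.
  by move=> yr; apply: contrapT => /eqP /fr.
by apply: (@partials_vanish t f _ oU sf fU x); exact: xr.
Qed.

(** The derivatives of a function of bounded support are continuous and vanish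
    off a compact ball. *)
Lemma bump_bounded_partials f (c : E) (r : R) : smooth f ->
  (forall x, f x != 0 -> `|x - c| <= r) -> bounded_partials f.
Proof.
move=> sf fr; split=> // t.
apply: (compact_support_bounded (@compact_cball c r)); first by have [] := sf t.
exact: partials_support.
Qed.

Lemma bounded_partials_slow f : bounded_partials f ->
  slow_family (fun _ : unit => 1) (fun _ => f).
Proof.
move=> [sf bf]; split=> // t; have [M fM] := bf t.
by exists 0%N, M => _ x; rewrite expr0 !mulr1.
Qed.

Lemma is_schwartzM f g : bounded_partials f -> is_schwartz g ->
  is_schwartz (fun x => f x * g x).
Proof.
move=> /bounded_partials_slow sf /is_schwartzE sg; apply/is_schwartzE.
have := schwartz_familyM sf sg; congr schwartz_family.
by apply/funext => ?; rewrite mulr1.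
Qed.

Lemma bump_schwartz f (c : E) (r : R) : smooth f ->
  (forall x, f x != 0 -> `|x - c| <= r) -> is_schwartz f.
Proof.
move=> sf fr; split=> // s t; have [_ /(_ t)[M fM]] := bump_bounded_partials sf fr.
pose K := `|c| + `|r|.
have mK x : `|x - c| <= r -> `|monomial s x| <= K ^+ size s.
  move=> xr; rewrite /monomial; elim: s => [|i s IH]; first by rewrite big_nil normr1.
  rewrite big_cons normrM exprS ler_pM//; apply: (le_trans (coord_le_norm x i)).
  rewrite -[x](subrK c) addrC (le_trans (ler_normD _ _))// lerD2l.
  exact: le_trans (ler_norm _).
exists (K ^+ size s * M) => x; rewrite normcE lecR normc_weighted.
have [xr|xr] := pselect (`|x - c| <= r).
  by rewrite ler_pM ?normc_ge0// mK.
rewrite (partials_support t sf fr xr) normc0 mulr0 mulr_ge0//.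
  by rewrite exprn_ge0// addr_ge0.
exact: le_trans (normc_ge0 _) (fM 0).
Qed.

Lemma norm_le_weight (x : E) : `|x| <= weight x.
Proof.
rewrite [`|_|]mx_normrE; apply/bigmax_leP; split=> [|[j i] _].
  exact: weight_ge0.
by rewrite ord1; exact: coord_le_weight.
Qed.

(** Multiplying by dilated cutoffs converges to the identity of the Schwartz
    space: the derivatives of a dilated function gain the dilation factor, and
    the Lipschitz bound trades one power of the weight for it at order zero. *)
Lemma cutoff_family (b : E -> R) (h : E -> R[i]) :
  bounded_partials (fun x => (b x)%:C) -> b 0 = 1 -> is_schwartz h ->
  schwartz_family (fun k : nat => k.+1%:R^-1)
    (fun k x => (1 - (b (k.+1%:R^-1 *: x))%:C) * h x).
Proof.
move=> bb b0 sh; have [sb bM] := bb.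
pose e (k : nat) : R := k.+1%:R^-1.
have e0 k : 0 <= e k by rewrite invr_ge0.
have e1 k : e k <= 1 by rewrite invf_le1// ler1n.
have sbe k : smooth (fun x : E => (b (e k *: x))%:C) := smooth_scale (e k) sb.
have E1 k : (fun x : E => 1 - (b (e k *: x))%:C) =
    (-1) *: (fun x : E => (b (e k *: x))%:C) + (fun _ => 1).
  by apply/funext => x; rewrite !fctE scaleN1r addrC.
have s1 := @smooth_cst R N 1.
have slow : slow_family e (fun k x => 1 - (b (e k *: x))%:C).
  split=> [k|t]; first by rewrite E1; exact: (smooth_lin (-1) (sbe k) s1).
  case/lastP: t => [|t i]; last first.
    have [M HM] := bM (rcons t i); exists 0%N, M => k x.
    rewrite E1 (partials_lin (rcons t i) (-1) (sbe k) s1) (partials_scale (e k) (rcons t i) sb).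
    rewrite partials_cst expr0 mulr1 !fctE addr0 scaleN1r normcN normcM normc_real [leLHS]mulrC.
    apply: ler_pM; rewrite ?normc_ge0//.
    by rewrite size_rcons ger0_norm ?exprn_ge0// exprS ler_piMr// exprn_ile1.
  have /choice[M HM] : forall i, exists M : R, forall x, normc (partial i (fun x => (b x)%:C) x) <= M.
    by move=> i; exact: (bM [:: i]).
  have lip : forall x v : E, `|b (x + v) - b x| <= (\sum_(i < N) \sum_j `|M j|) * `|v|.
    apply: (@bounded_partials_lipschitz _ _ _ (fun i x => complex.Re (partial i (fun x => (b x)%:C) x))) => i x.
      by have [] := smooth_is_partial i sb x.
    apply: (le_trans (normc_Re _)); apply: (le_trans (HM i x)).
    by rewrite (bigD1 i)//= (le_trans (ler_norm _))// lerDl sumr_ge0.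
  exists 1%N, (\sum_(i < N) \sum_j `|M j|) => k x.
  have -> : partials [::] (fun x : E => 1 - (b (e k *: x))%:C) x = (1 - b (e k *: x))%:C.
    by rewrite rmorphB.
  rewrite normc_real distrC expr1.
  have := lip 0 (e k *: x); rewrite add0r b0 normrZ (ger0_norm (e0 k)) => H.
  apply: (le_trans H); rewrite mulrA ler_wpM2l ?norm_le_weight//.
  by rewrite mulr_ge0// !sumr_ge0// => *; rewrite sumr_ge0.
have := schwartz_familyM slow (schwartz_family_cst nat sh).
by congr schwartz_family; apply/funext => k; rewrite mulr1.
Qed.

End bounded_support.

(** * Integrals of complex functions *)

Section complex_integral.
Context d (T : measurableType d) (R : realType).
Variable mu : {measure set T -> \bar R}.
Implicit Types (f g : T -> R[i]) (w : T -> R).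
Local Notation Re := (@complex.Re R).
Local Notation Im := (@complex.Im R).

Definition cint f : R[i] :=
  (\int[mu]_t Re (f t)) +i* (\int[mu]_t Im (f t)).

Definition cmeasurable f :=
  measurable_fun setT (Re \o f) /\ measurable_fun setT (Im \o f).

Definition cintegrable f := mu.-integrable setT (EFin \o (Re \o f)) /\
  mu.-integrable setT (EFin \o (Im \o f)).

Lemma le_integrable_real (g w : T -> R) : measurable_fun setT g ->
  mu.-integrable setT (EFin \o w) -> (forall t, `|g t| <= w t) ->
  mu.-integrable setT (EFin \o g).
Proof.
move=> mg iw gw; apply: (le_integrable _ _ _ iw) => //.
  exact/measurable_EFinP.
by move=> t _ /=; rewrite lee_fin (le_trans (gw t))// ler_norm.
Qed.

Lemma cmeasurable_real (g : T -> R) : measurable_fun setT g ->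
  cmeasurable (fun t => (g t)%:C).
Proof. by move=> mg; split=> //; exact: (@measurable_cst _ _ _ _ _ (0 : R)). Qed.

Lemma cmeasurable_cst c : cmeasurable (fun _ => c).
Proof. by split; exact: measurable_cst. Qed.

Lemma cmeasurableM f g : cmeasurable f -> cmeasurable g ->
  cmeasurable (fun t => f t * g t).
Proof.
move=> [fr fi] [gr gi]; split.
  apply: (eq_measurable_fun (fun t => (Re \o f) t * (Re \o g) t - (Im \o f) t * (Im \o g) t)).
    by move=> t _ /=; rewrite Re_mul.
  by apply: measurable_funB; exact: measurable_funM.
apply: (eq_measurable_fun (fun t => (Re \o f) t * (Im \o g) t + (Im \o f) t * (Re \o g) t)).
  by move=> t _ /=; rewrite Im_mul.
by apply: measurable_funD; exact: measurable_funM.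
Qed.

Lemma cmeasurable_expi (g : T -> R) : measurable_fun setT g ->
  cmeasurable (fun t => expi (g t)).
Proof.
move=> mg; split.
  apply: (measurableT_comp (f := @cos R)) => //.
  exact: continuous_measurable_fun (@continuous_cos R).
apply: (measurableT_comp (f := @sin R)) => //.
exact: continuous_measurable_fun (@continuous_sin R).
Qed.

Lemma cintegrable_dom f w : cmeasurable f -> mu.-integrable setT (EFin \o w) ->
  (forall t, normc (f t) <= w t) -> cintegrable f.
Proof.
move=> [fr fi] iw fw; split; apply: (le_integrable_real _ iw) => // t.
  exact: le_trans (normc_Re _) (fw t).
exact: le_trans (normc_Im _) (fw t).
Qed.

Lemma cintD f g : cintegrable f -> cintegrable g ->
  cint (fun t => f t + g t) = cint f + cint g.
Proof.
move=> [fr fi] [gr gi]; rewrite /cint.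
under eq_Rintegral do rewrite Re_add.
rewrite RintegralD//.
under [X in _ +i* X]eq_Rintegral do rewrite Im_add.
by rewrite RintegralD.
Qed.

Lemma cintZ c f : cintegrable f -> cint (fun t => c * f t) = c * cint f.
Proof.
move=> [fr fi]; rewrite /cint.
have I (a : R) h : mu.-integrable setT (EFin \o h) ->
    mu.-integrable setT (EFin \o (fun t => a * h t)).
  by move=> ih; exact: (@integrableZl _ _ _ mu setT _ a _ ih).
under eq_Rintegral do rewrite Re_mul.
rewrite RintegralB ?RintegralZl//; [|exact: (I _ (Re \o f))|exact: (I _ (Im \o f))].
under [X in _ +i* X]eq_Rintegral do rewrite Im_mul.
rewrite RintegralD ?RintegralZl//; [|exact: (I _ (Im \o f))|exact: (I _ (Re \o f))].
by case: (c) => a b /=; congr (_ +i* _); rewrite [RHS]addrC.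
Qed.

Lemma eq_cint f g : f =1 g -> cint f = cint g.
Proof. by move=> /funext ->. Qed.

Lemma le_normc_cint f w : cintegrable f -> mu.-integrable setT (EFin \o w) ->
  (forall t, normc (f t) <= w t) -> normc (cint f) <= 2 * \int[mu]_t w t.
Proof.
move=> [fr fi] iw fw; apply: (le_trans (normc_ReIm _)) => /=.
have H (h : T -> R) : mu.-integrable setT (EFin \o h) -> (forall t, `|h t| <= w t) ->
    `|\int[mu]_t h t| <= \int[mu]_t w t.
  move=> ih hw; apply: (le_trans (le_normr_Rintegral measurableT ih)).
  apply: le_Rintegral => //; exact: (integrable_norm ih).
rewrite mulr_natl mulr2n; apply: lerD; apply: H => // t.
  exact: le_trans (normc_Re _) (fw t).
exact: le_trans (normc_Im _) (fw t).
Qed.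

Lemma cint_dominated (F : nat -> T -> R[i]) f w : (forall k, cmeasurable (F k)) ->
  cmeasurable f -> mu.-integrable setT (EFin \o w) ->
  (forall k t, normc (F k t) <= w t) ->
  (forall t, Re (F k t) @[k --> \oo] --> Re (f t)) ->
  (forall t, Im (F k t) @[k --> \oo] --> Im (f t)) ->
  Re (cint (F k)) @[k --> \oo] --> Re (cint f) /\
  Im (cint (F k)) @[k --> \oo] --> Im (cint f).
Proof.
move=> mF [mfr mfi] iw Fw Fr Fi.
have H (h_ : nat -> T -> R) (h : T -> R) : (forall k, measurable_fun setT (h_ k)) ->
    measurable_fun setT h -> (forall k t, `|h_ k t| <= w t) ->
    (forall t, h_ k t @[k --> \oo] --> h t) ->
    \int[mu]_t h_ k t @[k --> \oo] --> \int[mu]_t h t.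
  move=> mh_ mh hw hh.
  have hh' t : (h_ k t)%:E @[k --> \oo] --> (h t)%:E.
    by apply: cvg_EFin; [exact: nearW|exact: hh].
  have [ih _ cvh] := @dominated_convergence _ _ _ mu setT measurableT
    (fun k t => (h_ k t)%:E) (fun t => (h t)%:E) (EFin \o w)
    (fun k => (measurable_EFinP _ _).2 (mh_ k)) ((measurable_EFinP _ _).2 mh)
    (aeW _ (fun t _ => hh' t)) iw
    (aeW _ (fun t k _ => hw k t)).
  apply: fine_cvg; rewrite fineK; last exact: integrable_fin_num.
  exact: cvh.
split.
  apply: H => //; first by move=> k; have [] := mF k.
  by move=> k t; exact: le_trans (normc_Re _) (Fw k t).
apply: H => //; first by move=> k; have [] := mF k.
by move=> k t; exact: le_trans (normc_Im _) (Fw k t).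
Qed.

End complex_integral.

Section complex_fubini.
Context d1 d2 (T1 : measurableType d1) (T2 : measurableType d2) (R : realType).
Variable m1 : {sigma_finite_measure set T1 -> \bar R}.
Variable m2 : {sigma_finite_measure set T2 -> \bar R}.
Local Notation Re := (@complex.Re R).
Local Notation Im := (@complex.Im R).

Section real.
Variables (w1 : T1 -> R) (w2 : T2 -> R).
Hypothesis iw1 : m1.-integrable setT (EFin \o w1).
Hypothesis iw2 : m2.-integrable setT (EFin \o w2).
Variable g : T1 * T2 -> R.
Hypothesis mg : measurable_fun setT g.
Hypothesis gw : forall x y, `|g (x, y)| <= w1 x * w2 y.

Lemma measurable_section1 x : measurable_fun setT (fun y => g (x, y)).
Proof. by apply: (measurableT_comp mg); exact: pair1_measurable. Qed.

Lemma measurable_section2 y : measurable_fun setT (fun x => g (x, y)).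
Proof. by apply: (measurableT_comp mg); exact: pair2_measurable. Qed.

Lemma integrable_section1 x : m2.-integrable setT (EFin \o (fun y => g (x, y))).
Proof.
apply: (@le_integrable_real _ _ _ _ _ (fun y => w1 x * w2 y)) => //.
  exact: measurable_section1.
exact: (@integrableZl _ _ _ m2 setT _ (w1 x) _ iw2).
Qed.

Lemma integrable_section2 y : m1.-integrable setT (EFin \o (fun x => g (x, y))).
Proof.
apply: (@le_integrable_real _ _ _ _ _ (fun x => w2 y * w1 x)).
- exact: measurable_section2.
- exact: (@integrableZl _ _ _ m1 setT _ (w2 y) _ iw1).
- by move=> x; rewrite mulrC.
Qed.

(** The iterated integral of the modulus is bounded by the product of the
    integrals of the two bounds. *)
Lemma integrable_product : (m1 \x m2)%E.-integrable setT (EFin \o g).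
Proof.
have mg' : measurable_fun setT (EFin \o g) by exact/measurable_EFinP.
apply/(integrable12ltyP _ _ mg').
apply: (@le_lt_trans _ _ (\int[m1]_x `|(w1 x * \int[m2]_y `|w2 y|)%:E|)%E).
  have mF : measurable_fun setT (fun x => (\int[m2]_y `|(EFin \o g) (x, y)|)%E).
    apply: (@measurable_fun_fubini_tonelli_F _ _ _ _ _ m2 (fun z => `|(EFin \o g) z|%E)).
      exact: measurableT_comp.
    by move=> z; exact: abse_ge0.
  apply: ge0_le_integral => //.
  - by move=> x _; exact: integral_ge0.
  - apply/measurableT_comp => //; apply/measurable_EFinP; apply: measurable_funM => //.
    exact/measurable_EFinP/(measurable_int _ iw1).
  move=> x _.
  have iw2' : m2.-integrable setT (EFin \o (fun y => `|w1 x| * `|w2 y|)).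
    exact: (@integrableZl _ _ _ m2 setT _ `|w1 x| _ (integrable_norm iw2)).
  apply: (@le_trans _ _ (\int[m2]_y (`|w1 x| * `|w2 y|)%:E)%E).
    apply: ge0_le_integral => //.
    - apply/measurableT_comp => //; exact/measurable_EFinP/measurable_section1.
    - exact: measurable_int iw2'.
    move=> y _; rewrite /= lee_fin -normrM; apply: (le_trans (gw x y)).
    exact: ler_norm.
  rewrite abse_EFin normrM (@ger0_norm _ (\int[m2]_y `|w2 y|)); last first.
    exact: Rintegral_ge0.
  have -> : (`|w1 x| * \int[m2]_y `|w2 y|)%:E = (\int[m2]_y (`|w1 x| * `|w2 y|))%:E.
    by rewrite RintegralZl//; exact: (integrable_norm iw2).
  by rewrite /Rintegral fineK//; exact: integrable_fin_num.
have : m1.-integrable setT (EFin \o (fun x => (\int[m2]_y `|w2 y|) * w1 x)).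
  exact: (@integrableZl _ _ _ m1 setT _ (\int[m2]_y `|w2 y|) _ iw1).
move=> /integrableP[_]; apply: le_lt_trans.
by under eq_integral do rewrite mulrC.
Qed.

Lemma fubini_section1 :
  \int[m1]_x (\int[m2]_y g (x, y)) = \int[(m1 \x m2)%E]_z g z.
Proof.
rewrite /Rintegral -(integral12_prod_meas1 integrable_product); congr fine.
apply: eq_integral => x _; rewrite fineK//.
exact: (integrable_fin_num _ (integrable_section1 x)).
Qed.

Lemma fubini_section2 :
  \int[m2]_y (\int[m1]_x g (x, y)) = \int[(m1 \x m2)%E]_z g z.
Proof.
rewrite /Rintegral -(integral21_prod_meas1 integrable_product); congr fine.
apply: eq_integral => y _; rewrite fineK//.
exact: (integrable_fin_num _ (integrable_section2 y)).
Qed.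

Lemma integrable_partial_integral :
  m1.-integrable setT (EFin \o (fun x => \int[m2]_y g (x, y))).
Proof.
have := integrable_fubini_F integrable_product; congr (integrable _ _ _).
apply/funext => x /=; rewrite /fubini_F /Rintegral fineK//.
exact: (integrable_fin_num _ (integrable_section1 x)).
Qed.

End real.

(** A product bound makes every section integrable, so that the iterated
    integrals may be written without exceptional null sets. *)
Section product_domination.
Variables (w1 : T1 -> R) (w2 : T2 -> R).
Hypothesis iw1 : m1.-integrable setT (EFin \o w1).
Hypothesis iw2 : m2.-integrable setT (EFin \o w2).
Variable f : T1 * T2 -> R[i].
Hypothesis mf : cmeasurable f.
Hypothesis fw : forall x y, normc (f (x, y)) <= w1 x * w2 y.

Let fr x y : `|(Re \o f) (x, y)| <= w1 x * w2 y.
Proof. exact: le_trans (normc_Re _) (fw x y). Qed.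

Let fi x y : `|(Im \o f) (x, y)| <= w1 x * w2 y.
Proof. exact: le_trans (normc_Im _) (fw x y). Qed.

Lemma cint_prod1 :
  cint m1 (fun x => cint m2 (fun y => f (x, y))) = cint (m1 \x m2)%E f.
Proof.
have [mr mi] := mf; rewrite /cint; congr (_ +i* _).
  exact: (fubini_section1 iw1 iw2 mr fr).
exact: (fubini_section1 iw1 iw2 mi fi).
Qed.

Lemma cint_prod2 :
  cint m2 (fun y => cint m1 (fun x => f (x, y))) = cint (m1 \x m2)%E f.
Proof.
have [mr mi] := mf; rewrite /cint; congr (_ +i* _).
  exact: (fubini_section2 iw1 iw2 mr fr).
exact: (fubini_section2 iw1 iw2 mi fi).
Qed.

Lemma cintegrable_partial_integral :
  cintegrable m1 (fun x => cint m2 (fun y => f (x, y))).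
Proof.
have [mr mi] := mf; split.
  exact: (integrable_partial_integral iw1 iw2 mr fr).
exact: (integrable_partial_integral iw1 iw2 mi fi).
Qed.

End product_domination.

End complex_fubini.

(** * Lebesgue measure on row vectors *)

Section tuple_measurability.
Variable R : realType.
Local Notation T := (measurableTypeR R).

(** An open set is a countable union of cubes with rational centres, and a cube
    is a finite intersection of conditions on one coordinate. This makes
    continuous functions measurable for the product sigma-algebra. *)
Lemma open_row_measurable n (V : set 'rV[R]_n) : open V ->
  measurable (@row_of_tuple R n @^-1` V).
Proof.
move=> oV.
pose box (q : n.-tuple rat * nat) : set 'rV[R]_n :=
  [set x | forall i, `|x 0 i - ratr (tnth q.1 i)| < q.2.+1%:R^-1].
pose F q : set (n.-tuple T) :=
  if `[< box q `<=` V >] then @row_of_tuple R n @^-1` box q else set0.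
have -> : @row_of_tuple R n @^-1` V = \bigcup_q F q.
  apply/seteqP; split=> [t Vt|t [q _]]; last first.
    by rewrite /F; case: asboolP => // bV /bV.
  have /nbhs_ballP[e /= e0 eV] : nbhs (row_of_tuple t) V by exact: open_nbhs_nbhs.
  have [k ke] : exists k : nat, k.+1%:R^-1 < e / 2.
    have e20 : 0 < e / 2 by rewrite divr_gt0.
    exists (Num.truncn (e / 2)^-1).
    rewrite -[ltRHS]invrK ltf_pV2 ?posrE ?invr_gt0//.
    by rewrite truncnS_gt.
  have k0 : 0 < k.+1%:R^-1 :> R by rewrite invr_gt0.
  have /choice[q Hq] : forall i : 'I_n, exists q : rat, `|tnth t i - ratr q| < k.+1%:R^-1.
    move=> i; have : tnth t i - k.+1%:R^-1 < tnth t i + k.+1%:R^-1 by rewrite ltrBlDr -addrA ltrDl addr_gt0.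
    move=> /rat_in_itvoo[q]; rewrite in_itv/= => /andP[q1 q2]; exists q.
    by rewrite ltr_distlC q1 q2.
  exists ([tuple q i | i < n], k) => //; rewrite /F ifT.
    by move=> i /=; rewrite mxE tnth_mktuple.
  apply/asboolP => x bx; apply: eV; split=> // i j; rewrite ord1.
  have := bx j => /=; rewrite tnth_mktuple => xq; have := Hq j => tq.
  rewrite /ball/= mxE -(subrKA (ratr (q j))); apply: (le_lt_trans (ler_normD _ _)).
  by rewrite [ltRHS]splitr ltrD// ?(lt_trans tq)// distrC (lt_trans xq).
apply: countable_bigcupT_measurable => [|q]; first exact: countableP.
rewrite /F; case: asboolP => // _.
have -> : @row_of_tuple R n @^-1` box q = \bigcap_(i in [set: 'I_n])
    (fun t : n.-tuple T => tnth t i) @^-1` (ball (ratr (tnth q.1 i) : R) (q.2.+1%:R^-1)).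
  apply/seteqP; split=> t H i.
    by move=> _; have := H i; rewrite mxE /ball/= distrC.
  by have := H i I; rewrite mxE /ball/= distrC.
apply: fin_bigcap_measurable => // i _.
rewrite -[X in measurable X]setTI; apply: (@measurable_tnth _ T n i) => //.
exact: measurable_ball.
Qed.

Lemma measurable_row n (h : 'rV[R]_n -> R) : continuous h ->
  measurable_fun setT (h \o @row_of_tuple R n).
Proof.
move=> ch; apply: (measurability _ (RGenOpens.measurableE R)) => //.
move=> _ [_ [x [y ->]] <-]; rewrite setTI.
rewrite (_ : _ @^-1` _ = @row_of_tuple R n @^-1` (h @^-1` `]x, y[))//.
apply: open_row_measurable; apply: open_comp => [z _|]; first exact: ch.
exact: interval_open.
Qed.

Lemma cmeasurable_row n (f : 'rV[R]_n -> R[i]) : continuous f ->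
  cmeasurable (f \o @row_of_tuple R n).
Proof. by move=> /continuous_ReIm[cr ci]; split; [exact: (measurable_row cr)|exact: (measurable_row ci)]. Qed.

Lemma cmeasurable_comp d d' (T1 : measurableType d) (T2 : measurableType d')
    (f : T2 -> R[i]) (phi : T1 -> T2) :
  cmeasurable f -> measurable_fun setT phi -> cmeasurable (f \o phi).
Proof.
move=> [fr fi] mphi; split; first exact: (measurableT_comp fr mphi).
exact: (measurableT_comp fi mphi).
Qed.

End tuple_measurability.

Section transfer.
Context d1 d2 (T1 : measurableType d1) (T2 : measurableType d2) (R : realType).
Variables (m1 : {measure set T1 -> \bar R}) (m2 : {measure set T2 -> \bar R}).

(** [m2] is [r] times the image of [m1], as seen by nonnegative functions. *)
Definition transfers (phi : T1 -> T2) (r : R) := [/\ measurable_fun setT phi,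
  0 < r & forall g : T2 -> \bar R, measurable_fun setT g -> (forall x, 0 <= g x)%E ->
    (\int[m2]_x g x = r%:E * \int[m1]_x g (phi x))%E].

Variables (phi : T1 -> T2) (r : R).
Hypothesis tr : transfers phi r.

Lemma transfer_integrable (g : T2 -> R) : m2.-integrable setT (EFin \o g) ->
  m1.-integrable setT (EFin \o (g \o phi)).
Proof.
have [mphi r0 H] := tr => /integrableP[mg goo]; apply/integrableP; split.
  by apply: (measurableT_comp mg).
move: goo; rewrite (H (fun x => `|(EFin \o g) x|%E)); last 2 first.
- exact: measurableT_comp.
- by move=> x; exact: abse_ge0.
have := @integral_ge0 _ _ _ m1 setT (fun x => `|(EFin \o g) (phi x)|%E) (fun _ _ => abse_ge0 _).
rewrite /comp; case: (integral _ _ _) => [s _ _|_|//]; first exact: ltry.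
by rewrite mulry gtr0_sg// mul1e.
Qed.

(** Splitting into positive and negative parts. *)
Lemma transfer_integral (g : T2 -> R) : m2.-integrable setT (EFin \o g) ->
  \int[m2]_x g x = r * \int[m1]_x g (phi x).
Proof.
move=> ig; have [mphi r0 H] := tr; have ig1 := transfer_integrable ig.
have mg : measurable_fun setT (EFin \o g) := measurable_int _ ig.
rewrite /Rintegral integralE [in RHS]integralE.
rewrite H; [|exact: measurable_funepos|by move=> x; exact: funepos_ge0].
rewrite (H ((fun x => (g x)%:E)^\-)%E);
  [|exact: measurable_funeneg|by move=> x; exact: funeneg_ge0].
have fp := integrable_pos_fin_num measurableT ig1.
have fn := integrable_neg_fin_num measurableT ig1.
have -> : (\int[m1]_x ((fun x0 : T2 => (g x0)%:E)^\+)%E (phi x) =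
  \int[m1]_x ((EFin \o (g \o phi))^\+)%E x)%E by apply: eq_integral => x _; rewrite !funeposE.
have -> : (\int[m1]_x ((fun x0 : T2 => (g x0)%:E)^\-)%E (phi x) =
  \int[m1]_x ((EFin \o (g \o phi))^\-)%E x)%E by apply: eq_integral => x _; rewrite !funenegE.
rewrite -muleBr; [|by []|by apply: fin_num_adde_defr].
by rewrite fineM// fin_numB fp fn.
Qed.

Lemma transfer_cint (f : T2 -> R[i]) : cintegrable m2 f ->
  cintegrable m1 (f \o phi) /\ cint m2 f = r%:C * cint m1 (f \o phi).
Proof.
move=> [fr fi]; split.
  by split; [exact: (transfer_integrable fr)|exact: (transfer_integrable fi)].
rewrite /cint (transfer_integral fr) (transfer_integral fi) /comp /=.
by apply/eqP; rewrite eq_complex /= !mul0r subr0 addr0 !eqxx.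
Qed.

End transfer.

Section lebesgue_transfers.
Variable R : realType.
Local Notation T := (measurableTypeR R).
Local Notation lambda := (@lebesgue_measure R).
Local Notation mu := (lebesgue_tuple R).

(** Lets the integrability of a product in [n.+1] variables be deduced from that of
    its factors. *)
Lemma transfer_integrable_inv d1 d2 (T1 : measurableType d1) (T2 : measurableType d2)
    (m1 : {measure set T1 -> \bar R}) (m2 : {measure set T2 -> \bar R})
    (phi : T1 -> T2) (r : R) (g : T2 -> R) : transfers m1 m2 phi r ->
  measurable_fun setT g -> m1.-integrable setT (EFin \o (g \o phi)) ->
  m2.-integrable setT (EFin \o g).
Proof.
move=> [mphi r0 H] mg /integrableP[_ goo]; apply/integrableP; split.
  exact/measurable_EFinP.
rewrite (H (fun x => `|(EFin \o g) x|%E)); last 2 first.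
- by apply: measurableT_comp => //; exact/measurable_EFinP.
- by move=> x; exact: abse_ge0.
by rewrite lte_mul_pinfty// ?lee_fin ltW.
Qed.

Lemma measurable_affine (c a : R) : measurable_fun setT (fun x : R => c + a * x).
Proof. by apply: measurable_funD => //; exact: measurable_funM. Qed.

Section affine1.
Variables (c : R) (a : R).
Hypothesis a0 : 0 < a.

Let image_measure : {measure set T -> \bar R} := measure_function_pushforward__canonical__measure_function_Measure
     lambda (measurable_affine c a : measurable_fun setT (_ : T -> T)).

Let scaled : {measure set T -> \bar R} := mscale (NngNum (ltW a0)) image_measure.

(** Both sides agree on intervals, and this characterises Lebesgue measure. *)
Lemma lebesgue_measure_affine A : measurable A ->
  lambda A = (a%:E * lambda ((fun x => c + a * x)%R @^-1` A))%E.
Proof.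
move=> mA; rewrite (@lebesgue_measure_unique R scaled)// => _ [[u v]] _ <-.
rewrite /scaled /= /mscale /= /pushforward /=.
have -> : (fun x => c + a * x) @^-1` `]u, v] = `](u - c) / a, (v - c) / a]%classic.
  by apply/seteqP; split=> x /=; rewrite !in_itv/= ltr_pdivrMr// ler_pdivlMr//
    ltrBlDl lerBrDl mulrC.
rewrite !lebesgue_measure_itv/= !lte_fin ltr_pM2r ?invr_gt0// ltrD2r.
case: ifPn => _; last by rewrite mule0.
rewrite -!EFinB -EFinM; congr (_%:E); field; rewrite gt_eqF//.
Qed.

Lemma transfers_affine1 : transfers lambda lambda (fun x : T => (c + a * x : T)) a.
Proof.
split=> //; first exact: measurable_affine.
move=> g mg g0.
transitivity (\int[scaled]_x g x)%E.
  by apply: eq_measure_integral => A mA _; exact: lebesgue_measure_affine.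
rewrite ge0_integral_mscale//=; congr (_ * _)%E.
by rewrite ge0_integral_pushforward//; exact: measurable_affine.
Qed.

End affine1.

Lemma transfers_opp : transfers lambda lambda (fun x : T => (- x : T)) 1.
Proof.
split=> //; first exact: oppr_measurable.
move=> g mg g0; rewrite mul1e.
transitivity (\int[pushforward lambda (-%R : T -> T)]_x g x)%E.
  apply: eq_measure_integral => A mA _; exact/esym/lebesgue_measureN.
by rewrite ge0_integral_pushforward//; exact: oppr_measurable.
Qed.

Lemma transfers_cons n : transfers (lambda \x mu n)%E (mu n.+1) (@cons_pair R n) 1.
Proof.
split=> //; first exact: measurable_cons_pair.
move=> g mg g0; rewrite mul1e /= /lebesgue_cons.
by rewrite ge0_integral_pushforward//; exact: measurable_cons_pair.
Qed.

Lemma ge0_integral_cons n (g : n.+1.-tuple T -> \bar R) :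
  measurable_fun setT g -> (forall t, 0 <= g t)%E ->
  (\int[mu n.+1]_t g t = \int[lambda]_x \int[mu n]_t g (cons_pair (x, t)))%E.
Proof.
move=> mg g0; have [mc _ H] := transfers_cons n.
have mgc := measurableT_comp mg mc.
by rewrite H// mul1e (fubini_tonelli1 _ mgc (fun p => g0 _)).
Qed.

Lemma measurable_integral_cons n (g : n.+1.-tuple T -> \bar R) :
  measurable_fun setT g -> (forall t, 0 <= g t)%E ->
  measurable_fun setT (fun x => \int[mu n]_t g (cons_pair (x, t)))%E.
Proof.
move=> mg g0; have [mc _ _] := transfers_cons n.
have mgc := measurableT_comp mg mc.
exact: (@measurable_fun_fubini_tonelli_F _ _ _ _ _ (mu n) _ mgc (fun p => g0 _)).
Qed.

Definition affine_tuple n (c : n.-tuple R) (a : R) (t : n.-tuple T) : n.-tuple T :=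
  [tuple tnth c i + a * tnth t i | i < n].

Lemma row_of_affine_tuple n (c : n.-tuple R) (a : R) (t : n.-tuple T) :
  row_of_tuple (affine_tuple c a t) = row_of_tuple c + a *: row_of_tuple t.
Proof. by apply/rowP => i; rewrite !mxE tnth_mktuple. Qed.

Lemma measurable_affine_tuple n (c : n.-tuple R) a :
  measurable_fun setT (affine_tuple c a).
Proof.
apply/measurable_fun_tnthP => i.
rewrite (_ : _ \o _ = (fun x : T => (tnth c i + a * x : T)) \o (@tnth _ T ^~ i)).
  by apply: measurableT_comp; [exact: measurable_affine|exact: measurable_tnth].
by apply/funext => t /=; rewrite tnth_mktuple.
Qed.

Lemma affine_tuple_cons n (c : n.+1.-tuple R) a (x : T) (t : n.-tuple T) :
  affine_tuple c a (cons_pair (x, t)) =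
  cons_pair (thead c + a * x : T, affine_tuple [tuple of behead c] a t).
Proof.
apply: eq_from_tnth => i; rewrite tnth_mktuple.
case: (unliftP ord0 i) => [j|] ->.
  by rewrite !tnthS tnth_mktuple tnth_behead; congr (tnth c _ + _); apply/val_inj;
    rewrite /= inordK// ltnS.
by rewrite !tnth0.
Qed.

(** By induction on the dimension, one coordinate at a time. *)
Lemma transfers_affine n (c : n.-tuple R) (a : R) : 0 < a ->
  transfers (mu n) (mu n) (affine_tuple c a) (a ^+ n).
Proof.
move=> a0; split; [exact: measurable_affine_tuple|exact: exprn_gt0|].
elim: n c => [|n IH] c g mg g0.
  rewrite expr0 mul1e; apply: eq_integral => t _; congr g.
  by apply/val_inj; rewrite [affine_tuple _ _ _]tuple0 [t]tuple0.
have mga := measurableT_comp mg (measurable_affine_tuple c a).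
rewrite !ge0_integral_cons//.
have [m1 _ H1] := transfers_affine1 (thead c) a0.
rewrite H1; last 2 first.
- exact: measurable_integral_cons.
- by move=> x; exact: integral_ge0.
rewrite exprS EFinM -muleA; congr (_ * _)%E.
rewrite -ge0_integralZl//; last 3 first.
- exact: (measurable_integral_cons mga (fun t => g0 _)).
- by move=> x _; exact: integral_ge0.
- by rewrite lee_fin exprn_ge0// ltW.
apply: eq_integral => x _.
rewrite (IH [tuple of behead c]); last 2 first.
- apply: (measurableT_comp mg); apply: (measurableT_comp (@measurable_cons_pair R n)).
  exact: pair1_measurable.
- by [].
by congr (_ * _)%E; apply: eq_integral => t _; rewrite /= affine_tuple_cons.
Qed.

Definition cat_pair m n (p : m.-tuple T * n.-tuple T) : (m + n).-tuple T :=
  [tuple of p.1 ++ p.2].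

Lemma row_of_cat_pair m n (p : m.-tuple T * n.-tuple T) :
  row_of_tuple (cat_pair p) = row_mx (row_of_tuple p.1) (row_of_tuple p.2).
Proof.
apply/rowP => i; rewrite [LHS]mxE [RHS]mxE.
by case: splitP => j ij; rewrite !mxE !(tnth_nth 0) /= ij nth_cat size_tuple
  ?ltn_ord// ltnNge leq_addr /= addKn.
Qed.

Lemma measurable_cat_pair m n : measurable_fun setT (@cat_pair m n).
Proof.
apply/measurable_fun_tnthP => i; case: (split_ordP i) => j ->.
  rewrite (_ : _ \o _ = (fun t : m.-tuple T => tnth t j) \o fst).
    by apply: measurableT_comp => //; exact: measurable_tnth.
  by apply/funext => -[s t]; rewrite /= tnth_lshift.
rewrite (_ : _ \o _ = (fun t : n.-tuple T => tnth t j) \o snd).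
  by apply: measurableT_comp => //; exact: measurable_tnth.
by apply/funext => -[s t]; rewrite /= tnth_rshift.
Qed.

(** Identifies Lebesgue measure in [m + n] variables with the product measure, by
    induction on [m] and associativity of the iterated integrals. *)
Lemma transfers_cat m n : transfers (mu m \x mu n)%E (mu (m + n)) (@cat_pair m n) 1.
Proof.
split=> //; first exact: measurable_cat_pair.
elim: m => [|m IH] g mg g0.
  have mgc := measurableT_comp mg (@measurable_cat_pair 0 n).
  rewrite mul1e (fubini_tonelli1 _ mgc (fun p => g0 _))//.
  rewrite integral_dirac//; last first.
    exact: (@measurable_fun_fubini_tonelli_F _ _ _ _ _ (mu n) _ mgc (fun p => g0 _)).
  rewrite diracT mul1e; apply: eq_integral => t _; congr g.
  exact/val_inj.
rewrite mul1e.
have mgc := measurableT_comp mg (@measurable_cat_pair m.+1 n).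
rewrite (fubini_tonelli1 _ mgc (fun p => g0 _))//.
rewrite [RHS]ge0_integral_cons; last 2 first.
- exact: (@measurable_fun_fubini_tonelli_F _ _ _ _ _ (mu n) _ mgc (fun p => g0 _)).
- by move=> t; apply: integral_ge0 => s _; exact: g0.
rewrite (ge0_integral_cons mg g0); apply: eq_integral => x _.
rewrite IH; last 2 first.
- apply: (measurableT_comp mg); apply: (measurableT_comp (@measurable_cons_pair R (m + n))).
  exact: pair1_measurable.
- by [].
have mgx : measurable_fun setT (fun p : m.-tuple T * n.-tuple T => g (cons_pair (x, cat_pair p))).
  apply: (measurableT_comp mg); apply: (measurableT_comp (@measurable_cons_pair R (m + n))).
  apply: (measurableT_comp (@pair1_measurable _ _ _ _ x)).
  exact: measurable_cat_pair.
rewrite mul1e.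
rewrite (@fubini_tonelli1 _ _ _ _ _ (mu m) (mu n)
  (fun p => g (cons_pair (x, cat_pair p))) mgx (fun p => g0 _)).
apply: eq_integral => t _; apply: eq_integral => s _; congr g.
exact/val_inj.
Qed.

End lebesgue_transfers.

(** * Functions with separated variables *)

Section product_functions.
Variable R : realType.
Local Notation T := (measurableTypeR R).
Local Notation lambda := (@lebesgue_measure R).
Local Notation mu := (lebesgue_tuple R).

Lemma cmeasurable_prod d (X : measurableType d) (J : Type) (r : seq J) (f : J -> X -> R[i]) :
  (forall j, cmeasurable (f j)) -> cmeasurable (fun x => \prod_(j <- r) f j x).
Proof.
move=> mf; elim: r => [|j r IH].
  rewrite (_ : (fun x => _) = fun _ => 1); first exact: cmeasurable_cst.
  by apply/funext => x; rewrite big_nil.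
rewrite (_ : (fun x => _) = fun x => f j x * \prod_(j <- r) f j x).
  exact: cmeasurableM (mf j) IH.
by apply/funext => x; rewrite big_cons.
Qed.

Lemma normc_prod (J : Type) (r : seq J) (f : J -> R[i]) :
  normc (\prod_(j <- r) f j) = \prod_(j <- r) normc (f j).
Proof. by apply: (big_morph (@normc R) (@normcM R)); rewrite normc1. Qed.

Lemma cmeasurable_tuple_prod n (f : 'I_n -> R -> R[i]) :
  (forall i, cmeasurable (f i : T -> R[i])) ->
  cmeasurable (fun t : n.-tuple T => \prod_i f i (tnth t i)).
Proof.
move=> mf; apply: cmeasurable_prod => i.
exact: (cmeasurable_comp (mf i) (@measurable_tnth _ T n i)).
Qed.

(** By induction on the number of variables. The bound [w] is there because the
    integrability of the product is needed to integrate one variable first. *)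
Lemma separated_integral n (f : 'I_n -> R -> R[i]) (w : 'I_n -> R -> R) :
  (forall i, cmeasurable (f i : T -> R[i])) ->
  (forall i, lambda.-integrable setT (EFin \o w i)) ->
  (forall i x, normc (f i x) <= w i x) ->
  (mu n).-integrable setT (EFin \o (fun t : n.-tuple T => \prod_i w i (tnth t i))) /\
  cint (mu n) (fun t => \prod_i f i (tnth t i)) = \prod_i cint lambda (f i).
Proof.
elim: n f w => [|n IH] f w mf iw fw.
  split.
    rewrite (_ : EFin \o _ = fun _ => 1%E); last first.
      by apply/funext => t /=; rewrite big_ord0.
    apply/integrableP; split; first exact: measurable_cst.
    rewrite (eq_integral (fun _ => 1%E)); last by move=> t _; rewrite abse1.
    rewrite integral_dirac//.
    by rewrite diracT mul1e ltry.
  rewrite big_ord0 /cint.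
  have D (c : R) (h : 0.-tuple T -> R) : (forall t, h t = c) -> \int[mu 0]_t h t = c.
    move=> hc; rewrite /Rintegral (eq_integral (fun _ => c%:E)); last by move=> t _; rewrite hc.
    rewrite integral_dirac//.
    by rewrite diracT mul1e.
  by rewrite (D 1) ?(D 0)// => t; rewrite big_ord0.
have w0 i x : 0 <= w i x by exact: le_trans (normc_ge0 _) (fw i x).
have [iw' IHf] := IH (fun j => f (lift ord0 j)) (fun j => w (lift ord0 j))
  (fun j => mf _) (fun j => iw _) (fun j x => fw _ x).
have mw i : measurable_fun setT (w i : T -> R).
  by have /measurable_int/measurable_EFinP := iw i.
have mW : cmeasurable (fun t : n.+1.-tuple T => \prod_i (w i (tnth t i))%:C).
  exact: (cmeasurable_tuple_prod (fun i => cmeasurable_real (mw i))).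
have mWr : measurable_fun setT (fun t : n.+1.-tuple T => \prod_i w i (tnth t i)).
  have [+ _] := mW; congr (measurable_fun _ _).
  by apply/funext => t /=; rewrite -rmorph_prod.
have consE (x : T) (t : n.-tuple T) : \prod_i w i (tnth (cons_pair (x, t)) i) =
    w ord0 x * \prod_(i < n) w (lift ord0 i) (tnth t i).
  by rewrite big_ord_recl tnth0; congr (_ * _); apply: eq_bigr => i _; rewrite tnthS.
have iW : (mu n.+1).-integrable setT (EFin \o (fun t : n.+1.-tuple T => \prod_i w i (tnth t i))).
  apply: (transfer_integrable_inv (transfers_cons R n)) => //.
  apply: (integrable_product (iw ord0) iw').
    by apply: (measurableT_comp mWr); exact: measurable_cons_pair.
  move=> x t; rewrite /= consE ger0_norm// mulr_ge0//.
  by apply: prodr_ge0.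
split=> //.
have mF := cmeasurable_tuple_prod mf.
have normF t : normc (\prod_i f i (tnth t i)) <= \prod_i w i (tnth t i).
  by rewrite normc_prod; apply: ler_prod => i _; rewrite normc_ge0 fw.
have cF := cintegrable_dom mF iW normF.
have [_ ->] := transfer_cint (transfers_cons R n) cF.
rewrite mul1r -(cint_prod1 (iw ord0) iw'); last 2 first.
- exact: (cmeasurable_comp mF (@measurable_cons_pair R n)).
- by move=> x t; rewrite /= -consE normF.
have consfE (x : T) (t : n.-tuple T) : \prod_i f i (tnth (cons_pair (x, t)) i) =
    f ord0 x * \prod_(i < n) f (lift ord0 i) (tnth t i).
  by rewrite big_ord_recl tnth0; congr (_ * _); apply: eq_bigr => i _; rewrite tnthS.
have cF' : cintegrable (mu n) (fun t => \prod_(i < n) f (lift ord0 i) (tnth t i)).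
  apply: (cintegrable_dom (cmeasurable_tuple_prod (fun j => mf (lift ord0 j))) iw').
  by move=> t; rewrite normc_prod; apply: ler_prod => i _; rewrite normc_ge0 fw.
under eq_cint => x.
  under eq_cint => t do rewrite /= consfE.
  rewrite (cintZ _ cF') IHf mulrC.
over.
rewrite cintZ; last exact: (cintegrable_dom (mf ord0) (iw ord0) (fw ord0)).
by rewrite big_ord_recl mulrC.
Qed.

Definition decay1 (x : R) : R := (oneDsqr x)^-1.

Lemma decay1_ge0 x : 0 <= decay1 x.
Proof. by rewrite invr_ge0 (le_trans _ (oneDsqr_ge1 x)). Qed.

Lemma continuous_decay1 : continuous decay1.
Proof. exact: continuous_oneDsqrV. Qed.

Lemma integral_decay1 : (\int[lambda]_x (decay1 x)%:E = pi%:E)%E.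
Proof.
rewrite ge0_symfun_integralT//=.
- rewrite (_ : [set x | _] = `[0, +oo[%classic); last first.
    by apply/seteqP; split => x/=; rewrite in_itv/= andbT.
  by rewrite integral0y_oneDsqr -EFinM mulrCA divff// mulr1.
- exact: decay1_ge0.
- exact: continuous_decay1.
- by move=> x/=; rewrite /decay1 /oneDsqr sqrrN.
Qed.

Lemma integrable_decay1 : lambda.-integrable setT (EFin \o decay1).
Proof.
have md : measurable_fun setT (decay1 : T -> R).
  exact: (continuous_measurable_fun continuous_decay1).
apply/integrableP; split; first exact/measurable_EFinP.
under eq_integral do rewrite /= ger0_norm ?decay1_ge0//.
by rewrite integral_decay1 ltry.
Qed.

Lemma cint_decay1 : cint lambda (fun x => (2 * decay1 x)%:C) = (2 * pi)%:C.
Proof.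
rewrite /cint /=; congr (_ +i* _); last first.
  by rewrite /Rintegral integral0.
rewrite RintegralZl//; last exact: integrable_decay1.
by rewrite /Rintegral integral_decay1.
Qed.

Lemma continuous_coord_prod n (h : R -> R) : continuous h ->
  continuous (fun x : 'rV[R]_n => \prod_i h (x 0 i)).
Proof.
move=> ch; suff H (r : seq 'I_n) : continuous (fun x : 'rV[R]_n => \prod_(i <- r) h (x 0 i)).
  exact: H.
elim: r => [|i r IH].
  rewrite (_ : (fun x => _) = fun _ => 1); first exact: cst_continuous.
  by apply/funext => x; rewrite big_nil.
rewrite (_ : (fun x => _) = fun x : 'rV[R]_n => h (x 0 i) * \prod_(i <- r) h (x 0 i)).
  have c1 : continuous (fun x : 'rV[R]_n => h (x 0 i)).
    move=> x; apply: (@continuous_comp _ _ _ (fun x : 'rV[R]_n => x 0 i) h).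
      exact: coord_continuous.
    exact: ch.
  by move=> x; exact: (cvgM (c1 x) (IH x)).
by apply/funext => x; rewrite big_cons.
Qed.

(** An integrable bound with separated variables, of integral [pi ^+ n]. *)
Definition decay n (x : 'rV[R]_n) : R := \prod_i decay1 (x 0 i).

Lemma decay_ge0 n (x : 'rV[R]_n) : 0 <= decay x.
Proof. by apply: prodr_ge0 => i _; exact: decay1_ge0. Qed.

Lemma integrable_decay n :
  (mu n).-integrable setT (EFin \o (fun t => decay (row_of_tuple t))).
Proof.
have mf (i : 'I_n) : cmeasurable (fun x : T => (decay1 x)%:C).
  exact: cmeasurable_real (continuous_measurable_fun continuous_decay1).
have dn (i : 'I_n) (x : R) : normc (decay1 x)%:C <= decay1 x.
  by rewrite normc_real ger0_norm// decay1_ge0.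
have [+ _] := separated_integral mf (fun _ => integrable_decay1) dn.
congr (integrable _ _ _); apply/funext => t /=; congr EFin.
by apply: eq_bigr => i _; rewrite mxE.
Qed.

(** Abel's kernel, whose Fourier transform is the Poisson kernel [2 * decay1]. *)
Definition abel1 (x : R) : R := expR (- `|x|).

Lemma continuous_abel1 : continuous abel1.
Proof.
move=> x; apply: (@continuous_comp _ _ _ (fun x : R => - `|x|) expR).
  by apply: (@continuousN R); exact: norm_continuous.
exact: continuous_expR.
Qed.

Lemma abel1_ge0 x : 0 <= abel1 x. Proof. exact: expR_ge0. Qed.

(** The factor [1 + cos] is nonnegative, so that the improper integral may be
    computed by means of a primitive before integrability is known. The cosine
    transform of Abel's kernel follows by subtracting the value at [s = 0]. *)
Let half_abel (s : R) :
  (\int[lambda]_x (abel1 x * (1 + cos (s * x)))%:E = (2 * (1 + decay1 s))%:E)%E.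
Proof.
have cG : continuous (fun x => abel1 x * (1 + cos (s * x))).
  move=> x; apply: (@continuousM R); first exact: continuous_abel1.
  apply: (@continuousD R R); first exact: cst_continuous.
  apply: (@continuous_comp _ _ _ (fun x : R => s * x) cos); last exact: continuous_cos.
  by apply: (@continuousM R); [exact: cst_continuous|exact: cvg_id].
have G0 x : 0 <= abel1 x * (1 + cos (s * x)).
  by rewrite mulr_ge0 ?abel1_ge0//; have := cos_geN1 (s * x); lra.
rewrite ge0_symfun_integralT//=; last first.
  by move=> x/=; rewrite /abel1 normrN mulrN cosN.
rewrite EFinM; congr (_ * _)%E.
rewrite (_ : [set x | _] = `[0, +oo[%classic); last first.
  by apply/seteqP; split => x/=; rewrite in_itv/= andbT.
have scE (a b : R) : a *: b = a * b by [].
have d0 : 1 + s ^+ 2 != 0 by rewrite gt_eqF// ltr_pwDl// sqr_ge0.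
(* A primitive of the integrand on the half line. *)
pose F (x : R) := expR (- x) * (-1 + (s * sin (s * x) - cos (s * x)) / (1 + s ^+ 2)).
have dF (x : R) : is_derive x 1 F (expR (- x) * (1 + cos (s * x))).
  have d1 : is_derive x 1 (fun x : R => expR (- x)) (expR (- x) * -1).
    exact: (is_derive1_comp (is_derive_expR _) (is_deriveNid x 1)).
  have dsx : is_derive x 1 (fun x : R => s * x) s.
    apply: (is_derive_eq (is_deriveZ s (is_derive_id x 1))).
    by rewrite /GRing.scale/= mulr1.
  have ds : is_derive x 1 (fun x : R => sin (s * x)) (cos (s * x) * s).
    exact: (@is_derive1_comp R sin (fun x => s * x) x _ _ (is_derive_sin _) dsx).
  have dc : is_derive x 1 (fun x : R => cos (s * x)) (- sin (s * x) * s).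
    exact: (@is_derive1_comp R cos (fun x => s * x) x _ _ (is_derive_cos _) dsx).
  have H := is_deriveM d1 (is_deriveD (is_derive_cst (-1 : R) x 1)
    (is_deriveZ ((1 + s ^+ 2)^-1) (is_deriveB (is_deriveZ s ds) dc))).
  have FE : F = (fun x : R => expR (- x)) * (cst (-1) +
      (1 + s ^+ 2)^-1 *: (s *: (fun x : R => sin (s * x)) - (fun x : R => cos (s * x)))).
    by apply/funext => y; rewrite /F !fctE !scE [_ / _]mulrC.
  rewrite FE; apply: (is_derive_eq H).
  rewrite !fctE /= !scE.
  by field.
rewrite (@ge0_continuous_FTC2y _ _ F 0 0)//.
- rewrite /F oppr0 expR0 mulr0 sin0 cos0 -EFinB; congr (_%:E).
  by rewrite /decay1 /oneDsqr; field.
- by apply: continuous_subspaceT; exact: cG.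
- pose K := 2 + `|s|.
  have FK x : `|F x| <= expR (- x) * K.
    rewrite /F normrM ger0_norm ?expR_ge0// ler_wpM2l ?expR_ge0//.
    apply: (le_trans (ler_normD _ _)); rewrite normrN1 /K.
    suff : `|(s * sin (s * x) - cos (s * x)) / (1 + s ^+ 2)| <= `|s| + 1 by lra.
    rewrite normrM normfV [X in _ / X]ger0_norm ?addr_ge0 ?sqr_ge0//.
    rewrite ler_pdivrMr ?ltr_pwDl ?sqr_ge0//.
    apply: (@le_trans _ _ (`|s| + 1)).
      apply: (le_trans (ler_normB _ _)); rewrite normrM.
      by rewrite lerD ?cos_max// ler_piMr// sin_max.
    by rewrite ler_peMr ?addr_ge0// lerDl sqr_ge0.
  have eK : expR (- x) * K @[x --> +oo%R] --> 0.
    by rewrite -[X in _ --> X](mul0r K); apply: cvgM; [exact: cvgr_expR|exact: cvg_cst].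
  have eNK : - (expR (- x) * K) @[x --> +oo%R] --> 0.
    by rewrite -[X in _ --> X]oppr0; apply: cvgN.
  apply: (squeeze_cvgr _ eNK eK); apply: nearW => x.
  by rewrite -ler_norml.
- apply: cvg_at_right_filter; apply: differentiable_continuous.
  by apply/derivable1_diffP; have [] := dF 0.
- move=> x; rewrite in_itv/= andbT => x0.
  rewrite derive1E; have [_ ->] := dF x.
  by rewrite /abel1 gtr0_norm.
Qed.

Lemma measurable_abel1 : measurable_fun setT (abel1 : T -> R).
Proof. exact: (continuous_measurable_fun continuous_abel1). Qed.

Lemma integrable_abel1 : lambda.-integrable setT (EFin \o abel1).
Proof.
have m0 : measurable_fun setT (fun x : T => abel1 x * (1 + cos (0 * x))).
  apply: measurable_funM; first exact: measurable_abel1.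
  rewrite (_ : (fun x => _) = fun _ => 1 + 1); first exact: measurable_cst.
  by apply/funext => x; rewrite mul0r cos0.
have i0 : lambda.-integrable setT (EFin \o (fun x => abel1 x * (1 + cos (0 * x)))).
  apply/integrableP; split; first exact/measurable_EFinP.
  under eq_integral => x _.
    rewrite /= ger0_norm; last by rewrite mul0r cos0 mulr_ge0 ?abel1_ge0.
  over.
  by rewrite half_abel ltry.
apply: (le_integrable_real measurable_abel1 i0) => x.
by rewrite ger0_norm ?abel1_ge0// mul0r cos0 ler_peMr ?abel1_ge0//; lra.
Qed.

Lemma continuous_dilation (s : R) : continuous (fun x : R => s * x).
Proof. by move=> x; apply: (@continuousM R); [exact: cst_continuous|exact: cvg_id]. Qed.

Let integrable_abel_trig (h : R -> R) : continuous h -> (forall x, `|h x| <= 1) ->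
  lambda.-integrable setT (EFin \o (fun x => abel1 x * h x)).
Proof.
move=> ch h1; apply: (le_integrable_real _ integrable_abel1).
  apply: measurable_funM; first exact: measurable_abel1.
  exact: (continuous_measurable_fun ch).
by move=> x; rewrite normrM ger0_norm ?abel1_ge0// ler_piMr ?abel1_ge0.
Qed.

Let continuous_cosM (s : R) : continuous (fun x : R => cos (s * x)).
Proof.
move=> x; apply: (@continuous_comp _ _ _ (fun x : R => s * x) cos); first exact: continuous_dilation.
exact: continuous_cos.
Qed.

Let continuous_sinM (s : R) : continuous (fun x : R => sin (s * x)).
Proof.
move=> x; apply: (@continuous_comp _ _ _ (fun x : R => s * x) sin); first exact: continuous_dilation.
exact: continuous_sin.
Qed.

Let abel_cos (s : R) : \int[lambda]_x (abel1 x * cos (s * x)) = 2 * decay1 s.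
Proof.
have L (A B d : R) : A + B = 2 * (1 + d) -> A + A = 2 * (1 + 1) -> B = 2 * d by lra.
have ic t := integrable_abel_trig (@continuous_cosM t) (fun x => cos_max _).
have H t : \int[lambda]_x abel1 x + \int[lambda]_x (abel1 x * cos (t * x)) = 2 * (1 + decay1 t).
  rewrite -(RintegralD measurableT integrable_abel1 (ic t)).
  transitivity (\int[lambda]_x (abel1 x * (1 + cos (t * x)))).
    by apply: eq_Rintegral => x _; rewrite mulrDr mulr1.
  by rewrite /Rintegral half_abel.
have := H 0; have -> : \int[lambda]_x (abel1 x * cos (0 * x)) = \int[lambda]_x abel1 x.
  by apply: eq_Rintegral => x _; rewrite mul0r cos0 mulr1.
have -> : decay1 0 = 1 by rewrite /decay1 /oneDsqr expr0n addr0 invr1.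
exact: (L _ _ _ (H s)).
Qed.

Let abel_sin (s : R) : \int[lambda]_x (abel1 x * sin (s * x)) = 0.
Proof.
have L (A : R) : A = - A -> A = 0 by lra.
have is_ := integrable_abel_trig (@continuous_sinM s) (fun x => sin_max _).
have := transfer_integral (transfers_opp R) is_; rewrite mul1r.
have -> : \int[lambda]_x (abel1 (- x) * sin (s * - x)) =
    - \int[lambda]_x (abel1 x * sin (s * x)).
  rewrite -mulN1r -RintegralZl//; apply: eq_Rintegral => x _.
  by rewrite /abel1 normrN mulrN sinN mulN1r mulrN.
exact: L.
Qed.

Lemma abel1_fourier (s : R) :
  cint lambda (fun x => (abel1 x)%:C * expi (s * x)) = (2 * decay1 s)%:C.
Proof.
rewrite /cint; congr (_ +i* _).
  rewrite -(abel_cos s); apply: eq_Rintegral => x _.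
  by rewrite Re_mul /= mul0r subr0.
rewrite -(abel_sin s); apply: eq_Rintegral => x _.
by rewrite Im_mul /= mul0r addr0.
Qed.

Definition abel n (x : 'rV[R]_n) : R := \prod_i abel1 (x 0 i).

Lemma abel_ge0 n (x : 'rV[R]_n) : 0 <= abel x.
Proof. by apply: prodr_ge0 => i _; exact: abel1_ge0. Qed.

Lemma abel_le1 n (x : 'rV[R]_n) : abel x <= 1.
Proof.
by apply: prodr_ile1 => i _; rewrite abel1_ge0 -expR0 ler_expR oppr_le0 normr_ge0.
Qed.

Lemma expi_sum (J : Type) (r : seq J) (g : J -> R) :
  expi (\sum_(j <- r) g j) = \prod_(j <- r) expi (g j).
Proof. by apply: (big_morph (@expi R) (@expiD R)); rewrite expi0. Qed.

Lemma abel_fourier n (t : 'rV[R]_n) :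
  integralC (fun x : 'rV[R]_n => (abel x)%:C * expi (dot t x)) =
  (2 ^+ n * decay t)%:C.
Proof.
pose f (i : 'I_n) (x : R) : R[i] := (abel1 x)%:C * expi (t 0 i * x).
have mf i : cmeasurable (f i : T -> R[i]).
  apply: cmeasurableM; first exact: (cmeasurable_real measurable_abel1).
  apply: cmeasurable_expi; exact: (continuous_measurable_fun (@continuous_dilation (t 0 i))).
have nf i x : normc (f i x) <= abel1 x.
  by rewrite normcM normc_expi mulr1 normc_real ger0_norm ?abel1_ge0.
have [_ H] := separated_integral mf (fun _ => integrable_abel1) nf.
rewrite -[LHS]/(cint (mu n) _).
transitivity (cint (mu n) (fun s => \prod_i f i (tnth s i))).
  apply: eq_cint => s /=; rewrite big_split /= -rmorph_prod; congr (_%:C * _).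
    by apply: eq_bigr => i _; rewrite mxE.
  rewrite /dot expi_sum; apply: eq_bigr => i _; by rewrite mxE.
rewrite H; under eq_bigr do rewrite abel1_fourier.
by rewrite -rmorph_prod big_split /= prodr_const card_ord.
Qed.

Lemma integral_decay n :
  integralC (fun x : 'rV[R]_n => (2 ^+ n * decay x)%:C) = ((2 * pi) ^+ n)%:C.
Proof.
have mf (i : 'I_n) : cmeasurable (fun x : T => (2 * decay1 x)%:C).
  apply: cmeasurable_real; apply: measurable_funM; first exact: measurable_cst.
  exact: (continuous_measurable_fun continuous_decay1).
have iw (i : 'I_n) : lambda.-integrable setT (EFin \o (fun x => 2 * decay1 x)).
  exact: (@integrableZl _ _ _ lambda setT _ 2 _ integrable_decay1).
have nf (i : 'I_n) x : normc (2 * decay1 x)%:C <= 2 * decay1 x.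
  by rewrite normc_real ger0_norm// mulr_ge0// decay1_ge0.
have [_ H] := separated_integral mf iw nf.
rewrite -[LHS]/(cint (mu n) _).
transitivity (cint (mu n) (fun s => \prod_(i < n) (2 * decay1 (tnth s i))%:C)).
  apply: eq_cint => s /=; rewrite -rmorph_prod big_split /= prodr_const card_ord.
  by congr ((_ * _)%:C); apply: eq_bigr => i _; rewrite mxE.
rewrite H; under eq_bigr do rewrite cint_decay1.
by rewrite prodr_const card_ord rmorphXn.
Qed.

End product_functions.

(** * Integrals of decaying functions *)

Section dominated_functions.
Variable R : realType.
Local Notation T := (measurableTypeR R).
Local Notation mu := (lebesgue_tuple R).
Local Notation Re := (@complex.Re R).
Local Notation Im := (@complex.Im R).

(** A class of integrable functions on which Fubini's theorem and translations can
    be used without further hypotheses. *)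
Definition decaying n (f : 'rV[R]_n -> R[i]) :=
  continuous f /\ exists M : R, forall x, normc (f x) <= M * decay x.

Lemma decayingZ n c (f : 'rV[R]_n -> R[i]) : decaying f -> decaying (fun x => c * f x).
Proof.
move=> [cf [M fM]]; split.
  exact: (continuous_mulC (@continuous_cstC R 'rV[R]_n c) cf).
by exists (normc c * M) => x; rewrite normcM -mulrA ler_wpM2l ?normc_ge0.
Qed.

Lemma decayingM n (f g : 'rV[R]_n -> R[i]) (M : R) : continuous f -> (forall x, normc (f x) <= M) ->
  decaying g -> decaying (fun x => f x * g x).
Proof.
move=> cf fM [cg [M' gM]]; split; first exact: (continuous_mulC cf cg).
exists (M * M') => x; rewrite normcM -mulrA ler_pM ?normc_ge0//.
Qed.

Lemma decayingD n (f g : 'rV[R]_n -> R[i]) : decaying f -> decaying g ->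
  decaying (fun x => f x + g x).
Proof.
move=> [cf [M fM]] [cg [M' gM]]; split.
  by move=> x; exact: (continuousD (cf x) (cg x)).
exists (M + M') => x; rewrite mulrDl.
exact: le_trans (le_normcD _ _) (lerD (fM x) (gM x)).
Qed.

Lemma integralCE n (f : 'rV[R]_n -> R[i]) :
  integralC f = cint (mu n) (f \o @row_of_tuple R n).
Proof. by []. Qed.

Lemma eq_integralC n (f g : 'rV[R]_n -> R[i]) : f =1 g -> integralC f = integralC g.
Proof. by move=> /funext ->. Qed.

Lemma weightX_decay n (x : 'rV[R]_n) : 1 <= weight x ^+ n * decay x.
Proof.
have H : \prod_(i < n) oneDsqr (x 0 i) <= weight x ^+ n.
  apply: (@le_trans _ _ (\prod_(i < n) weight x)).
    apply: ler_prod => i _; rewrite (le_trans _ (oneDsqr_ge1 _))//=.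
    rewrite /oneDsqr /weight lerD2l (bigD1 i)//= lerDl sumr_ge0// => j _.
    exact: sqr_ge0.
  by rewrite prodr_const card_ord.
have P0 : 0 < \prod_(i < n) oneDsqr (x 0 i).
  by apply: prodr_gt0 => i _; exact: lt_le_trans (oneDsqr_ge1 _).
have -> : decay x = (\prod_(i < n) oneDsqr (x 0 i))^-1 by rewrite -prodfV.
by rewrite ler_pdivlMr// mul1r.
Qed.

Lemma decay_gt0 n (x : 'rV[R]_n) : 0 < decay x.
Proof.
by apply: prodr_gt0 => i _; rewrite invr_gt0 (lt_le_trans _ (oneDsqr_ge1 _)).
Qed.

Lemma integrable_Mdecay n (M : R) :
  (mu n).-integrable setT (EFin \o (fun t => M * decay (row_of_tuple t))).
Proof. exact: (@integrableZl _ _ _ (mu n) setT _ M _ (integrable_decay R n)). Qed.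

Lemma decaying_integrable n (f : 'rV[R]_n -> R[i]) : decaying f ->
  cintegrable (mu n) (f \o @row_of_tuple R n).
Proof.
move=> [cf [M fM]]; apply: (cintegrable_dom (cmeasurable_row cf) (integrable_Mdecay n M)).
by move=> t; exact: fM.
Qed.

Lemma le_normc_integralC n (f : 'rV[R]_n -> R[i]) (M : R) : continuous f ->
  (forall x, normc (f x) <= M * decay x) ->
  normc (integralC f) <= M * (2 * \int[mu n]_t decay (row_of_tuple t)).
Proof.
move=> cf fM.
have := le_normc_cint (decaying_integrable (conj cf (ex_intro _ M fM)))
  (integrable_Mdecay n M) (fun t => fM _).
by rewrite (RintegralZl _ measurableT (integrable_decay R n)) mulrCA.
Qed.

Lemma integralCD n (f g : 'rV[R]_n -> R[i]) : decaying f -> decaying g ->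
  integralC (fun x => f x + g x) = integralC f + integralC g.
Proof.
by move=> df dg; exact: (cintD (decaying_integrable df) (decaying_integrable dg)).
Qed.

Lemma integralCZ n c (f : 'rV[R]_n -> R[i]) : decaying f ->
  integralC (fun x => c * f x) = c * integralC f.
Proof. by move=> df; exact: (cintZ c (decaying_integrable df)). Qed.

Lemma integralC_affine n (c : 'rV[R]_n) (a : R) (f : 'rV[R]_n -> R[i]) : 0 < a ->
  decaying f -> integralC f = (a ^+ n)%:C * integralC (fun x => f (c + a *: x)).
Proof.
move=> a0 df; pose ct := [tuple c 0 i | i < n].
rewrite (integralCE f).
have [_ ->] := transfer_cint (transfers_affine ct a0) (decaying_integrable df).
congr (_ * _); apply: eq_cint => t /=; congr f.
rewrite row_of_affine_tuple; congr (_ + _).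
by apply/rowP => i; rewrite mxE tnth_mktuple.
Qed.

Lemma integralC_translation n (c : 'rV[R]_n) (f : 'rV[R]_n -> R[i]) :
  decaying f -> integralC (fun x => f (c + x)) = integralC f.
Proof.
move=> df; rewrite (integralC_affine c ltr01 df) expr1n mul1r.
by apply: eq_integralC => x; rewrite scale1r.
Qed.

(** The domination is local in the parameter, on a segment through each point:
    the translates of a decaying function have no common bound. *)
Lemma is_directional_integral N n (v : 'rV[R]_N) (F F' : 'rV[R]_N -> 'rV[R]_n -> R[i]) :
  (forall z, decaying (F z)) -> (forall x, is_directional v (F^~ x) (F'^~ x)) ->
  (forall z, exists M : R, forall (s : R) x, -1 < s < 1 ->
     normc (F' (z + s *: v) x) <= M * decay x) ->
  is_directional v (fun z => integralC (F z)) (fun z => integralC (F' z)).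
Proof.
move=> dF dFF' F'M z.
suff H (p : R[i] -> R) (f := fun s : R => fun t : n.-tuple T => p (F (z + s *: v) (row_of_tuple t)))
    (f' := fun s : R => fun t : n.-tuple T => p (F' (z + s *: v) (row_of_tuple t))) :
    (forall c, `|p c| <= normc c) ->
    (forall s, (mu n).-integrable setT (EFin \o f s)) ->
    (forall (s : R) t, is_derive s 1 (f^~ t) (f' s t)) ->
    is_derive (0 : R) 1 (fun s => \int[mu n]_t f s t) (\int[mu n]_t f' 0 t).
  have D (p : R[i] -> R) (s : R) t (dp : forall y, is_derive y v (p \o (F^~ (row_of_tuple t))) (p (F' y (row_of_tuple t)))) :
      is_derive s 1 (fun s : R => p (F (z + s *: v) (row_of_tuple t))) (p (F' (z + s *: v) (row_of_tuple t))).
    by apply/(is_derive_line (fun z => p (F z (row_of_tuple t)))); exact: dp.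
  split.
    have := H Re (fun c => normc_Re c) (fun s => (decaying_integrable (dF (z + s *: v))).1)
      (fun s t => D Re s t (fun y => (dFF' (row_of_tuple t) y).1)).
    move/(is_derive_line (fun z => \int[mu n]_t Re (F z (row_of_tuple t)))).
    by rewrite !scale0r !addr0.
  have := H Im (fun c => normc_Im c) (fun s => (decaying_integrable (dF (z + s *: v))).2)
    (fun s t => D Im s t (fun y => (dFF' (row_of_tuple t) y).2)).
  move/(is_derive_line (fun z => \int[mu n]_t Im (F z (row_of_tuple t)))).
  by rewrite !scale0r !addr0.
move=> pn intf df.
have [M HM] := F'M z.
have dE (s : R) t : partial1of2 f s t = f' s t.
  by rewrite partial1of2E; have [_ ->] := df s t.
have I0 : `]-1, 1[%classic (0 : R) by rewrite /= in_itv/= ltrN10 ltr01.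
have G0 (t : n.-tuple T) : 0 <= `|M| * decay (row_of_tuple t) by rewrite mulr_ge0// decay_ge0.
have Gub s t : `]-1, 1[%classic s -> setT t -> `|partial1of2 f s t| <= `|M| * decay (row_of_tuple t).
  rewrite /= in_itv/= => sI _; rewrite dE (le_trans (pn _))//.
  apply: (le_trans (HM s _ sI)); rewrite ler_wpM2r ?decay_ge0//.
  exact: ler_norm.
have df1 s t : `]-1, 1[%classic s -> setT t -> derivable (f^~ t) s 1.
  by move=> _ _; have [] := df s t.
have := @cvg_differentiation_under_integral R _ _ (mu n) f setT measurableT 0 (-1) 1 I0
  (fun s _ => intf s) df1 _ G0 (integrable_Mdecay n `|M|) Gub.
move=> cv.
have dE0 : \int[mu n]_t f' 0 t = \int[mu n]_t partial1of2 f 0 t.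
  by apply: eq_Rintegral => t _; rewrite dE.
rewrite dE0; split.
  apply/cvg_ex; exists (\int[mu n]_t partial1of2 f 0 t).
  by under eq_fun do rewrite /= scaler1.
apply: cvg_lim => //.
by under eq_fun do rewrite /= scaler1.
Qed.

End dominated_functions.

Section phases.
Variables (R : realType) (N : nat).
Local Notation E := 'rV[R]_N.

Lemma is_directional_expi (v : E) (g g' : E -> R) :
  (forall x, is_derive x v g (g' x)) ->
  is_directional v (fun x => expi (g x)) (fun x => (0 +i* g' x) * expi (g x)).
Proof.
move=> dg x.
have H (h : R -> R) (h' : R) : is_derive (g x) 1 h h' -> is_derive x v (h \o g) (g' x * h').
  move=> dh.
  have dl : is_derive (0 : R) 1 (fun s => g (x + s *: v)) (g' x).
    by apply/(is_derive_line g x v 0); rewrite scale0r addr0; exact: dg.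
  have dh0 : is_derive (g (x + 0 *: v)) 1 h h' by rewrite scale0r addr0.
  have := @is_derive1_comp R h (fun s => g (x + s *: v)) 0 _ _ dh0 dl.
  by rewrite mulrC => /(is_derive_line (h \o g) x v 0); rewrite scale0r addr0.
rewrite Re_mul Im_mul /= !mul0r sub0r add0r; split.
  by rewrite -mulrN; exact: (H (@cos R) _ (is_derive_cos _)).
exact: (H (@sin R) _ (is_derive_sin _)).
Qed.

Lemma dotDl (x y z : E) : dot (x + y) z = dot x z + dot y z.
Proof. by rewrite /dot -big_split; apply: eq_bigr => i _; rewrite mxE mulrDl. Qed.

Lemma dotZl a (x z : E) : dot (a *: x) z = a * dot x z.
Proof. by rewrite /dot mulr_sumr; apply: eq_bigr => i _; rewrite mxE mulrA. Qed.

Lemma dotC (x y : E) : dot x y = dot y x.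
Proof. by apply: eq_bigr => i _; rewrite mulrC. Qed.

Lemma dotDr (x y z : E) : dot x (y + z) = dot x y + dot x z.
Proof. by rewrite dotC dotDl ![dot _ x]dotC. Qed.

Lemma dotZr a (x z : E) : dot x (a *: z) = a * dot x z.
Proof. by rewrite dotC dotZl dotC. Qed.

Lemma dotNr (x y : E) : dot x (- y) = - dot x y.
Proof. by rewrite -scaleN1r dotZr mulN1r. Qed.

Lemma dot_delta (x : E) i : dot x (delta_mx 0 i) = x 0 i.
Proof.
rewrite /dot (bigD1 i)//= mxE !eqxx mulr1 big1 ?addr0// => j ji.
by rewrite mxE (negPf ji) andbF mulr0.
Qed.

Lemma is_derive_affine1 (a b : R) : is_derive (0 : R) 1 (fun s => a + s * b) b.
Proof.
have := is_deriveD (is_derive_cst a (0 : R) 1) (is_deriveZ b (is_derive_id (0 : R) 1)).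
rewrite add0r /GRing.scale/= mulr1; congr is_derive.
by apply/funext => s; rewrite !fctE /= mulrC.
Qed.

Lemma is_derive_ndot (v z x : E) : is_derive x v (fun x => - dot x z) (- dot v z).
Proof.
have := is_derive_affine1 (- dot x z) (- dot v z).
rewrite (_ : (fun s => _) = fun s => - dot (x + s *: v) z).
  by move/(is_derive_line (fun x => - dot x z) x v 0); rewrite scale0r addr0.
by apply/funext => s; rewrite dotDl dotZl opprD mulrN.
Qed.

Lemma is_directional_phase (v z : E) :
  is_directional v (fun x => expi (- dot x z)) (fun x => (0 +i* (- dot v z)) * expi (- dot x z)).
Proof. by apply: is_directional_expi => x; exact: is_derive_ndot. Qed.

Lemma continuous_phase (z : E) : continuous (fun x => expi (- dot x z)).
Proof.
apply: (@bounded_partials_continuous _ _ _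
  (fun i x => (0 +i* (- dot (delta_mx 0 i) z)) * expi (- dot x z))
  (fun i => normc (0 +i* (- dot (delta_mx 0 i) z)))) => i.
  exact: is_directional_phase.
by move=> x; rewrite normcM normc_expi mulr1.
Qed.

End phases.

Section schwartz_decay.
Variable R : realType.

Lemma schwartz_family_decay (I : Type) (e : I -> R) N (F : I -> 'rV[R]_N -> R[i]) :
  schwartz_family e F ->
  exists M : R, forall k x, normc (F k x) <= M * e k * decay x.
Proof.
move=> sF; have [M FM] := schwartz_family_rapid sF N.
exists M => k x; rewrite [leRHS]mulrC.
have H := weightX_decay x; have n0 := normc_ge0 (F k x).
apply: (@le_trans _ _ ((weight x ^+ N * decay x) * normc (F k x))).
  by rewrite ler_peMl.
by rewrite [weight x ^+ _ * _]mulrC -mulrA ler_wpM2l ?decay_ge0.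
Qed.

Lemma is_schwartz_decaying N (f : 'rV[R]_N -> R[i]) : is_schwartz f -> decaying f.
Proof.
move=> /is_schwartzE sf; split; first exact: (@schwartz_family_continuous _ _ _ _ _ sf tt).
by have [M HM] := schwartz_family_decay sf; exists M => x; have := HM tt x; rewrite mulr1.
Qed.

Lemma decaying_phaseN N (z : 'rV[R]_N) (h : 'rV[R]_N -> R[i]) :
  decaying h -> decaying (fun t => expi (- dot t z) * h t).
Proof.
move=> [ch [M hM]]; split; last by exists M => y; rewrite normcM normc_expi mul1r.
exact: (continuous_mulC (@continuous_phase R N z) ch).
Qed.

Lemma decaying_phase N (z : 'rV[R]_N) (h : 'rV[R]_N -> R[i]) :
  decaying h -> decaying (fun t => expi (dot z t) * h t).
Proof.
move=> /(decaying_phaseN (- z)); congr decaying.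
by apply/funext => t; rewrite dotNr opprK dotC.
Qed.

Lemma weight_row_mx n (x y : 'rV[R]_n) : weight x <= weight (row_mx x y).
Proof.
rewrite /weight big_split_ord /= lerD2l.
under [X in _ <= X + _]eq_bigr do rewrite row_mxEl.
by rewrite lerDl sumr_ge0// => i _; exact: sqr_ge0.
Qed.

Lemma weight_row_mxr n (x y : 'rV[R]_n) : weight y <= weight (row_mx x y).
Proof.
rewrite /weight big_split_ord /= lerD2l.
under [X in _ <= _ + X]eq_bigr do rewrite row_mxEr.
by rewrite lerDr sumr_ge0// => i _; exact: sqr_ge0.
Qed.

Lemma schwartz_family_slice_decay (I : Type) (e : I -> R) n (F : I -> 'rV[R]_(n + n) -> R[i]) :
  schwartz_family e F ->
  exists M : R, forall k x y, normc (F k (row_mx x y)) <= M * e k * decay x.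
Proof.
move=> sF; have [M FM] := schwartz_family_rapid sF n.
exists M => k x y; rewrite [leRHS]mulrC.
have H := weightX_decay x; have n0 := normc_ge0 (F k (row_mx x y)).
apply: (@le_trans _ _ ((weight x ^+ n * decay x) * normc (F k (row_mx x y)))).
  by rewrite ler_peMl.
rewrite [weight x ^+ _ * _]mulrC -mulrA ler_wpM2l ?decay_ge0//; apply: le_trans (FM k (row_mx x y)).
by rewrite ler_wpM2r//; apply: lerXn2r; rewrite ?nnegrE ?weight_ge0// weight_row_mx.
Qed.

Lemma norm_row_mx n (x y : 'rV[R]_n) (r : R) : `|x| <= r -> `|y| <= r -> `|row_mx x y| <= r.
Proof.
move=> xr yr; have r0 := le_trans (normr_ge0 _) xr.
rewrite [leLHS]mx_normrE; apply/bigmax_leP; split=> // -[i j] _ /=.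
rewrite ord1; case: (split_ordP j) => k ->.
  by rewrite row_mxEl (le_trans (coord_le_norm x k)).
by rewrite row_mxEr (le_trans (coord_le_norm y k)).
Qed.

Lemma continuous_row_mx n (y : 'rV[R]_n) : continuous (fun x : 'rV[R]_n => row_mx x y).
Proof.
move=> x; apply/(@cvgrPdist_lt _ _ _ _ (nbhs_filter (x : 'rV[R]_n))) => e e0.
apply: filterS (nbhsx_ballx x _ e0) => z; rewrite -ball_normE /ball_/= => xz.
rewrite opp_row_mx add_row_mx subrr; apply: le_lt_trans xz.
by apply: norm_row_mx; rewrite ?normr0.
Qed.

Lemma smooth_coord N (i : 'I_N) : smooth (fun x : 'rV[R]_N => (x 0 i)%:C) /\
  forall j, partial j (fun x : 'rV[R]_N => (x 0 i)%:C) = fun _ => ((i == j)%:R)%:C.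
Proof.
have H j : is_partial j (fun x : 'rV[R]_N => (x 0 i)%:C) (fun _ => ((i == j)%:R)%:C).
  have := @is_partial_coord R N id (fun _ => 1) 0 1 i j (fun y => is_derive_id y 1).
  apply: is_directional_ext => x; first by rewrite add0r mul1r.
  by rewrite !mulr1.
split=> [|j]; last by have /is_partialP[] := H j.
apply: (@smooth_algebra _ _ [set fun x : 'rV[R]_N => (x 0 i)%:C]); last exact: algebra_in.
move=> _ ->; split=> [|j].
  apply/continuous_ReIm; split; first exact: coord_continuous.
  by apply: (@cst_continuous _ _ (0 : R)).
by exists (fun _ => ((i == j)%:R)%:C); split=> //; exact: algebra_cst.
Qed.

Lemma slow_coord (I : Type) N (c : R[i]) (i : 'I_N) :
  slow_family (fun _ : I => 1) (fun _ x => c * (x 0 i)%:C).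
Proof.
have [sx dx] := smooth_coord i.
have sc : smooth (fun x : 'rV[R]_N => c * (x 0 i)%:C).
  exact: (smoothM (smooth_cst c) sx).
have dcx j : partial j (fun x : 'rV[R]_N => c * (x 0 i)%:C) = fun _ => c * ((i == j)%:R)%:C.
  have := is_directionalZ c (smooth_is_partial j sx); rewrite dx.
  by move=> /is_partialP[].
split=> // t; exists 1%N, (normc c) => _ x; rewrite mulr1 expr1.
case/lastP: t => [|t j].
  by rewrite /= normcM normc_real ler_wpM2l ?normc_ge0// coord_le_weight.
rewrite partials_rcons dcx; case/lastP: t => [|t k]; last first.
  by rewrite partials_cst normc0 mulr_ge0 ?normc_ge0 ?weight_ge0.
rewrite /= normcM normc_real ler_wpM2l ?normc_ge0//.
rewrite (le_trans _ (weight_ge1 x))// normr_nat; by case: eqP.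
Qed.

Lemma schwartz_family_coordM (I : Type) (e : I -> R) N (F : I -> 'rV[R]_N -> R[i]) c i :
  schwartz_family e F -> schwartz_family e (fun k x => c * (x 0 i)%:C * F k x).
Proof.
move=> sF; have := schwartz_familyM (slow_coord I c i) sF.
by congr schwartz_family; apply/funext => k; rewrite mul1r.
Qed.

Lemma schwartz_familyZ (I : Type) (e : I -> R) N (F : I -> 'rV[R]_N -> R[i]) c :
  schwartz_family e F -> schwartz_family e (fun k x => c * F k x).
Proof.
move=> sF; have : slow_family (fun _ : I => 1) (fun _ (_ : 'rV[R]_N) => c).
  split=> [_|t]; first exact: smooth_cst.
  exists 0%N, (normc c) => _ x; rewrite expr0 !mulr1.
  by case/lastP: t => [//|t i]; rewrite partials_cst normc0 normc_ge0.
move=> /schwartz_familyM/(_ sF).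
by congr schwartz_family; apply/funext => k; rewrite mul1r.
Qed.

Lemma oneDsqr_ge0 (x : R) : 0 <= oneDsqr x.
Proof. exact: le_trans ler01 (oneDsqr_ge1 x). Qed.

(** In one variable this is Peetre's inequality
    [1 + b ^ 2 <= 2 (1 + a ^ 2) (1 + (a + b) ^ 2)]. *)
Lemma decay_translate n (z x : 'rV[R]_n) :
  decay (z + x) <= (\prod_i (2 * oneDsqr (z 0 i))) * decay x.
Proof.
rewrite /decay -big_split; apply: ler_prod => i _ /=; rewrite decay1_ge0 mxE /=.
set a := z 0 i; set b := x 0 i.
have p1 : 0 < oneDsqr b by rewrite (lt_le_trans _ (oneDsqr_ge1 _)).
have p2 : 0 < oneDsqr (a + b) by rewrite (lt_le_trans _ (oneDsqr_ge1 _)).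
rewrite /decay1 ler_pdivlMr// mulrC ler_pdivrMr// /oneDsqr.
have := sqr_ge0 (a * (a + b)); have := sqr_ge0 (a + (a + b)); nra.
Qed.

Lemma decaying_translate n (z : 'rV[R]_n) (g : 'rV[R]_n -> R[i]) :
  decaying g -> decaying (fun x => g (z + x)).
Proof.
move=> [cg [M gM]]; split.
  move=> x; apply: (@continuous_comp _ _ _ (fun x => z + x) g); last exact: cg.
  apply: (@continuousD R); first exact: cst_continuous.
  exact: cvg_id.
exists (`|M| * (\prod_i (2 * oneDsqr (z 0 i)))) => x.
apply: (le_trans (gM _)); rewrite -mulrA.
apply: (@le_trans _ _ (`|M| * decay (z + x))).
  by rewrite ler_wpM2r ?decay_ge0// ler_norm.
by rewrite ler_wpM2l// decay_translate.
Qed.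

(** The integral of a derivative is the derivative of the integrals of the
    translates, which do not depend on the translation. *)
Lemma integralC_partial n j (g g' : 'rV[R]_n -> R[i]) : decaying g -> decaying g' ->
  is_partial j g g' -> integralC g' = 0.
Proof.
move=> dg dg' gg'.
have H : is_partial j (fun z => integralC (fun x => g (z + x)))
    (fun z => integralC (fun x => g' (z + x))).
  apply: is_directional_integral => [z|x|z]; first exact: decaying_translate.
    apply: (@is_directional_pullback _ _ _ (fun z => z + x)) gg' => z s.
    by rewrite addrA.
  have [_ [M gM]] := dg'.
  exists (`|M| * (\prod_(i < n) (2 * oneDsqr (`|z 0 i| + 1)))) => s x sI.
  apply: (le_trans (gM _)); rewrite -mulrA.
  apply: (@le_trans _ _ (`|M| * decay (z + s *: delta_mx 0 j + x))).
    by rewrite ler_wpM2r ?decay_ge0// ler_norm.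
  rewrite ler_wpM2l//; apply: (le_trans (decay_translate _ _)).
  rewrite ler_wpM2r ?decay_ge0//; apply: ler_prod => i _.
  rewrite mulr_ge0 ?oneDsqr_ge0//=.
  rewrite ler_pM2l// /oneDsqr lerD2l.
  have zi : `|(z + s *: delta_mx 0 j) 0 i| <= `|z 0 i| + 1.
    rewrite !mxE eqxx /=; apply: (le_trans (ler_normD _ _)); rewrite lerD2l normrM.
    have s1 : `|s| <= 1 by rewrite ltW// ltr_norml.
    by case: (i == j); rewrite ?normr1 ?mulr1 ?normr0 ?mulr0.
  rewrite -(real_normK (num_real ((z + s *: delta_mx 0 j) 0 i))).
  by apply: lerXn2r; rewrite ?nnegrE ?addr_ge0.
have E z : integralC (fun x => g (z + x)) = integralC g by exact: integralC_translation.
have {}H : is_partial j (fun _ => integralC g) (fun z => integralC (fun x => g' (z + x))).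
  by apply: is_directional_ext H.
have /is_partialP[_ H1] := H.
have /is_partialP[_ H2] := @is_directional_cst R n (delta_mx 0 j) (integralC g).
have := congr1 (fun h => h 0) (etrans (esym H2) H1) => /= ->.
by apply: eq_integralC => x; rewrite add0r.
Qed.

End schwartz_decay.

(** * The partial Fourier transform *)

Section partial_fourier_transform.
Variables (R : realType) (n : nat).
Local Notation E := 'rV[R]_n.
Local Notation EE := 'rV[R]_(n + n).
Implicit Types (f : EE -> R[i]).

Let phi f (z : EE) (x : E) : R[i] :=
  expi (- dot x (lsubmx z)) * f (row_mx x (rsubmx z)).

Let normc_phi f z x : normc (phi f z x) = normc (f (row_mx x (rsubmx z))).
Proof. by rewrite normcM normc_expi mul1r. Qed.

Let schwartz_slice_decay f : is_schwartz f ->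
  exists M : R, forall x y, normc (f (row_mx x y)) <= M * decay x.
Proof.
move=> /is_schwartzE sf; have [M HM] := schwartz_family_slice_decay sf.
by exists M => x y; have := HM tt x y; rewrite mulr1.
Qed.

Lemma schwartz_continuous N (g : 'rV[R]_N -> R[i]) : is_schwartz g -> continuous g.
Proof. by move=> /is_schwartz_decaying[]. Qed.

Let decaying_phi f z : is_schwartz f -> decaying (phi f z).
Proof.
move=> sf; apply: decaying_phaseN; split; last first.
  by have [M HM] := schwartz_slice_decay sf; exists M => x; exact: HM.
move=> x; apply: (@continuous_comp _ _ _ (fun x : E => row_mx x (rsubmx z)) f).
  exact: continuous_row_mx.
exact: schwartz_continuous.
Qed.

Lemma schwartz_partial N i (g : 'rV[R]_N -> R[i]) : is_schwartz g -> is_schwartz (partial i g).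
Proof. by move=> /is_schwartzE sg; apply/is_schwartzE; exact: schwartz_family_partial sg i. Qed.

Lemma schwartz_coordM N i c (g : 'rV[R]_N -> R[i]) : is_schwartz g ->
  is_schwartz (fun x => c * (x 0 i)%:C * g x).
Proof. by move=> /is_schwartzE sg; apply/is_schwartzE; exact: schwartz_family_coordM sg. Qed.

Lemma schwartz_is_partial N i (g : 'rV[R]_N -> R[i]) : is_schwartz g ->
  is_partial i g (partial i g).
Proof. by move=> [sg _]; exact: smooth_is_partial. Qed.

Let ci : R[i] := 0 +i* (- 1).

Let ciE (a : R) : (0 +i* - a : R[i]) = ci * a%:C.
Proof. by apply/eqP; rewrite eq_complex /= !mul0r !mulr0 subrr mulN1r add0r !eqxx. Qed.

(** This rule and the next three exchange derivatives and multiplications by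
    coordinates. They show that the partial Fourier transforms of Schwartz
    families form a class to which [schwartz_family_coind_coord] applies. *)
Lemma partial_fourier_dleft j f : is_schwartz f ->
  is_partial (lshift n j) (partial_fourier f)
    (partial_fourier (fun w : EE => ci * (w 0 (lshift n j))%:C * f w)).
Proof.
move=> sf; apply: is_directional_integral => [z|x|z]; first exact: decaying_phi.
  have Lx z (s : R) : rsubmx (s *: delta_mx 0 (lshift n j) + z) = s *: 0 + rsubmx z :> E.
    by rewrite rsubmx_shift rsubmx_delta0.
  have d2 := is_directional_pullback Lx (is_directional0 (fun y => f (row_mx x y))).
  have Ll z (s : R) : lsubmx (s *: delta_mx 0 (lshift n j) + z) = s *: delta_mx 0 j + lsubmx z :> E.
    by rewrite lsubmx_shift lsubmx_delta.
  have d1 := is_directional_pullback Ll (is_directional_phase (delta_mx 0 j) x).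
  apply: is_directional_ext (is_directionalM d1 d2) => z /=.
    by rewrite dotC.
  rewrite mulr0 addr0 dotC dot_delta ciE row_mxEl dotC.
  by rewrite mulrAC [RHS]mulrA mulrAC; ring.
have [M HM] := schwartz_slice_decay (schwartz_coordM (lshift n j) ci sf).
by exists M => s x _; rewrite normcM normc_expi mul1r; exact: HM.
Qed.

Lemma partial_fourier_dright j f : is_schwartz f ->
  is_partial (rshift n j) (partial_fourier f)
    (partial_fourier (partial (rshift n j) f)).
Proof.
move=> sf; apply: is_directional_integral => [z|x|z]; first exact: decaying_phi.
  have Lx z (s : R) : row_mx x (rsubmx (s *: delta_mx 0 (rshift n j) + z)) =
      s *: delta_mx 0 (rshift n j) + row_mx x (rsubmx z) :> EE.
    rewrite rsubmx_shift rsubmx_delta -[delta_mx 0 (rshift n j)]hsubmxK lsubmx_delta0 rsubmx_delta.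
    by rewrite scale_row_mx add_row_mx scaler0 add0r.
  have d2 := is_directional_pullback Lx (schwartz_is_partial (rshift n j) sf).
  have Ll z (s : R) : lsubmx (s *: delta_mx 0 (rshift n j) + z) = s *: 0 + lsubmx z :> E.
    by rewrite lsubmx_shift lsubmx_delta0.
  have d1 := is_directional_pullback Ll (is_directional0 (fun y => expi (- dot x y))).
  apply: is_directional_ext (is_directionalM d1 d2) => z //=.
  by rewrite mul0r add0r.
have [M HM] := schwartz_slice_decay (schwartz_partial (rshift n j) sf).
by exists M => s x _; rewrite normcM normc_expi mul1r; exact: HM.
Qed.

(** Integration by parts: the integral of the derivative of the whole integrand
    vanishes by [integralC_partial]. *)
Lemma partial_fourier_mleft j f (z : EE) : is_schwartz f ->
  (z 0 (lshift n j))%:C * partial_fourier f z =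
  partial_fourier (fun w => ci * partial (lshift n j) f w) z.
Proof.
move=> sf.
have sdf := schwartz_partial (lshift n j) sf.
have Lx x (s : R) : row_mx (s *: delta_mx 0 j + x) (rsubmx z) =
    s *: delta_mx 0 (lshift n j) + row_mx x (rsubmx z) :> EE.
  rewrite -[delta_mx 0 (lshift n j)]hsubmxK lsubmx_delta rsubmx_delta0.
  by rewrite scale_row_mx add_row_mx scaler0 add0r.
have d1 := is_directional_pullback Lx (schwartz_is_partial (lshift n j) sf).
have d0 := is_directionalM (is_directional_phase (delta_mx 0 j) (lsubmx z)) d1.
pose xi : R := lsubmx z 0 j.
have dE x : (0 +i* - dot (delta_mx 0 j) (lsubmx z)) * expi (- dot x (lsubmx z)) *
     f (row_mx x (rsubmx z)) + expi (- dot x (lsubmx z)) *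
     partial (lshift n j) f (row_mx x (rsubmx z)) =
    (ci * xi%:C) * phi f z x + phi (partial (lshift n j) f) z x.
  by rewrite dotC dot_delta ciE mulrA.
have {}d0 : is_partial j (phi f z)
    (fun x => (ci * xi%:C) * phi f z x + phi (partial (lshift n j) f) z x).
  by apply: is_directional_ext d0.
have df := decaying_phi z sf; have ddf := decaying_phi z sdf.
have dcf := decayingZ (ci * xi%:C) df.
have dsum := decayingD dcf ddf.
have := integralC_partial df dsum d0.
rewrite (integralCD dcf ddf) (integralCZ _ df) => /eqP; rewrite addr_eq0 => /eqP H.
have -> : partial_fourier (fun w => ci * partial (lshift n j) f w) z =
    ci * integralC (phi (partial (lshift n j) f) z).
  rewrite -(integralCZ _ ddf); apply: eq_integralC => x.
  by rewrite /phi mulrCA.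
have -> : partial_fourier f z = integralC (phi f z) by [].
have zE : (z 0 (lshift n j)) = xi by rewrite /xi mxE.
have ci2 : ci * ci = -1.
  by apply/eqP; rewrite eq_complex /= !mul0r !mulr0 mulrNN mulr1 sub0r addr0 oppr0 !eqxx.
rewrite zE -[integralC (phi (partial _ _) _)]opprK -H mulrN !mulrA ci2.
by rewrite !mulN1r mulNr opprK.
Qed.

Lemma partial_fourier_mright j f (z : EE) : is_schwartz f ->
  (z 0 (rshift n j))%:C * partial_fourier f z =
  partial_fourier (fun w => 1 * (w 0 (rshift n j))%:C * f w) z.
Proof.
move=> sf; rewrite -(integralCZ _ (decaying_phi z sf)); apply: eq_integralC => x.
by rewrite /phi row_mxEr mul1r mulrCA mxE.
Qed.

Lemma schwartz_family_is_schwartz (I : Type) (e : I -> R) N (F : I -> 'rV[R]_N -> R[i]) k :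
  schwartz_family e F -> is_schwartz (F k).
Proof.
move=> [sF bF]; split; first exact: sF.
by move=> s t; have [M FM] := bF s t; exists (M * e k) => x; rewrite normcE lecR.
Qed.

Lemma schwartz_family_partial_fourier (I : Type) (e : I -> R) (F : I -> EE -> R[i]) :
  schwartz_family e F -> schwartz_family e (fun k => partial_fourier (F k)).
Proof.
move=> sF.
apply: (@schwartz_family_coind_coord _ _ _ _ [set H | exists F,
  schwartz_family e F /\ H = fun k => partial_fourier (F k)]); last by exists F.
move=> _ [{sF}F [sF ->]].
have sFk k := schwartz_family_is_schwartz k sF.
split=> [|i|i].
- have [M HM] := schwartz_family_slice_decay sF.
  exists (M * (2 * \int[lebesgue_tuple R n]_t decay (row_of_tuple t))) => k z.
  rewrite mulrAC; apply: le_normc_integralC => [|x].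
    exact: (decaying_phi z (sFk k)).1.
  by rewrite -/(phi (F k) z x) normc_phi.
- case: (split_ordP i) => j ->.
    exists (fun k w => ci * partial (lshift n j) (F k) w); split.
      exact/schwartz_familyZ/schwartz_family_partial.
    by apply/funext => k; apply/funext => z; exact: partial_fourier_mleft.
  exists (fun k (w : EE) => 1 * (w 0 (rshift n j))%:C * F k w); split.
    exact: schwartz_family_coordM.
  by apply/funext => k; apply/funext => z; exact: partial_fourier_mright.
- case: (split_ordP i) => j ->.
    exists (fun k => partial_fourier (fun w : EE => ci * (w 0 (lshift n j))%:C * F k w)).
    split=> [|k]; last exact: partial_fourier_dleft.
    by exists (fun k (w : EE) => ci * (w 0 (lshift n j))%:C * F k w); split=> //;
      exact: schwartz_family_coordM.
  exists (fun k => partial_fourier (partial (rshift n j) (F k))).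
  split=> [|k]; last exact: partial_fourier_dright.
  by exists (fun k => partial (rshift n j) (F k)); split=> //; exact: schwartz_family_partial.
Qed.

Lemma schwartz_partial_fourier f : is_schwartz f -> is_schwartz (partial_fourier f).
Proof.
move=> /is_schwartzE sf; apply/is_schwartzE.
exact: schwartz_family_partial_fourier sf.
Qed.

Lemma partial_fourier_lin c f g z : is_schwartz f -> is_schwartz g ->
  partial_fourier (fun w => c * f w + g w) z = c * partial_fourier f z + partial_fourier g z.
Proof.
move=> sf sg; rewrite -(integralCZ c (decaying_phi z sf)).
rewrite -(integralCD _ (decaying_phi z sg)).
  by apply: eq_integralC => x; rewrite /phi mulrDr mulrCA.
exact: decayingZ (decaying_phi z sf).
Qed.

End partial_fourier_transform.

(** * The Fourier transform of Schwartz functions *)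

Section fubini_row.
Variables (R : realType) (n : nat).
Local Notation T := (measurableTypeR R).
Local Notation mu := (lebesgue_tuple R).
Local Notation E := 'rV[R]_n.
Local Notation EE := 'rV[R]_(n + n).

Lemma decay_row_mx (x y : E) : decay (row_mx x y) = decay x * decay y.
Proof.
rewrite /decay big_split_ord /=; congr (_ * _); apply: eq_bigr => i _.
  by rewrite row_mxEl.
by rewrite row_mxEr.
Qed.

Section double_integral.
Variable h : EE -> R[i].
Hypothesis dh : decaying h.

Let M := projT1 (cid dh.2).
Let hM : forall z, normc (h z) <= M * decay z := projT2 (cid dh.2).

Let hp (p : n.-tuple T * n.-tuple T) : R[i] := h (row_mx (row_of_tuple p.1) (row_of_tuple p.2)).

Let mhp : cmeasurable hp.
Proof.
have := cmeasurable_comp (cmeasurable_row dh.1) (@measurable_cat_pair R n n).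
by congr cmeasurable; apply/funext => p; rewrite /= row_of_cat_pair.
Qed.

Let hpM s t : normc (hp (s, t)) <= (M * decay (row_of_tuple s)) * decay (row_of_tuple t).
Proof. by rewrite -mulrA -decay_row_mx; exact: hM. Qed.

Let iM := integrable_Mdecay n M.
Let i1 := integrable_decay R n.

(** Here the integral over [R ^ (n + n)] meets the product of the measures on the
    two factors, through [transfers_cat]. *)
Lemma integralC_row_mx :
  integralC h = integralC (fun x => integralC (fun y => h (row_mx x y))).
Proof.
have [_ H] := transfer_cint (transfers_cat R n n) (decaying_integrable dh).
rewrite integralCE H mul1r.
have -> : ((h \o @row_of_tuple R (n + n)) \o @cat_pair R n n) = hp.
  by apply/funext => p; rewrite /= row_of_cat_pair.
by rewrite -(cint_prod1 iM i1 mhp hpM).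
Qed.

Lemma integralC_exchange :
  integralC (fun x => integralC (fun y => h (row_mx x y))) =
  integralC (fun y => integralC (fun x => h (row_mx x y))).
Proof.
transitivity (cint (mu n \x mu n)%E hp).
  exact: (cint_prod1 iM i1 mhp hpM).
exact/esym/(cint_prod2 iM i1 mhp hpM).
Qed.

Lemma integralC_row_mxZ c :
  integralC (fun x => c * integralC (fun y => h (row_mx x y))) =
  c * integralC (fun x => integralC (fun y => h (row_mx x y))).
Proof. exact: (cintZ c (cintegrable_partial_integral iM i1 mhp hpM)). Qed.

End double_integral.

Lemma continuous_submx N M (p : 'rV[R]_N -> 'rV[R]_M) :
  (forall x y, p (x - y) = p x - p y) -> (forall x, `|p x| <= `|x|) -> continuous p.
Proof.
move=> pB pn x; apply/(@cvgrPdist_lt _ _ _ _ (nbhs_filter (x : 'rV[R]_N))) => e e0.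
apply: filterS (nbhsx_ballx (x : 'rV[R]_N) _ e0) => y.
rewrite -ball_normE /ball_/= -pB; exact: le_lt_trans.
Qed.

Lemma continuous_lsubmx : continuous (fun z : EE => lsubmx z : E).
Proof.
apply: continuous_submx => [x y|x]; first by rewrite raddfB.
rewrite [leLHS]mx_normrE; apply/bigmax_leP; split=> // -[i j] _ /=.
by rewrite mxE ord1 coord_le_norm.
Qed.

Lemma continuous_rsubmx : continuous (fun z : EE => rsubmx z : E).
Proof.
apply: continuous_submx => [x y|x]; first by rewrite raddfB.
rewrite [leLHS]mx_normrE; apply/bigmax_leP; split=> // -[i j] _ /=.
by rewrite mxE ord1 coord_le_norm.
Qed.

Lemma continuous_compC (X Y : topologicalType) (p : X -> Y) (f : Y -> R[i]) :
  continuous p -> continuous f -> continuous (fun x => f (p x)).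
Proof. by move=> cp cf x; apply: (@continuous_comp _ _ _ p f); [exact: cp|exact: cf]. Qed.

Lemma continuous_pairing : continuous (fun z : EE => expi (dot (lsubmx z) (rsubmx z))).
Proof.
have cd (r : seq 'I_n) : continuous (fun z : EE => \sum_(i <- r) lsubmx z 0 i * rsubmx z 0 i : R).
  elim: r => [|i r IH].
    rewrite (_ : (fun z => _) = fun _ => 0); first exact: cst_continuous.
    by apply/funext => z; rewrite big_nil.
  rewrite (_ : (fun z => _) = fun z : EE =>
      z 0 (lshift n i) * z 0 (rshift n i) + \sum_(i <- r) lsubmx z 0 i * rsubmx z 0 i).
    have c1 : continuous (fun z : EE => z 0 (lshift n i)) by exact: coord_continuous.
    have c2 : continuous (fun z : EE => z 0 (rshift n i)) by exact: coord_continuous.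
    by move=> z; exact: (cvgD (cvgM (c1 z) (c2 z)) (IH z)).
  by apply/funext => z; rewrite big_cons !mxE.
have {}cd : continuous (fun z : EE => dot (lsubmx z) (rsubmx z)) by exact: cd.
apply/continuous_ReIm; split=> z.
  apply: (@continuous_comp _ _ _ (fun z : EE => dot (lsubmx z) (rsubmx z)) cos).
    exact: cd.
  exact: continuous_cos.
apply: (@continuous_comp _ _ _ (fun z : EE => dot (lsubmx z) (rsubmx z)) sin).
  exact: cd.
exact: continuous_sin.
Qed.

(** Makes Fubini's theorem available for kernels with a bounded phase [e]. *)
Lemma decaying_kernel (e : EE -> R[i]) (f g : E -> R[i]) :
  continuous e -> (forall z, normc (e z) <= 1) -> decaying f -> decaying g ->
  decaying (fun z => f (lsubmx z) * (e z * g (rsubmx z))).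
Proof.
move=> ce e1 [cf [M fM]] [cg [M' gM]]; split.
  apply: (continuous_mulC (continuous_compC continuous_lsubmx cf)).
  exact: (continuous_mulC ce (continuous_compC continuous_rsubmx cg)).
exists (M * M') => z; rewrite !normcM.
rewrite -[z in decay z]hsubmxK decay_row_mx mulrACA.
rewrite ler_pM ?mulr_ge0 ?normc_ge0//.
by apply: le_trans (gM _); rewrite ler_piMl ?normc_ge0.
Qed.

Lemma continuous_row_mxr (x : E) : continuous (fun y : E => row_mx x y).
Proof.
move=> y; apply/(@cvgrPdist_lt _ _ _ _ (nbhs_filter (y : E))) => e e0.
apply: filterS (nbhsx_ballx (y : E) _ e0) => z; rewrite -ball_normE /ball_/= => yz.
rewrite opp_row_mx add_row_mx subrr; apply: le_lt_trans yz.
by apply: norm_row_mx; rewrite ?normr0.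
Qed.

(** Fubini's theorem for the kernel [f x * e (x, y) * g y]. *)
Lemma integralC_transpose (e : EE -> R[i]) (f g : E -> R[i]) :
  continuous e -> (forall z, normc (e z) <= 1) -> decaying f -> decaying g ->
  integralC (fun x => f x * integralC (fun y => e (row_mx x y) * g y)) =
  integralC (fun y => integralC (fun x => e (row_mx x y) * f x) * g y).
Proof.
move=> ce e1 df dg; have dh := decaying_kernel ce e1 df dg.
have hE x y : f (lsubmx (row_mx x y)) * (e (row_mx x y) * g (rsubmx (row_mx x y))) =
    f x * (e (row_mx x y) * g y).
  by rewrite row_mxKl row_mxKr.
have d1 (p : E -> EE) k : continuous p -> decaying k -> decaying (fun y => e (p y) * k y).
  move=> cp [ck [M kM]]; split.
    exact: (continuous_mulC (continuous_compC cp ce) ck).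
  by exists M => y; apply: le_trans (kM _); rewrite normcM ler_piMl ?normc_ge0.
have := integralC_exchange dh.
rewrite (_ : (fun x => integralC (fun y => _)) =
    (fun x => f x * integralC (fun y => e (row_mx x y) * g y))); last first.
  apply/funext => x; rewrite -(integralCZ _ (d1 _ _ (@continuous_row_mxr x) dg)).
  by apply: eq_integralC => y; rewrite hE.
move=> ->; apply: eq_integralC => y.
rewrite mulrC -(integralCZ _ (d1 _ _ (@continuous_row_mx R n y) df)).
by apply: eq_integralC => x; rewrite hE; ring.
Qed.

(** The inverse Fourier transform is its own transpose: its kernel is symmetric. *)
Lemma inv_fourier_multiplication (f g : E -> R[i]) : decaying f -> decaying g ->
  integralC (fun x => f x * inv_fourier g x) = integralC (fun x => inv_fourier f x * g x).
Proof.
move=> df dg; pose c : R[i] := ((2 * pi) ^- n)%:C.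
have e1 (z : EE) : normc (expi (dot (lsubmx z) (rsubmx z))) <= 1 by rewrite normc_expi.
have H := integralC_transpose continuous_pairing e1 df (decayingZ c dg).
transitivity (integralC (fun x => f x * integralC (fun y =>
    expi (dot (lsubmx (row_mx x y)) (rsubmx (row_mx x y))) * (c * g y)))).
  apply: eq_integralC => x; congr (_ * _); rewrite /inv_fourier -/c -(integralCZ c (decaying_phase x dg)).
  by apply: eq_integralC => y; rewrite row_mxKl row_mxKr mulrCA.
rewrite H; apply: eq_integralC => y; rewrite mulrA [_ * c]mulrC; congr (_ * _ * _).
by apply: eq_integralC => x; rewrite row_mxKl row_mxKr dotC.
Qed.

End fubini_row.

Section fourier_schwartz.
Variables (R : realType) (n : nat).
Local Notation E := 'rV[R]_n.

Lemma schwartz_unit_exists : exists g : E -> R[i], is_schwartz g /\ g 0 = 1.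
Proof.
have [b [sb _ b1 b2]] := @plateau_exists R n 0 1 ltr01.
exists (fun x => (b x)%:C); split; last by rewrite b1// subrr normr0.
by apply: (@bump_schwartz _ _ _ 0 (2 * 1)) => // x bx; apply: b2;
  apply: contra_neq bx => ->.
Qed.

(** The Fourier transform is the restriction to a slice of a partial Fourier
    transform in twice as many variables: take the tensor product with a
    function equal to 1 at the origin, and freeze the second variable there. *)
Lemma schwartz_family_fourier (I : Type) (e : I -> R) (F : I -> E -> R[i]) :
  schwartz_family e F -> schwartz_family e (fun k => fourier (F k)).
Proof.
move=> sF; have [g [sg g0]] := schwartz_unit_exists.
have sT := schwartz_family_partial_fourier (schwartz_family_tensor sF (schwartz_family_cst I sg)).
have BK : @row_mx R n n n 1%:M 0 *m @col_mx R n n n 1%:M 0 = 1%:M.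
  by rewrite mul_row_col mulmx1 mulmx0 addr0.
have := schwartz_family_affine 0 BK sT.
have -> : (fun k => e k * 1) = e by apply/funext => k; rewrite mulr1.
congr schwartz_family; apply/funext => k; apply/funext => x.
rewrite add0r mul_mx_row mulmx1 mulmx0 /partial_fourier row_mxKl row_mxKr.
apply: eq_integralC => y; by rewrite /tensor row_mxKl row_mxKr g0 mulr1.
Qed.

Lemma schwartz_fourier (f : E -> R[i]) : is_schwartz f -> is_schwartz (fourier f).
Proof.
by move=> /is_schwartzE sf; apply/is_schwartzE; exact: schwartz_family_fourier sf.
Qed.

Lemma schwartz_affine (c : E) (a : R) (f : E -> R[i]) : a != 0 ->
  is_schwartz f -> is_schwartz (fun x => f (c + a *: x)).
Proof.
move=> a0 /is_schwartzE sf; apply/is_schwartzE.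
have BK : a%:M *m (a^-1)%:M = 1%:M :> 'M[R]_n by rewrite -scalar_mxM mulfV.
have := schwartz_family_affine c BK sf; congr schwartz_family.
by apply/funext => _; apply/funext => x; rewrite mul_mx_scalar.
Qed.

Lemma schwartzZ c (f : E -> R[i]) : is_schwartz f -> is_schwartz (fun x => c * f x).
Proof. by move=> /is_schwartzE sf; apply/is_schwartzE; exact: schwartz_familyZ sf. Qed.

Lemma inv_fourierE (f : E -> R[i]) x :
  inv_fourier f x = ((2 * pi) ^- n)%:C * fourier f (- x).
Proof.
rewrite /inv_fourier; congr (_ * _); apply: eq_integralC => y.
by rewrite dotNr opprK dotC.
Qed.

Lemma schwartz_inv_fourier (f : E -> R[i]) : is_schwartz f -> is_schwartz (inv_fourier f).
Proof.
move=> /schwartz_fourier sf.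
have N1 : -1 != 0 :> R by rewrite oppr_eq0 oner_eq0.
rewrite (_ : inv_fourier f = fun x => ((2 * pi) ^- n)%:C * fourier f (0 + -1 *: x)).
  by apply: schwartzZ; exact: schwartz_affine sf.
by apply/funext => x; rewrite inv_fourierE add0r scaleN1r.
Qed.

End fourier_schwartz.

(** * Fourier inversion *)

Section fourier_inversion.
Variables (R : realType) (n : nat).
Local Notation T := (measurableTypeR R).
Local Notation mu := (lebesgue_tuple R).
Local Notation E := 'rV[R]_n.
Local Notation Re := (@complex.Re R).
Local Notation Im := (@complex.Im R).

Lemma abel1_le_decay1 (x : R) : abel1 x <= 2 * decay1 x.
Proof.
have p : 0 < oneDsqr x by rewrite (lt_le_trans _ (oneDsqr_ge1 _)).
rewrite /decay1 ler_pdivlMr// /abel1 expRN mulrC ler_pdivrMr ?expR_gt0//.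
have := expR_ge1Dxn 1 (normr_ge0 x).
rewrite real_normK ?num_real// => H; rewrite /oneDsqr.
have f2 : (2`!%:R : R) = 2 by [].
rewrite f2 in H; lra.
Qed.

Lemma decaying_abel : decaying (fun x : E => (abel x)%:C).
Proof.
split.
  apply/continuous_ReIm; split; first exact: (continuous_coord_prod (@continuous_abel1 R)).
  by apply: (@cst_continuous _ _ (0 : R)).
exists (2 ^+ n) => x; rewrite normc_real ger0_norm ?abel_ge0//.
rewrite -[X in _ ^+ X](card_ord n) -prodr_const -big_split.
by apply: ler_prod => i _ /=; rewrite abel1_ge0 abel1_le_decay1.
Qed.

Section at_origin.
Variable g : E -> R[i].
Hypothesis sg : is_schwartz g.

Let G (xi : E) : R[i] := integralC (fun t => expi (dot xi t) * g t).

Let GE xi : G xi = fourier g (- xi).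
Proof. by apply: eq_integralC => t; rewrite dotNr opprK dotC. Qed.

Let sG : is_schwartz G.
Proof.
have N1 : -1 != 0 :> R by rewrite oppr_eq0 oner_eq0.
rewrite (_ : G = fun x => fourier g (0 + -1 *: x)).
  exact: schwartz_affine N1 (schwartz_fourier sg).
by apply/funext => x; rewrite GE add0r scaleN1r.
Qed.

Let sga a : a != 0 -> is_schwartz (fun s => g (a *: s)).
Proof.
move=> a0; have := schwartz_affine 0 a0 sg.
by congr is_schwartz; apply/funext => x; rewrite add0r.
Qed.

Let decaying_abelG a : decaying (fun xi => (abel (a *: xi))%:C * G xi).
Proof.
have a1 (x : E) : normc (abel (a *: x))%:C <= 1 by rewrite normc_real ger0_norm ?abel_ge0 ?abel_le1.
apply: (decayingM _ a1 (is_schwartz_decaying sG)).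
exact: (continuous_compC (@scaler_continuous R E a) decaying_abel.1).
Qed.

(** Rescaling both variables moves the parameter from Abel's kernel to [g]. *)
Let abel_poisson a : 0 < a ->
  integralC (fun xi => (abel (a *: xi))%:C * G xi) =
  integralC (fun s => g (a *: s) * (2 ^+ n * decay s)%:C).
Proof.
move=> a0; have an0 : a != 0 by rewrite gt_eqF.
have ai0 : 0 < a^-1 by rewrite invr_gt0.
have dga := is_schwartz_decaying (sga an0).
have e1 (z : 'rV[R]_(n + n)) : normc (expi (dot (lsubmx z) (rsubmx z))) <= 1.
  by rewrite normc_expi.
have a1 (x : E) : normc (abel x)%:C <= 1 by rewrite normc_real ger0_norm ?abel_ge0 ?abel_le1.
have GaE xi : (a^-1 ^+ n)%:C * G (a^-1 *: xi) = integralC (fun s => expi (dot xi s) * g (a *: s)).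
  rewrite /G (integralC_affine 0 a0 (decaying_phase (a^-1 *: xi) (is_schwartz_decaying sg))).
  rewrite mulrA -rmorphM -exprMn mulVf// expr1n mul1r; apply: eq_integralC => s.
  by rewrite add0r dotZl dotZr mulrA mulVf// mul1r.
have dG : decaying (fun xi => (abel xi)%:C * G (0 + a^-1 *: xi)).
  have sGa := schwartz_affine 0 (lt0r_neq0 ai0) sG.
  exact: (decayingM decaying_abel.1 a1 (is_schwartz_decaying sGa)).
rewrite (integralC_affine 0 ai0 (decaying_abelG a)).
rewrite (_ : (fun xi => _) = fun xi => (abel xi)%:C * G (0 + a^-1 *: xi)); last first.
  by apply/funext => xi; rewrite add0r scalerA mulfV// scale1r.
rewrite -(integralCZ _ dG).
transitivity (integralC (fun x => (abel x)%:C * integralC (fun y =>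
    expi (dot (lsubmx (row_mx x y)) (rsubmx (row_mx x y))) * g (a *: y)))).
  apply: eq_integralC => x; rewrite mulrCA add0r GaE; congr (_ * _).
  by apply: eq_integralC => y; rewrite row_mxKl row_mxKr.
rewrite (integralC_transpose (@continuous_pairing R n) e1 decaying_abel dga).
apply: eq_integralC => s; rewrite mulrC -abel_fourier; congr (_ * _).
by apply: eq_integralC => x; rewrite row_mxKl row_mxKr dotC mulrC.
Qed.

Let a_ (k : nat) : R := k.+1%:R^-1.

Let a_gt0 k : 0 < a_ k. Proof. by rewrite invr_gt0. Qed.

Let dilation_cvg (f : E -> R) (x : E) : continuous f ->
  f (a_ k *: x) @[k --> \oo] --> f 0.
Proof.
move=> cf; apply: (@continuous_cvg _ _ _ _ _ (fun k => a_ k *: x) f); first exact: cf.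
rewrite -[X in _ --> X](scale0r x); apply: cvgZr_tmp.
exact: cvg_harmonic.
Qed.

(** Inversion at the origin. Insert Abel's kernel with parameter [a] in the
    integral of the transform [G]. As [a] tends to 0 the integral tends to that
    of [G]; by [abel_poisson] it also tends to [g 0] times the integral of the
    Poisson kernel. *)
Lemma integralC_inv_transform : integralC G = ((2 * pi) ^+ n)%:C * g 0.
Proof.
pose J k := integralC (fun xi => (abel (a_ k *: xi))%:C * G xi).
have sGd := is_schwartz_decaying sG.
have [cgr cgi] : continuous (Re \o g) /\ continuous (Im \o g).
  by apply/continuous_ReIm; exact: schwartz_continuous.
have ca0 : abel (0 : E) = 1.
  by rewrite /abel big1// => i _; rewrite /abel1 mxE normr0 oppr0 expR0.
(* The dilated kernel is at most 1 and tends to 1, so [G] itself dominates. *)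
have [L1r L1i] : Re (J k) @[k --> \oo] --> Re (integralC G) /\
    Im (J k) @[k --> \oo] --> Im (integralC G).
  have [_ [M GM]] := sGd.
  apply: (@cint_dominated _ _ _ (mu n) (fun k t => (abel (a_ k *: row_of_tuple t))%:C * G (row_of_tuple t))
     (fun t => G (row_of_tuple t)) (fun t => M * decay (row_of_tuple t))).
  - by move=> k; exact: (cmeasurable_row (decaying_abelG (a_ k)).1).
  - exact: (cmeasurable_row sGd.1).
  - exact: integrable_Mdecay.
  - move=> k t; rewrite normcM normc_real ger0_norm ?abel_ge0//.
    by apply: le_trans (GM _); rewrite ler_piMl ?normc_ge0// abel_le1.
  - move=> t; rewrite (_ : (fun k => _) = fun k => abel (a_ k *: row_of_tuple t) * Re (G (row_of_tuple t))).
      rewrite -[X in _ --> X]mul1r -ca0; apply: cvgM; last exact: cvg_cst.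
      exact: (dilation_cvg _ (continuous_coord_prod (@continuous_abel1 R))).
    by apply/funext => k; rewrite Re_mul /= mul0r subr0.
  - move=> t; rewrite (_ : (fun k => _) = fun k => abel (a_ k *: row_of_tuple t) * Im (G (row_of_tuple t))).
      rewrite -[X in _ --> X]mul1r -ca0; apply: cvgM; last exact: cvg_cst.
      exact: (dilation_cvg _ (continuous_coord_prod (@continuous_abel1 R))).
    by apply/funext => k; rewrite Im_mul /= mul0r addr0.
have JE k : J k = integralC (fun s => g (a_ k *: s) * (2 ^+ n * decay s)%:C).
  exact: abel_poisson.
have cdec : continuous (fun x : E => (2 ^+ n * decay x)%:C : R[i]).
  apply/continuous_ReIm; split; last by apply: (@cst_continuous _ _ (0 : R)).
  have c2 : continuous (fun _ : E => 2 ^+ n : R) by exact: cst_continuous.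
  have c3 : continuous (@decay R n) := continuous_coord_prod (@continuous_decay1 R).
  by move=> x; exact: (cvgM (c2 x) (c3 x)).
have d2 (x : E) : normc (2 ^+ n * decay x)%:C = 2 ^+ n * decay x.
  by rewrite normc_real ger0_norm// mulr_ge0 ?decay_ge0// exprn_ge0.
have ddec : decaying (fun x : E => (2 ^+ n * decay x)%:C).
  by split=> //; exists (2 ^+ n) => x; rewrite d2.
have dgdec : integralC (fun s : E => g 0 * (2 ^+ n * decay s)%:C) = ((2 * pi) ^+ n)%:C * g 0.
  by rewrite (integralCZ (g 0) ddec) integral_decay mulrC.
have [M gM] := schwartz_bounded sg.
(* On the other side it is [g] that is dilated, and [g] is bounded. *)
have [L2r L2i] : Re (J k) @[k --> \oo] --> Re (((2 * pi) ^+ n)%:C * g 0) /\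
    Im (J k) @[k --> \oo] --> Im (((2 * pi) ^+ n)%:C * g 0).
  have -> : J = fun k => integralC (fun s => g (a_ k *: s) * (2 ^+ n * decay s)%:C).
    by apply/funext.
  rewrite -dgdec.
  apply: (@cint_dominated _ _ _ (mu n) (fun k t => g (a_ k *: row_of_tuple t) * (2 ^+ n * decay (row_of_tuple t))%:C)
     (fun t => g 0 * (2 ^+ n * decay (row_of_tuple t))%:C) (fun t => (M * 2 ^+ n) * decay (row_of_tuple t))).
  - move=> k; apply: (cmeasurableM _ (cmeasurable_row cdec)).
    apply: (cmeasurable_row (f := fun s => g (a_ k *: s))).
    exact: schwartz_continuous (sga (lt0r_neq0 (a_gt0 k))).
  - exact: (cmeasurableM (cmeasurable_cst _ (g 0)) (cmeasurable_row cdec)).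
  - exact: integrable_Mdecay.
  - move=> k t; rewrite normcM d2 -mulrA ler_wpM2r// mulr_ge0 ?decay_ge0// exprn_ge0.
  - move=> t; rewrite (_ : (fun k => _) = fun k => Re (g (a_ k *: row_of_tuple t)) * (2 ^+ n * decay (row_of_tuple t))).
      rewrite Re_mul /= mulr0 subr0; apply: cvgM; last exact: cvg_cst.
      exact: (dilation_cvg _ cgr).
    by apply/funext => k; rewrite Re_mul /= mulr0 subr0.
  - move=> t; rewrite (_ : (fun k => _) = fun k => Im (g (a_ k *: row_of_tuple t)) * (2 ^+ n * decay (row_of_tuple t))).
      rewrite Im_mul /= mulr0 add0r; apply: cvgM; last exact: cvg_cst.
      exact: (dilation_cvg _ cgi).
    by apply/funext => k; rewrite Im_mul /= mulr0 add0r.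
have Er := etrans (esym (cvg_lim (@Rhausdorff R) L1r)) (cvg_lim (@Rhausdorff R) L2r).
have Ei := etrans (esym (cvg_lim (@Rhausdorff R) L1i)) (cvg_lim (@Rhausdorff R) L2i).
by move: Er Ei; case: (integralC G) => a b; case: (_ * g 0) => c d /= -> ->.
Qed.

End at_origin.

(** Translations reduce the formula to the origin. *)
Theorem fourier_inv_fourier (f : E -> R[i]) : is_schwartz f -> fourier (inv_fourier f) = f.
Proof.
move=> sf; apply/funext => x.
have sfx : is_schwartz (fun t => f (x + t)).
  have := schwartz_affine x (oner_neq0 R) sf.
  by congr is_schwartz; apply/funext => t; rewrite scale1r.
have H := integralC_inv_transform sfx; rewrite addr0 in H.
have dphase (xi y : E) : decaying (fun t => expi (dot xi (t - y)) * f t).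
  have := decayingZ (expi (dot xi (- y))) (decaying_phase xi (is_schwartz_decaying sf)).
  by congr decaying; apply/funext => t; rewrite dotDr expiD; ring.
have E1 xi : expi (- dot xi x) * inv_fourier f xi =
    ((2 * pi) ^- n)%:C * integralC (fun t => expi (dot xi t) * f (x + t)).
  rewrite /inv_fourier mulrCA; congr (_ * _).
  have -> : integralC (fun t => expi (dot xi t) * f (x + t)) =
      integralC (fun t => expi (dot xi (t - x)) * f t).
    rewrite -(integralC_translation x (dphase xi x)); apply: eq_integralC => t.
    by rewrite addrAC subrr add0r.
  have d0 := dphase xi 0.
  have -> : (fun t => expi (dot xi t) * f t) = (fun t => expi (dot xi (t - 0)) * f t).
    by apply/funext => t; rewrite subr0.
  rewrite -(integralCZ _ d0); apply: eq_integralC => t.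
  by rewrite subr0 dotDr dotNr expiD; ring.
rewrite /fourier; under eq_integralC do rewrite E1.
have dG : decaying (fun xi => integralC (fun t => expi (dot xi t) * f (x + t))).
  have N1 : -1 != 0 :> R by rewrite oppr_eq0 oner_eq0.
  have := is_schwartz_decaying (schwartz_affine 0 N1 (schwartz_fourier sfx)).
  congr decaying; apply/funext => xi; rewrite add0r scaleN1r.
  by apply: eq_integralC => t; rewrite dotNr opprK dotC.
rewrite (integralCZ _ dG) H mulrA -rmorphM mulVf ?mul1r//.
by rewrite expf_neq0// mulf_neq0// gt_eqF// pi_gt0.
Qed.

End fourier_inversion.

(** * Tempered distributions *)

Section topological_criteria.

Lemma cvg_initial (S : choiceType) (T : topologicalType) (f : S -> T)
    (F : set_system S) (s : S) : Filter F ->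
  f @ F --> f s -> F --> (s : initial_topology f).
Proof.
move=> FF Ffs A; rewrite nbhsE => -[B [[V oV <-] Vs] sub].
apply: filterS sub _; apply: Ffs; exact: open_nbhs_nbhs.
Qed.

Lemma cvg_product (J : Type) (T : J -> topologicalType)
    (F : set_system (forall j, T j)) (f : forall j, T j) : Filter F ->
  (forall j, (fun g : forall j, T j => g j) @ F --> f j) ->
  F --> (f : prod_topology T).
Proof.
move=> FF Ff; apply/cvg_sup => j.
exact: (@cvg_initial _ _ (fun g : forall j, T j => g j) F f FF (Ff j)).
Qed.

End topological_criteria.

Section schwartz_space.
Variables (R : realType) (N : nat).
Local Notation E := 'rV[R]_N.
Implicit Types phi chi : Schwartz R N.

Lemma schwartzP phi : is_schwartz phi.
Proof. by have /asboolP := valP phi. Qed.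

Lemma to_schwartzE (f : E -> R[i]) : is_schwartz f -> (to_schwartz f : E -> R[i]) = f.
Proof. by move=> sf; apply: (insubdK (0 : Schwartz R N)); apply/asboolP. Qed.

Lemma schwartz_eq phi chi : (phi : E -> R[i]) =1 chi -> phi = chi.
Proof. by move=> H; apply: val_inj; apply/funext. Qed.

Lemma to_schwartzK phi : to_schwartz phi = phi.
Proof. by apply: schwartz_eq => x; rewrite to_schwartzE//; exact: schwartzP. Qed.

Lemma schwartz_linE c phi chi x : (c *: phi + chi) x = c * phi x + chi x.
Proof. by []. Qed.

(** The rates of Schwartz families are rates of convergence for the seminorms that
    define the topology of the Schwartz space. *)
Lemma cvg_to_schwartz0 (e : nat -> R) (F : nat -> E -> R[i]) :
  e k @[k --> \oo] --> 0 -> schwartz_family e F ->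
  to_schwartz (F k) @[k --> \oo] --> (0 : Schwartz R N).
Proof.
move=> e0 sF; have [_ bF] := sF.
apply: (@cvg_initial _ _ (@weighted_family R N)); apply: cvg_product => -[s t].
move=> P /uniform_nbhs[A [/= eA sub]].
rewrite -entourage_ballE in eA; have [r /= r0 rA] := eA.
have [M FM] := bF s t.
have W0 x : weighted s t (0 : Schwartz R N) x = 0.
  have := partials_lin t (-1) (@smooth0 R N) (@smooth0 R N).
  rewrite scaler0 addr0 scaleN1r addNr => p0.
  by rewrite /weighted (_ : partials t _ = 0)// mulr0.
have W k x : weighted s t (to_schwartz (F k)) x = weighted s t (F k) x.
  by rewrite /weighted to_schwartzE//; exact: (schwartz_family_is_schwartz k sF).
(* The radius of a ball of [R[i]] is a complex number, positive hence real. *)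
have [q rE] : exists q : R, r = q%:C.
  by exists (complex.Re r); apply/esym; rewrite RRe_real// gtr0_real.
have q0 : 0 < q by move: r0; rewrite rE ltcR.
have : \forall k \near \oo, M * e k < q.
  have : M * e k @[k --> \oo] --> M * 0 by apply: cvgM => //; exact: cvg_cst.
  by rewrite mulr0; move/cvgrPdist_lt => /(_ _ q0); apply: filterS => k; rewrite sub0r normrN; apply: le_lt_trans; exact: ler_norm.
apply: filterS => k Mk; apply: sub => x _ /=.
apply: rA.
suff : `|weighted s t (0 : Schwartz R N) x - weighted s t (to_schwartz (F k)) x| < r by [].
rewrite W0 W [0 - _]add0r normrN rE normcE ltcR; exact: le_lt_trans (FM k x) Mk.
Qed.

Lemma temperedP (u : Tempered R N) : is_tempered u.
Proof. by have /asboolP := valP u. Qed.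

Lemma tempered_lin (u : Tempered R N) c phi chi : u (c *: phi + chi) = c * u phi + u chi.
Proof. by have [lu _] := temperedP u; rewrite lu. Qed.

Lemma linear_at0 (V : lmodType R[i]) (u : V -> R[i]) : linear u -> u 0 = 0.
Proof. by move=> lu; have := lu (-1) 0 0; rewrite scaler0 addr0 scaleN1r addNr. Qed.

Lemma tempered0 (u : Tempered R N) : u 0 = 0.
Proof. by apply: linear_at0 => c phi chi; rewrite tempered_lin. Qed.

(** The form in which the continuity of a tempered distribution is used: a value
    that does not change along a null sequence is zero. *)
Lemma tempered_null_cst (u : Tempered R N) (e : nat -> R) (F : nat -> E -> R[i]) c :
  e k @[k --> \oo] --> 0 -> schwartz_family e F ->
  (forall k, u (to_schwartz (F k)) = c) -> c = 0.
Proof.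
move=> e0 sF uc; have [_ cu] := temperedP u; apply/eqP/contraT => c0.
have nc0 : 0 < `|c| by rewrite normr_gt0.
have B0 : nbhs (u 0) [set z : R[i] | `|z| < `|c|].
  apply: filterS (nbhsx_ballx (u 0 : R[i]) _ nc0) => z.
  by rewrite /ball /= tempered0 sub0r normrN.
have := cvg_to_schwartz0 e0 sF (cu 0 _ B0).
case=> k _ /(_ k (leqnn k)); rewrite /= uc.
by rewrite ltxx.
Qed.

End schwartz_space.

(** * Weak-* continuous functionals *)

Section weak_star_duality.
Variables (R : realType) (N : nat).
Local Notation S := (Schwartz R N).
Local Notation S' := (Tempered R N).

Lemma evaluation_continuous (chi : S) : continuous (fun u : S' => u chi).
Proof.
move=> u.
have c1 := @initial_continuous S' {ptws S -> R[i]} (@tempered_fun R N) u.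
have c2 := @proj_continuous S (fun _ => R[i]) chi (tempered_fun u).
exact: (cvg_comp _ _ c1 c2).
Qed.

(** Linear algebra: a functional vanishing on the common kernel of finitely many
    functionals is a linear combination of them. *)
Lemma functional_of_common_kernel (s : seq S) (L : S' -> R[i]) : linear L ->
  (forall u : S', (forall chi, chi \in s -> u chi = 0) -> L u = 0) ->
  exists g : S, forall u, L u = u g.
Proof.
elim: s L => [|chi s IH] L lL L0.
  by exists 0 => u; rewrite tempered0; apply: L0 => chi; rewrite in_nil.
have [[w [ws wchi]]|H] := pselect (exists w : S', (forall xi, xi \in s -> w xi = 0) /\ w chi != 0).
  (* On the kernel of the remaining functionals [L] is proportional to [chi]. *)
  pose c := L w / w chi.
  have [||g gE] := IH (fun u => L u - c * u chi).
  - move=> k u v; rewrite lL (_ : (k *: u + v) chi = k * u chi + v chi)//.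
    by rewrite /c /GRing.scale /=; ring.
  - move=> u us; have : L (- (u chi / w chi) *: w + u) = 0.
      apply: L0 => xi; rewrite in_cons => xis.
      suff : - (u chi / w chi) * w xi + u xi = 0 by [].
      case/orP: xis => [/eqP->|xis]; first by rewrite mulNr divfK// addNr.
      by rewrite (ws _ xis) (us _ xis) mulr0 addr0.
    rewrite lL /GRing.scale /= => H; rewrite -[RHS]H /c; ring.
  exists (c *: chi + g) => u; rewrite tempered_lin -gE; ring.
apply: IH => // u us; apply: L0 => xi; rewrite in_cons => /orP[/eqP->|]; last exact: us.
by apply/eqP/contraT => ?; case: H; exists u.
Qed.

(** The dual of [S'] for the weak-* topology is [S]. A neighbourhood of 0 contains
    the common kernel of finitely many evaluations; there [L] is smaller than 1,
    hence zero by homogeneity. *)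
Lemma weak_star_functional (L : S' -> R[i]) : linear L -> continuous L ->
  exists g : S, forall u, L u = u g.
Proof.
move=> lL cL.
pose kernel (s : seq S) := [set u : S' | forall chi, chi \in s -> u chi = 0].
(* This filter tends to 0: on its members any given evaluation is eventually 0. *)
pose F : set_system S' := filter_from setT kernel.
have FF : Filter F.
  apply: filter_from_filter; first by exists [::].
  move=> s t _ _; exists (s ++ t) => // u ust.
  by split=> chi chis; apply: ust; rewrite mem_cat chis ?orbT.
have F0 : F --> (0 : S').
  apply: (@cvg_initial S' {ptws S -> R[i]} (@tempered_fun R N) F 0 FF).
  apply: cvg_product => chi P P0; exists [:: chi] => // u /(_ chi).
  rewrite mem_head => /(_ isT) u0 /=; rewrite u0; exact: nbhs_singleton P0.
have L0 := linear_at0 lL.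
have B0 : nbhs (L 0) [set z : R[i] | `|z| < 1].
  apply: filterS (nbhsx_ballx (L 0 : R[i]) _ ltr01) => z.
  by rewrite /ball /= L0 sub0r normrN.
have [s _ sB] := F0 _ (cL 0 _ B0).
apply: (@functional_of_common_kernel s) => // u us.
apply/eqP/contraT => Lu0.
have : kernel s ((L u)^-1 *: u).
  move=> chi chis; rewrite (_ : (_ *: u) chi = (L u)^-1 * u chi)//.
  by rewrite us// mulr0.
move/sB; rewrite /=; have := lL (L u)^-1 u 0; rewrite !addr0 L0 addr0 => ->.
by rewrite /GRing.scale /= mulVf// normr1 ltxx.
Qed.

End weak_star_duality.

(** * Supports *)

Section localization.
Variables (R : realType) (N : nat).
Local Notation E := 'rV[R]_N.
Local Notation S := (Schwartz R N).
Implicit Types (u : S -> R[i]) (phi : S).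

Lemma closure_support_cball (f : E -> R[i]) (c : E) (r : R) :
  (forall x, f x != 0 -> `|x - c| <= r) ->
  closure [set x | f x != 0] `<=` [set x | `|x - c| <= r].
Proof.
move=> fr; rewrite (_ : [set x | `|x - c| <= r] = closure [set x : E | `|x - c| <= r]).
  by apply: closure_subset => x; exact: fr.
apply/closure_id.
exact: closed_cball_row.
Qed.

Lemma compact_closure_support (f : E -> R[i]) (c : E) (r : R) :
  (forall x, f x != 0 -> `|x - c| <= r) -> compact (closure [set x | f x != 0]).
Proof.
move=> /closure_support_cball H.
exact: (subclosed_compact (@closed_closure _ _) (@compact_cball _ _ c r) H).
Qed.

Lemma vanishes_on_subset u (U V : set E) : U `<=` V -> vanishes_on u V -> vanishes_on u U.
Proof. by move=> UV uV phi cphi sphi; apply: uV => //; exact: subset_trans UV. Qed.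

(** A partition of unity, produced one ball at a time: with a plateau function [b]
    of the first ball, [b * phi] is supported where [u] vanishes, and
    [phi - b * phi] is nonzero only in the remaining balls. *)
Lemma localization_finite u (s : seq (E * R)) phi : linear u ->
  (forall p, p \in s -> 0 < p.2 /\ vanishes_on u [set y | `|y - p.1| <= 2 * p.2]) ->
  (forall x, phi x != 0 -> exists2 p, p \in s & `|x - p.1| <= p.2) -> u phi = 0.
Proof.
move=> lu; elim: s phi => [|[c r] s IH] phi us sphi.
  rewrite (_ : phi = 0) ?linear_at0//; apply: schwartz_eq => x.
  by apply/eqP/contraT => /sphi[].
have [r0 ur] := us _ (mem_head _ _).
have [b [sb _ b1 br]] := plateau_exists c r0.
have br' x : (b x)%:C != 0 :> R[i] -> `|x - c| <= 2 * r.
  by move=> bx; apply: br; apply: contra bx => /eqP->.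
have sbphi := is_schwartzM (bump_bounded_partials sb br') (schwartzP phi).
have bphi x : to_schwartz (fun x => (b x)%:C * phi x) x = (b x)%:C * phi x.
  by rewrite to_schwartzE.
set psi := to_schwartz _ in bphi.
have u1 : u psi = 0.
  have H x : psi x != 0 -> `|x - c| <= 2 * r.
    by rewrite bphi mulf_eq0 negb_or => /andP[/br'].
  by apply: ur; [exact: compact_closure_support H | exact: closure_support_cball H].
have : u (-1 *: psi + phi) = 0.
  apply: IH => [p ps|x]; first by apply: us; rewrite in_cons ps orbT.
  rewrite schwartz_linE bphi => H.
  have phi0 : phi x != 0 by apply: contra H => /eqP->; rewrite !mulr0 addr0.
  have [p] := sphi x phi0; rewrite in_cons => /orP[/eqP->/b1 bx1|]; last by exists p.
  by move: H; rewrite bx1 mul1r mulN1r addNr eqxx.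
by rewrite lu u1 scaler0 add0r.
Qed.

(** Local vanishing on a compact set is global: finitely many balls on which [u]
    vanishes cover it. *)
Lemma localization u (K : set E) phi : linear u -> compact K ->
  [set x | phi x != 0] `<=` K ->
  (forall x, K x -> exists U, [/\ open U, U x & vanishes_on u U]) -> u phi = 0.
Proof.
move=> lu cK phiK KU.
pose D := [set p : E * R | 0 < p.2 /\ vanishes_on u [set y | `|y - p.1| <= 2 * p.2]].
move: cK; rewrite compact_cover => /(_ (E * R)%type D (fun p => ball p.1 p.2)).
case=> [p _|x Kx|s sD Ks].
- exact: ball_open.
- have [U [oU Ux uU]] := KU x Kx.
  have /nbhs_ballP[e /= e0 eU] := open_nbhs_nbhs (conj oU Ux).
  have e4 : 0 < e / 4 by rewrite divr_gt0.
  exists (x, e / 4); last exact: ballxx.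
  split=> //=; apply: vanishes_on_subset uU => y /= yx; apply: eU.
  by rewrite -ball_normE /= distrC; apply: le_lt_trans yx _; lra.
apply: (@localization_finite u (finmap.enum_fset s)) => // [p ps|x /phiK /Ks[p ps]].
  by have /sD := ps; rewrite inE.
rewrite -ball_normE /= distrC => /ltW H; by exists p.
Qed.

Lemma not_supp u x : ~ supp u x -> exists U, [/\ open U, U x & vanishes_on u U].
Proof. by move=> /contrapT[U [oU uU] Ux]; exists U. Qed.

Lemma vanishes_off_supp u phi : linear u -> compact (closure [set x | phi x != 0]) ->
  (forall x, closure [set x | phi x != 0] x -> ~ supp u x) -> u phi = 0.
Proof.
move=> lu cphi phiu; apply: (localization lu cphi); first exact: subset_closure.
by move=> x /phiu; exact: not_supp.
Qed.

Lemma closed_supp u : closed (supp u).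
Proof. by apply: open_closedC; apply: bigcup_open => U []. Qed.

End localization.

(** * Distributions given by functions *)

Section regular_distributions.
Variables (R : realType) (N : nat).
Local Notation E := 'rV[R]_N.

Lemma decaying_schwartzM (f g : E -> R[i]) : is_schwartz f -> is_schwartz g ->
  decaying (fun x => f x * g x).
Proof.
move=> sf sg; have [M fM] := schwartz_bounded sf.
exact: (decayingM (schwartz_continuous sf) fM (is_schwartz_decaying sg)).
Qed.

Lemma nbhs_uniform (chi : Schwartz R N) (d : R) : 0 < d ->
  nbhs chi [set psi : Schwartz R N | forall x, normc (chi x - psi x) < d].
Proof.
move=> d0; pose T := prod_topology (fun _ : seq 'I_N * seq 'I_N => {uniform E -> R[i]}).
have c1 := @initial_continuous (Schwartz R N) T (@weighted_family R N) chi.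
have c2 := @proj_continuous _ (fun _ : seq 'I_N * seq 'I_N => {uniform E -> R[i]})
  ([::], [::]) (weighted_family chi).
have c := cvg_comp _ _ c1 c2.
have w0 (psi : Schwartz R N) x : weighted [::] [::] psi x = psi x.
  by rewrite /weighted /monomial big_nil mul1r.
have dC : 0 < d%:C :> R[i] by rewrite ltcR.
pose A := [set xy : R[i] * R[i] | ball xy.1 d%:C xy.2].
have eA : entourage A by rewrite -entourage_ballE; exists d%:C.
have HA : nbhs (weighted_family chi ([::], [::]) : {uniform E -> R[i]})
    [set h | forall y, [set: E] y -> A (weighted_family chi ([::], [::]) y, h y)].
  by apply/uniform_nbhs; exists A; split.
have HB : nbhs chi [set psi : Schwartz R N | forall y : E, [set: E] y ->
    A (weighted_family chi ([::], [::]) y, weighted_family psi ([::], [::]) y)] := c _ HA.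
apply: (@filterS _ (nbhs chi) (nbhs_filter chi) _ _ _ HB) => psi H x.
have := H x Logic.I; rewrite /A /= /ball /= /weighted_family /= !w0.
by rewrite normcE ltcR.
Qed.

(** The integral is bounded by the supremum of the test function, which is one of
    the seminorms. *)
Lemma regular_tempered (f : E -> R[i]) : is_schwartz f -> is_tempered (regular f).
Proof.
move=> sf; have df := is_schwartz_decaying sf.
have dM (chi : Schwartz R N) := decaying_schwartzM sf (schwartzP chi).
have lin c (chi psi : Schwartz R N) :
    regular f (c *: chi + psi) = c * regular f chi + regular f psi.
  rewrite /regular -(integralCZ c (dM chi)) -(integralCD (decayingZ c (dM chi)) (dM psi)).
  by apply: eq_integralC => x; rewrite schwartz_linE; ring.
split=> // chi; have [cf [M fM]] := df.
have M0 : 0 <= M.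
  by have := le_trans (normc_ge0 _) (fM 0); rewrite pmulr_lge0// decay_gt0.
pose K := M * (2 * \int[lebesgue_tuple R N]_t decay (row_of_tuple t)).
have K0 : 0 <= K.
  rewrite /K mulr_ge0// mulr_ge0//; apply: fine_ge0; apply: integral_ge0 => t _.
  by rewrite lee_fin decay_ge0.
move=> P /(@nbhs_ballP _ R[i]) [r /= r0 rP].
have rE : r = (complex.Re r)%:C by rewrite RRe_real// gtr0_real.
have q0 : 0 < complex.Re r by move: r0; rewrite rE ltcR.
have K1 : 0 < K + 1 by rewrite ltr_wpDl.
have d0 : 0 < complex.Re r / (K + 1) by rewrite divr_gt0.
apply: filterS (nbhs_uniform chi d0) => psi H; apply: rP.
rewrite /ball /= rE.
have -> : regular f chi - regular f psi = integralC (fun x => f x * (chi x - psi x)).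
  rewrite [LHS]addrC -mulN1r -lin; apply: eq_integralC => x.
  by rewrite schwartz_linE mulN1r addrC.
rewrite normcE ltcR; apply: (@le_lt_trans _ _ (complex.Re r / (K + 1) * K)); last first.
  by rewrite mulrAC ltr_pdivrMr// ltr_pM2l// ltrDl.
have := @le_normc_integralC R N (fun x => f x * (chi x - psi x)) (complex.Re r / (K + 1) * M).
rewrite -[_ * M * _]mulrA; apply.
- apply: (continuous_mulC cf).
  rewrite (_ : (fun x => _) = (-1 *: psi + chi : Schwartz R N)).
    exact: schwartz_continuous (schwartzP _).
  by apply/funext => x; rewrite schwartz_linE mulN1r addrC.
- move=> x; rewrite normcM mulrC -[leRHS]mulrA ler_pM ?normc_ge0//.
  exact/ltW/H.
Qed.
End regular_distributions.

(** * The kernel of a pseudodifferential operator *)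

Section symbols_and_kernels.
Variables (R : realType) (n : nat).
Local Notation E := 'rV[R]_n.
Local Notation EE := 'rV[R]_(n + n).
Local Notation c_ := (((2 * pi) ^- n)%:C : R[i]).

Lemma japanese_bracket (eta : E) : 1 <= 1 + euclidean_norm eta <= 2 * weight eta.
Proof.
rewrite lerDl sqrtr_ge0 /=.
have s0 : 0 <= \sum_i eta 0 i ^+ 2 by rewrite sumr_ge0// => i _; exact: sqr_ge0.
have := sqr_sqrtr s0; have := sqrtr_ge0 (\sum_i eta 0 i ^+ 2).
rewrite /euclidean_norm /weight; set q := Num.sqrt _; set s := \sum_i _.
move=> q0 qs; rewrite -qs; nra.
Qed.

(** Since [1 + |eta| <= 2 * weight eta], and a real exponent is at most an integer. *)
Lemma symbol_growth (a : EE -> R[i]) : symbols a -> continuous a /\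
  exists m, exists M : R, forall z, normc (a z) <= M * weight (rsubmx z : E) ^+ m.
Proof.
move=> [d _ [sa ba]]; split; first by have [] := sa [::].
have [C HC] := ba [::] [::].
pose m := `|Num.ceil d|%N; exists m, (`|C| * 2 ^+ m) => z.
have dm : d <= m%:R.
  apply: (le_trans (Num.Theory.ceil_ge d)); rewrite /m natr_absz ler_int; exact: ler_norm.
have := HC (lsubmx z) (rsubmx z); rewrite /= hsubmxK normcE lecR subr0 => aC.
apply: (le_trans aC); have /andP[b1 b2] := japanese_bracket (rsubmx z).
apply: (@le_trans _ _ (`|C| * (1 + euclidean_norm (rsubmx z)) `^ d)).
  by rewrite ler_wpM2r ?powR_ge0// ler_norm.
rewrite -mulrA ler_wpM2l// -exprMn.
apply: (le_trans (ler_powR b1 dm)); rewrite powR_mulrn ?(le_trans ler01)//.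
by rewrite lerXn2r// nnegrE ?(le_trans ler01 b1)// (le_trans (le_trans ler01 b1)).
Qed.

(** Rapid decay absorbs polynomial growth. *)
Lemma growth_schwartz_decaying N (g : 'rV[R]_N -> R[i]) m (M : R) (f : 'rV[R]_N -> R[i]) :
  continuous g -> (forall x, normc (g x) <= M * weight x ^+ m) ->
  is_schwartz f -> decaying (fun x => g x * f x).
Proof.
move=> cg gM sf; split; first exact: (continuous_mulC cg (schwartz_continuous sf)).
have M0 : 0 <= M.
  have := le_trans (normc_ge0 _) (gM 0); rewrite pmulr_lge0//.
  by rewrite exprn_gt0// weight_gt0.
have [M' fM] := schwartz_family_rapid ((is_schwartzE f).1 sf) (m + N).
exists (M * M') => x; rewrite normcM.
apply: (le_trans (ler_wpM2r (normc_ge0 _) (gM x))).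
rewrite -!mulrA ler_wpM2l//.
have H := weightX_decay x; have n0 := normc_ge0 (f x).
have := fM tt x; rewrite mulr1 exprD => Hf.
apply: (@le_trans _ _ ((weight x ^+ N * decay x) * (weight x ^+ m * normc (f x)))).
  by rewrite ler_peMl// mulr_ge0// weightX_ge0.
rewrite (_ : _ * _ * _ = weight x ^+ m * weight x ^+ N * normc (f x) * decay x); last by ring.
by rewrite ler_wpM2r ?decay_ge0.
Qed.

Lemma symbol_decaying (a : EE -> R[i]) (f : EE -> R[i]) : symbols a ->
  is_schwartz f -> decaying (fun z => a z * f z).
Proof.
move=> /symbol_growth[ca [m [M aM]]]; apply: (growth_schwartz_decaying ca (m := m) (M := M)) => z.
have M0 : 0 <= M.
  have := le_trans (normc_ge0 _) (aM z); rewrite pmulr_lge0//.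
  by rewrite exprn_gt0// weight_gt0.
apply: le_trans (aM z) _; rewrite ler_wpM2l// lerXn2r ?nnegrE ?weight_ge0//.
by rewrite -[z in leRHS]hsubmxK weight_row_mxr.
Qed.

Lemma symbol_section_decaying (a : EE -> R[i]) (f : E -> R[i]) x : symbols a ->
  is_schwartz f -> decaying (fun y => a (row_mx x y) * f y).
Proof.
move=> /symbol_growth[ca [m [M aM]]].
apply: (growth_schwartz_decaying (m := m) (M := M)) => [|y].
  exact: continuous_compC (@continuous_row_mxr R n x) ca.
by have := aM (row_mx x y); rewrite row_mxKr.
Qed.

(** Pulling back by the inverse of the change of variables of the kernel. *)
Definition shear (f : EE -> R[i]) (z : EE) : R[i] :=
  f (row_mx (lsubmx z + rsubmx z : E) (rsubmx z)).

Lemma schwartz_shear f : is_schwartz f -> is_schwartz (shear f).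
Proof.
move=> /is_schwartzE sf; apply/is_schwartzE.
have BK : @block_mx R n n n n 1%:M 0 1%:M 1%:M *m block_mx 1%:M 0 (- 1%:M) 1%:M = 1%:M.
  rewrite mulmx_block !(mulmx1, mul1mx, mulmx0, mul0mx) !(addr0, add0r) subrr.
  by rewrite -scalar_mx_block.
have := schwartz_family_affine 0 BK sf; congr schwartz_family.
apply/funext => _; apply/funext => z; rewrite add0r /shear; congr f.
by rewrite -[z in LHS]hsubmxK mul_row_block !mulmx1 mulmx0 add0r.
Qed.

Lemma psdo_kernelE (a : EE -> R[i]) (f : Schwartz R (n + n)) :
  psdo_kernel a f = c_ * integralC (fun z => a z * partial_fourier (shear f) z).
Proof.
have sf := schwartz_shear (schwartzP f).
rewrite /psdo_kernel /shearD /partial_fourierD /regular -/(shear f).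
by rewrite (to_schwartzE sf) to_schwartzE//; exact: schwartz_partial_fourier.
Qed.

Lemma psdo_kernel_linear (a : EE -> R[i]) : symbols a -> linear (psdo_kernel a).
Proof.
move=> sa k f g.
have sf := schwartz_shear (schwartzP f); have sg := schwartz_shear (schwartzP g).
have df := symbol_decaying sa (schwartz_partial_fourier sf).
have dg := symbol_decaying sa (schwartz_partial_fourier sg).
rewrite !psdo_kernelE /GRing.scale /= mulrCA -mulrDr; congr (_ * _).
rewrite -(integralCZ k df) -(integralCD (decayingZ k df) dg); apply: eq_integralC => z.
have -> : shear (k *: f + g : Schwartz R (n + n)) = fun w => k * shear f w + shear g w.
  by apply/funext => w; rewrite /shear schwartz_linE.
by rewrite (partial_fourier_lin _ _ sf sg); ring.
Qed.

Lemma schwartz_tensor (f g : E -> R[i]) : is_schwartz f -> is_schwartz g ->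
  is_schwartz (tensor f g).
Proof.
move=> /is_schwartzE sf /is_schwartzE sg; apply/is_schwartzE.
have := schwartz_family_tensor sf sg; congr schwartz_family.
by apply/funext => _; rewrite mulr1.
Qed.

(** The translation [t + y] in the first variable of the sheared tensor product
    becomes the oscillating factor of the operator. *)
Lemma partial_fourier_shear_tensor (psi phi : E -> R[i]) x y : is_schwartz psi ->
  partial_fourier (shear (tensor psi phi)) (row_mx x y) =
  expi (dot x y) * phi y * fourier psi x.
Proof.
move=> spsi; rewrite /partial_fourier row_mxKl row_mxKr.
have d := decaying_phaseN x (is_schwartz_decaying spsi).
have H := integralC_translation y d.
have -> : fourier psi x = integralC (fun t => expi (- dot (y + t) x) * psi (y + t)).
  by rewrite H; apply: eq_integralC => t; rewrite dotC.
have d' := decaying_translate y d.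
rewrite -(integralCZ _ d'); apply: eq_integralC => t.
rewrite /shear /tensor !(row_mxKl, row_mxKr) [y + t]addrC dotDl opprD expiD.
have e1 : expi (dot x y) * expi (- dot y x) = 1 by rewrite -expiD dotC subrr expi0.
by rewrite -[LHS]mul1r -e1; ring.
Qed.

(** Up to the factor [(2 pi)^-n], both sides are the double integral of
    [expi (dot x y) * a (x, y) * phi y * fourier psi x]: on the left because
    [F^-1 phi] is a Schwartz function, whose transform is [phi] by inversion, on
    the right by [partial_fourier_shear_tensor]. *)
Lemma psdo_conjugate_kernel (a : EE -> R[i]) (A : Tempered R n -> Tempered R n) :
  symbols a -> is_psdo a A -> is_conjugate_kernel A (psdo_kernel a).
Proof.
move=> sa [_ _ Areg] phi psi v vE.
have sphi := schwartzP phi; have spsi := schwartzP psi.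
have sT := schwartz_tensor spsi sphi.
have siphi := schwartz_inv_fourier sphi.
have vreg : v =1 regular (to_schwartz (inv_fourier phi)).
  move=> chi; rewrite vE /inv_fourierD /regular (to_schwartzE siphi).
  rewrite (to_schwartzE (schwartz_inv_fourier (schwartzP chi))).
  exact: (inv_fourier_multiplication (is_schwartz_decaying sphi) (is_schwartz_decaying (schwartzP chi))).
rewrite /fourierD (Areg _ _ vreg) /regular (to_schwartzE siphi) (to_schwartzE (schwartz_fourier spsi)).
rewrite psdo_kernelE (to_schwartzE sT).
have dh := symbol_decaying sa (schwartz_partial_fourier (schwartz_shear sT)).
rewrite (integralC_row_mx dh) -(integralC_row_mxZ dh); apply: eq_integralC => x.
rewrite /psdo_fun fourier_inv_fourier// -mulrA; congr (_ * _); rewrite mulrC.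
have d1 := decaying_phase x (symbol_section_decaying x sa sphi).
rewrite (_ : integralC (fun eta => _) = integralC (fun y => expi (dot x y) * (a (row_mx x y) * phi y))).
  rewrite -(integralCZ _ d1); apply: eq_integralC => y.
  by rewrite (partial_fourier_shear_tensor _ _ _ spsi); ring.
by apply: eq_integralC => y; rewrite mulrA.
Qed.

End symbols_and_kernels.

(** * Tubes around compact sets *)

Section tubes.
Variables (R : realType) (n : nat).
Local Notation E := 'rV[R]_n.
Local Notation EE := 'rV[R]_(n + n).

Lemma continuous_pair_row : continuous (fun p : E * E => row_mx p.1 p.2 : EE).
Proof.
move=> [x y] W /(@nbhs_ballP _ EE)[r /= r0 rW].
have r2 : 0 < r / 2 by rewrite divr_gt0.
exists (ball x (r / 2), ball y (r / 2)); first by split; exact: nbhsx_ballx.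
move=> [x' y'] /=; rewrite -!ball_normE /= => -[xx yy]; apply: rW.
rewrite -ball_normE /= opp_row_mx add_row_mx.
apply: (@le_lt_trans _ _ (r / 2)); last by lra.
by apply: norm_row_mx; exact: ltW.
Qed.

Lemma open_row_near (W : set EE) (x y : E) : open W -> W (row_mx x y) ->
  nbhs (x, y) [set p : E * E | W (row_mx p.1 p.2)].
Proof. by move=> oW Wxy; apply: continuous_pair_row; exact: open_nbhs_nbhs. Qed.

(** Compactness makes the neighbourhoods of [y] attached to the points of [B]
    uniform. *)
Lemma tube_left (W : set EE) (B : set E) (y : E) : open W -> compact B ->
  (forall x, B x -> W (row_mx x y)) ->
  \forall y' \near y, forall x, B x -> W (row_mx x y').
Proof.
move=> oW /compact_near_coveringP cB BW.
apply: (cB E (nbhs y) (fun y' x => W (row_mx x y'))) => x Bx.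
by apply: open_row_near => //; exact: BW.
Qed.

Lemma tube_right (W : set EE) (B : set E) (x : E) : open W -> compact B ->
  (forall y, B y -> W (row_mx x y)) ->
  \forall x' \near x, forall y, B y -> W (row_mx x' y).
Proof.
move=> oW /compact_near_coveringP cB BW.
apply: (cB E (nbhs x) (fun x' y => W (row_mx x' y))) => y By.
(* [near_covering] takes the point of the compact set first, hence the swap. *)
have [[P Q] [/= nP nQ] PQ] := open_row_near oW (BW _ By).
by exists (Q, P) => // -[y' x'] /= [Qy Px]; exact: (PQ (x', y')).
Qed.

Lemma compact_pair_row (B C : set E) : compact B -> compact C ->
  compact [set z : EE | B (lsubmx z) /\ C (rsubmx z)].
Proof.
move=> cB cC; have := continuous_compact (continuous_subspaceT continuous_pair_row)
  (compact_setX cB cC).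
congr compact; apply/seteqP; split=> [_ [[x y] [/= Bx Cy] <-]|z [Bz Cz]].
  by rewrite /= row_mxKl row_mxKr.
by exists (lsubmx z, rsubmx z) => //; rewrite /= hsubmxK.
Qed.

(** A point outside the composite has a neighbourhood outside it, by
    [tube_right]. *)
Lemma closed_compose (K : set EE) (B : set E) : closed K -> compact B -> closed (compose K B).
Proof.
move=> clK cB; rewrite -[compose K B]setCK; apply: open_closedC.
rewrite openE => x xKB; rewrite /interior.
have oK : open (~` K) by exact: closed_openC.
have BK y : B y -> (~` K) (row_mx x y) by move=> By Kxy; apply: xKB; exists y.
by apply: filterS (tube_right oK cB BK) => x' H [y By Kxy]; exact: (H y By Kxy).
Qed.

End tubes.

(** * The support of the image *)

Section support.
Variables (R : realType) (n : nat).
Local Notation E := 'rV[R]_n.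
Local Notation EE := 'rV[R]_(n + n).

Lemma smooth_phase (z : E) : smooth (fun x : E => expi (- dot x z)).
Proof.
apply: (@smooth_algebra _ _ [set fun x : E => expi (- dot x z)]); last exact: algebra_in.
move=> _ ->; split=> [|j]; first exact: continuous_phase.
exists (fun x => (0 +i* (- dot (delta_mx 0 j) z)) * expi (- dot x z)).
by split; [apply: algebraM; [exact: algebra_cst|exact: algebra_in]|exact: is_directional_phase].
Qed.

(** The fundamental lemma of the calculus of variations, through Fourier inversion:
    testing with plane waves times a plateau function [b] shows that the Fourier
    transform of [b * h] is zero. *)
Lemma schwartz_annihilated (h : E -> R[i]) (c : E) (r : R) : 0 < r -> is_schwartz h ->
  (forall phi : Schwartz R n, (forall x, phi x != 0 -> `|x - c| <= 2 * r) ->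
    integralC (fun x => phi x * h x) = 0) ->
  forall x, `|x - c| <= r -> h x = 0.
Proof.
move=> r0 sh hphi x xc; have [b [sb _ b1 br]] := plateau_exists c r0.
have br' y : (b y)%:C != 0 :> R[i] -> `|y - c| <= 2 * r.
  by move=> by0; apply: br; apply: contra by0 => /eqP->.
have sbh := is_schwartzM (bump_bounded_partials sb br') sh.
have F0 xi : fourier (fun y => (b y)%:C * h y) xi = 0.
  have pr y : expi (- dot y xi) * (b y)%:C != 0 -> `|y - c| <= 2 * r.
    by rewrite mulf_eq0 negb_or => /andP[_ /br'].
  have sp := bump_schwartz (smoothM (smooth_phase xi) sb) pr.
  have := hphi (to_schwartz (fun y => expi (- dot y xi) * (b y)%:C)).
  rewrite to_schwartzE// => <-//; apply: eq_integralC => y.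
  by rewrite mulrA.
have := fourier_inv_fourier sbh => /(congr1 (fun f => f x)).
rewrite b1// mul1r => <-.
have -> : inv_fourier (fun y => (b y)%:C * h y) = fun y => 0 * inv_fourier (fun y => (b y)%:C * h y) y.
  by apply/funext => y; rewrite inv_fourierE F0 !mulr0.
have sv := schwartz_inv_fourier sbh.
have d := decaying_phaseN x (is_schwartz_decaying sv).
rewrite /fourier -[RHS](mul0r (integralC (fun t => expi (- dot t x) * inv_fourier (fun y => (b y)%:C * h y) t))).
by rewrite -(integralCZ 0 d); apply: eq_integralC => t; rewrite mulrCA.
Qed.

Lemma fourier_lin c (f g : E -> R[i]) : is_schwartz f -> is_schwartz g ->
  fourier (fun x => c * f x + g x) = fun x => c * fourier f x + fourier g x.
Proof.
have d (h : E -> R[i]) (x : E) (sh : is_schwartz h) :=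
  decaying_phaseN x (is_schwartz_decaying sh).
move=> sf sg; apply/funext => x; rewrite /fourier -(integralCZ c (d f x sf)).
rewrite -(integralCD (decayingZ c (d f x sf)) (d g x sg)); apply: eq_integralC => t.
by ring.
Qed.

Lemma fourierD_linear (u : Tempered R n) : linear (fourierD u).
Proof.
move=> c f g; have sf := schwartzP f; have sg := schwartzP g.
rewrite /fourierD -tempered_lin; congr (tempered_fun u _); apply: schwartz_eq => x.
rewrite schwartz_linE (to_schwartzE (schwartz_fourier sf)) (to_schwartzE (schwartz_fourier sg)).
rewrite (to_schwartzE (schwartz_fourier (schwartzP (c *: f + g)))).
exact: (congr1 (fun F => F x) (fourier_lin c sf sg)).
Qed.

(** The function [h] vanishes near the support of [fourierD u], which is in general
    not compact, nor is the support of [h]. A dilated cutoff of [h] has compact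
    support off that of [fourierD u] and is killed by it; the remainder tends to
    zero in the Schwartz space, so the value at [h] is zero by continuity. *)
Lemma fourierD_flat (u : Tempered R n) (h : E -> R[i]) : is_schwartz h ->
  (forall x, supp (fourierD u) x -> exists2 r : R, 0 < r & forall y, `|y - x| <= r -> h y = 0) ->
  fourierD u (to_schwartz h) = 0.
Proof.
move=> sh h0.
have [b [sb _ b1 br]] := @plateau_exists R n 0 1 ltr01.
pose e (k : nat) : R := k.+1%:R^-1.
have br' x : (b x)%:C != 0 :> R[i] -> `|x - 0| <= 2 * 1.
  by move=> bx; apply: br; apply: contra bx => /eqP->.
have b00 : b 0 = 1 by rewrite b1// subrr normr0.
have sF := cutoff_family (bump_bounded_partials sb br') b00 sh.
have e0 k : 0 < e k by rewrite invr_gt0.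
have bk k x : (b (e k *: x))%:C != 0 :> R[i] -> `|x - 0| <= 2 / e k.
  move=> /br'; rewrite !subr0 normrZ gtr0_norm// => H.
  by rewrite ler_pdivlMr// mulrC -[2](mulr1).
have sbh k : is_schwartz (fun x => (b (e k *: x))%:C * h x).
  exact: (is_schwartzM (bump_bounded_partials (smooth_scale (e k) sb) (@bk k)) sh).
have inner k : fourierD u (to_schwartz (fun x => (b (e k *: x))%:C * h x)) = 0.
  apply: vanishes_off_supp; first exact: fourierD_linear.
    rewrite (to_schwartzE (sbh k)); apply: (@compact_closure_support _ _ _ 0 (2 / e k)) => x.
    by rewrite mulf_eq0 negb_or => /andP[/bk].
  rewrite (to_schwartzE (sbh k)) => x clx /h0[r r0 hr].
  have [y [/= ybh]] := clx _ (nbhsx_ballx (x : E) _ r0).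
  rewrite -ball_normE /= distrC => /ltW yr.
  by move: ybh; rewrite hr// mulr0 eqxx.
have e_cvg : e k @[k --> \oo] --> 0 by exact: cvg_harmonic.
apply: (@tempered_null_cst R n u e _ _ e_cvg (schwartz_family_fourier sF)) => k.
have sk := schwartz_family_is_schwartz k sF.
have := fourierD_linear u 1 (to_schwartz (fun x => (b (e k *: x))%:C * h x))
  (to_schwartz (fun x => (1 - (b (k.+1%:R^-1 *: x))%:C) * h x)).
rewrite inner scaler0 add0r {2}/fourierD (to_schwartzE sk) => <-.
congr (fourierD u _); apply: schwartz_eq => x.
by rewrite schwartz_linE (to_schwartzE sk) (to_schwartzE (sbh k)) (to_schwartzE sh) /e; ring.
Qed.

(** Weak-* duality turns the continuous functional [w |-> <F A w, psi>] into
    [w |-> <F w, h>] for one Schwartz function [h]. Against a Schwartz function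
    [phi] the kernel gives [int phi h = K (psi (x) phi)], which is zero as soon as
    [phi] is supported close to a point of the support of [F u], because the
    support of [psi (x) phi] then avoids that of the kernel. So [h] vanishes near
    the support of [F u], and [fourierD_flat] applies. *)
Lemma psdo_fourier_local (a : EE -> R[i]) (A : Tempered R n -> Tempered R n)
    (u : Tempered R n) (psi : Schwartz R n) : symbols a -> is_psdo a A ->
  compact (closure [set x | psi x != 0]) ->
  (forall xi eta, closure [set x | psi x != 0] xi -> supp (fourierD u) eta ->
    ~ supp (psdo_kernel a) (row_mx xi eta)) ->
  fourierD (A u) psi = 0.
Proof.
move=> sa pA cpsi disj; have [lA cA _] := pA; have spsi := schwartzP psi.
pose L (w : Tempered R n) : R[i] := A w (to_schwartz (fourier psi)).
have lL : linear L.
  by move=> c w w'; rewrite /L lA.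
have cL : continuous L.
  by move=> w; exact: (cvg_comp _ _ (cA w) (@evaluation_continuous R n _ (A w))).
have [g LE] := weak_star_functional lL cL.
have sg := schwartzP g; have sh := schwartz_inv_fourier sg.
pose h := inv_fourier g.
(* Since [fourier h = g]. *)
have -> : fourierD (A u) psi = fourierD u (to_schwartz h).
  by rewrite /fourierD -/(L u) LE (to_schwartzE sh) fourier_inv_fourier// to_schwartzK.
have hK (phi : Schwartz R n) : integralC (fun x => phi x * h x) =
    psdo_kernel a (to_schwartz (tensor psi phi)).
  have sphi := schwartzP phi; have siphi := schwartz_inv_fourier sphi.
  have Tv : regular (inv_fourier phi) \in @tempered R n by apply/asboolP; exact: regular_tempered.
  pose v := MkTempered Tv.
  have vE : v =1 inv_fourierD (regular phi).
    move=> chi; rewrite /= /inv_fourierD /regular (to_schwartzE (schwartz_inv_fourier (schwartzP chi))).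
    by rewrite (inv_fourier_multiplication (is_schwartz_decaying sphi)
      (is_schwartz_decaying (schwartzP chi))).
  rewrite -(psdo_conjugate_kernel sa pA psi vE) /fourierD -/(L v) LE /= /regular.
  exact: (inv_fourier_multiplication (is_schwartz_decaying sphi) (is_schwartz_decaying sg)).
apply: fourierD_flat => // eta eta_u.
have oW : open (~` supp (psdo_kernel a)) by apply: closed_openC; exact: closed_supp.
have BW xi : closure [set x | psi x != 0] xi -> (~` supp (psdo_kernel a)) (row_mx xi eta).
  by move=> xipsi; exact: disj.
have /(@nbhs_ballP _ E)[r /= r0 rW] := tube_left oW cpsi BW.
have r4 : 0 < r / 4 by rewrite divr_gt0.
exists (r / 4) => // y yeta; apply: (schwartz_annihilated r4 sh _ yeta) => phi phir.
rewrite hK; have sT := schwartz_tensor spsi (schwartzP phi).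
apply: (localization (psdo_kernel_linear sa) (compact_pair_row cpsi (@compact_cball _ _ eta (2 * (r / 4))))).
  move=> z /=; rewrite (to_schwartzE sT) /tensor mulf_eq0 negb_or => /andP[psiz phiz].
  by split; [exact: subset_closure|exact: phir].
move=> z [z1 z2]; apply: not_supp; rewrite -[z]hsubmxK.
apply: (rW (rsubmx z)) => //; rewrite -ball_normE /= distrC; apply: le_lt_trans z2 _; lra.
Qed.

Lemma psdo_fourier_support (a : EE -> R[i]) (A : Tempered R n -> Tempered R n)
    (u : Tempered R n) : symbols a -> is_psdo a A ->
  supp (fourierD (A u)) `<=` closure (compose (supp (psdo_kernel a)) (supp (fourierD u))).
Proof.
move=> sa pA xi xiu; apply: contrapT => nxi; apply: xiu.
exists (~` closure (compose (supp (psdo_kernel a)) (supp (fourierD u)))) => //; split.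
  by apply: closed_openC; exact: closed_closure.
move=> psi cpsi spsi; apply: (psdo_fourier_local sa pA cpsi) => z eta /spsi zC etau zK.
by apply: zC; apply: subset_closure; exists eta.
Qed.

End support.

Theorem theorem8p2 (R : realType) (n : nat) (a : 'rV[R]_(n + n) -> R[i])
    (A : Tempered R n -> Tempered R n) :
  symbols a -> is_psdo a A ->
  [/\ is_conjugate_kernel A (psdo_kernel a),
      forall u : Tempered R n,
        supp (fourierD (A u)) `<=`
        closure (compose (supp (psdo_kernel a)) (supp (fourierD u))) &
      forall u : Tempered R n,
        compact (supp (fourierD u)) ->
        closed (compose (supp (psdo_kernel a)) (supp (fourierD u)))].
Proof.
move=> sa pA; split=> [|u|u cu].
- exact: psdo_conjugate_kernel.
- exact: psdo_fourier_support.
- exact: closed_compose (@closed_supp _ _ _) cu.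
Qed.
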